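(* Let $d\ge1$, $0<\rho<\eta<1$, $s>0$, and let $\Lambda,M\subset\mathbb{R}^d$ be $\rho$-separated. For every $\tau>0$ there exist $L>0$ and a continuous linear map $Q_{\tau,L}:X_{\tau,L}(\Lambda,M)\to\mathcal{S}(\mathbb{R}^d)$ such that, if $(\alpha,\beta)\in X_{\tau,L}(\Lambda,M)$ and $f=Q_{\tau,L}(\alpha,\beta)$, then $(-\Delta)^sf\in\mathcal{S}(\mathbb{R}^d)$ and $$f(\lambda)=\alpha(\lambda)\ \text{ for }\lambda\in\Lambda,\qquad (-\Delta)^sf(\mu)=\beta(\mu)\ \text{ for }\mu\in M.$$ Moreover, for every multiindex $\nu\in\mathbb{Z}_+^d$ there exist constants $C_\nu,c_\nu>0$ such that, for all $(\alpha,\beta)\in X_{\tau,L}(\Lambda,M)$, with $f=Q_{\tau,L}(\alpha,\beta)$, and all $x\in\mathbb{R}^d$, $$|\partial^\nu f(x)|+|\partial^\nu(-\Delta)^sf(x)|\le C_\nu\|(\alpha,\beta)\|_{X_{\tau,L}}e^{-c_\nu|x|^\eta}.$$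
   Context: A set in $\mathbb{R}^d$ is discrete if it has no accumulation point in $\mathbb{R}^d$. A discrete set $\Gamma\subset\mathbb{R}^d$ is $\rho$-separated if there exist $A,B>0$ such that $\operatorname{dist}(\gamma,\Gamma\setminus\{\gamma\})\ge Ae^{-B|\gamma|^\rho}$ for all $\gamma\in\Gamma$ (the distance to the empty set being $+\infty$). The sets $\Lambda$ and $M$ are not required to be disjoint. The Fourier transform is $\widehat f(\xi)=\int_{\mathbb{R}^d}f(x)e^{-2\pi i\xi\cdot x}\,dx$. For $s>0$ and $f$ in the Schwartz space $\mathcal{S}(\mathbb{R}^d)$ (complex-valued functions), $(-\Delta)^sf$ is the smooth function defined by $\widehat{(-\Delta)^sf}(\xi)=|\xi|^{2s}\widehat f(\xi)$. For $\tau,L>0$ (and the fixed $\rho,\eta$), $X_{\tau,L}(\Lambda,M)$ is the Banach space of pairs $(\alpha,\beta)$ of functions $\alpha:\Lambda\to\mathbb{C}$, $\beta:M\to\mathbb{C}$ with $$\|(\alpha,\beta)\|_{X_{\tau,L}}=\sup_{\lambda\in\Lambda}e^{\tau|\lambda|^\eta+L|\lambda|^\rho}|\alpha(\lambda)|+\sup_{\mu\in M}e^{\tau|\mu|^\eta}|\beta(\mu)|<\infty.$$ $\mathbb{Z}_+$ denotes the nonnegative integers. *)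

(* Defs.v *)
From HB Require Import structures.
From mathcomp Require Import all_boot all_order all_algebra.
From mathcomp Require Import all_classical all_reals all_analysis.
From mathcomp Require Import complex.
Set Implicit Arguments.
Unset Strict Implicit.
Unset Printing Implicit Defensive.
Import Order.TTheory GRing.Theory Num.Theory.
Import numFieldNormedType.Exports.
Local Open Scope classical_set_scope.
Local Open Scope complex_scope.
Local Open Scope ring_scope.

(* The real-valued modulus; `|z| : R[i] is convertible to (cmod z)%:C. *)
Definition cmod (R : realType) (z : R[i]) : R := ComplexField.Normc.normc z.

(* The library norm on 'rV[R]_d is the sup norm, hence these. *)
Definition dotp (R : realType) (d : nat) (x y : 'rV[R]_d) : R :=
  \sum_(i < d) x ord0 i * y ord0 i.

Definition eucl (R : realType) (d : nat) (x : 'rV[R]_d) : R :=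
  Num.sqrt (dotp x x).

Definition is_discrete (R : realType) (d : nat) (G : set 'rV[R]_d) : Prop :=
  limit_point G = set0.

(* ereal_inf set0 = +oo. *)
Definition eucl_dist (R : realType) (d : nat) (x : 'rV[R]_d)
    (A : set 'rV[R]_d) : \bar R :=
  ereal_inf [set (eucl (x - y))%:E | y in A].

Definition rho_separated (R : realType) (d : nat) (rho : R)
    (G : set 'rV[R]_d) : Prop :=
  is_discrete G /\
  exists A B : R, [/\ 0 < A, 0 < B &
    forall g, G g ->
      ((A * expR (- B * eucl g `^ rho))%:E <= eucl_dist g (G `\ g))%E].

(* R[i] carries no normed R-module structure, so a complex-valued function is
   differentiated through its real and imaginary parts. *)
Definition re_fun (R : realType) (T : Type) (f : T -> R[i]) : T -> R :=
  fun x => complex.Re (f x).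

Definition im_fun (R : realType) (T : Type) (f : T -> R[i]) : T -> R :=
  fun x => complex.Im (f x).

Definition basis_vec (R : realType) (d : nat) (i : 'I_d) : 'rV[R]_d :=
  delta_mx ord0 i.

Definition partial (R : realType) (d : nat) (i : 'I_d)
    (f : 'rV[R]_d -> R[i]) : 'rV[R]_d -> R[i] :=
  fun x => ('D_(basis_vec R i) (re_fun f) x)
           +i* ('D_(basis_vec R i) (im_fun f) x).

Definition partials (R : realType) (d : nat) (s : seq 'I_d)
    (f : 'rV[R]_d -> R[i]) : 'rV[R]_d -> R[i] :=
  foldr (@partial R d) f s.

Definition dmulti (R : realType) (d : nat) (nu : {ffun 'I_d -> nat})
    (f : 'rV[R]_d -> R[i]) : 'rV[R]_d -> R[i] :=
  partials (flatten [seq nseq (nu i) i | i <- enum 'I_d]) f.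

Definition smooth (R : realType) (d : nat) (f : 'rV[R]_d -> R[i]) : Prop :=
  forall s : seq 'I_d,
    [/\ continuous (re_fun (partials s f)),
        continuous (im_fun (partials s f)) &
        forall (i : 'I_d) (x : 'rV[R]_d),
          derivable (re_fun (partials s f)) x (basis_vec R i) /\
          derivable (im_fun (partials s f)) x (basis_vec R i)].

Definition schwartz_term (R : realType) (d : nat) (k : nat)
    (nu : {ffun 'I_d -> nat}) (f : 'rV[R]_d -> R[i]) (x : 'rV[R]_d) : R :=
  (1 + eucl x) ^+ k * cmod (dmulti nu f x).

Definition is_schwartz (R : realType) (d : nat) (f : 'rV[R]_d -> R[i]) : Prop :=
  smooth f /\
  forall (k : nat) (nu : {ffun 'I_d -> nat}),
    has_ubound (range (schwartz_term k nu f)).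

(* Lebesgue measure on R^n, as the n-fold product of lebesgue_measure. *)
Section lebesgue_tuple.
Variable R : realType.
Local Notation RT := (measurableTypeR R).

Definition tuple_cons (n : nat) (p : n.-tuple RT * RT) : n.+1.-tuple RT :=
  [the n.+1.-tuple RT of p.2 :: p.1].

Lemma measurable_tuple_cons (n : nat) :
  measurable_fun [set: n.-tuple RT * RT] (@tuple_cons n).
Proof. exact: measurable_cons. Qed.

Definition tuple_measure_succ (n : nat)
    (m : {measure set (n.-tuple RT) -> \bar R}) :
    set (n.+1.-tuple RT) -> \bar R :=
  pushforward (m \x (@lebesgue_measure R))%E (@tuple_cons n).

Section succ_measure.
Variables (n : nat) (m : {measure set (n.-tuple RT) -> \bar R}).

Let succ0 : tuple_measure_succ m set0 = 0%E.
Proof. by rewrite /tuple_measure_succ /pushforward preimage_set0 measure0. Qed.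

Let succ_ge0 A : (0 <= tuple_measure_succ m A)%E.
Proof. by rewrite /tuple_measure_succ /pushforward; exact: measure_ge0. Qed.

Let succ_sigma_additive : semi_sigma_additive (tuple_measure_succ m).
Proof.
have mc := @measurable_tuple_cons n.
move=> F mF tF mUF; rewrite /tuple_measure_succ /pushforward preimage_bigcup.
apply: measure_semi_sigma_additive.
- by move=> k; rewrite -[X in measurable X]setTI; exact: mc.
- apply/trivIsetP => /= i j _ _ ij; rewrite -preimage_setI.
  by move/trivIsetP : tF => /(_ _ _ _ _ ij) ->//; rewrite preimage_set0.
- by rewrite -preimage_bigcup -[X in measurable X]setTI; exact: mc.
Qed.

HB.instance Definition _ := isMeasure.Build _ _ _ (tuple_measure_succ m)
  succ0 succ_ge0 succ_sigma_additive.
End succ_measure.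

Fixpoint lebesgue_tuple (n : nat) : {measure set (n.-tuple RT) -> \bar R} :=
  match n with
  | 0 => \d_([tuple] : 0.-tuple RT)
  | n'.+1 => tuple_measure_succ (lebesgue_tuple n')
  end.

Definition row_of (n : nat) (t : n.-tuple RT) : 'rV[R]_n :=
  \row_i tnth t i.

Definition cintegrable (n : nat) (f : 'rV[R]_n -> R[i]) : Prop :=
  (lebesgue_tuple n).-integrable setT (fun t => (re_fun f (row_of t))%:E) /\
  (lebesgue_tuple n).-integrable setT (fun t => (im_fun f (row_of t))%:E).

Definition cintegral (n : nat) (f : 'rV[R]_n -> R[i]) : R[i] :=
  Rintegral (lebesgue_tuple n) setT (fun t => re_fun f (row_of t))
  +i* Rintegral (lebesgue_tuple n) setT (fun t => im_fun f (row_of t)).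

End lebesgue_tuple.

Definition cis (R : realType) (t : R) : R[i] := cos t +i* sin t.

Definition fourier (R : realType) (d : nat) (f : 'rV[R]_d -> R[i])
    (xi : 'rV[R]_d) : R[i] :=
  cintegral (fun x => f x * cis (- (2 * pi * dotp xi x))).

Definition is_frac_lap (R : realType) (d : nat) (s : R)
    (f g : 'rV[R]_d -> R[i]) : Prop :=
  [/\ smooth g, cintegrable g &
      forall xi, fourier g xi = (eucl xi `^ (2 * s))%:C * fourier f xi].

(* "The" function g with is_frac_lap s f g.  For s > 0 and f Schwartz it exists
   (the inverse Fourier transform of |xi|^{2s} times that of f, which is
   O(|x|^{-d-2s})) and is unique by Fourier inversion; the default value 0 of
   xget is not used in that case. *)
Definition frac_lap (R : realType) (d : nat) (s : R)
    (f : 'rV[R]_d -> R[i]) : 'rV[R]_d -> R[i] :=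
  xget 0 [set g | is_frac_lap s f g].

Section range_sup.
Variables (R : realType) (T : Type).
Implicit Types F : T -> R.

Lemma range_supP F t : has_ubound (range F) -> F t <= sup (range F).
Proof. by move=> hF; apply: ub_le_sup => //; exists t. Qed.

Lemma range_sup_le F c : 0 <= c -> (forall t, F t <= c) -> sup (range F) <= c.
Proof.
move=> c0 Fc; have [->|/set0P ne] := eqVneq (range F) set0.
  by rewrite sup0.
by apply: ge_sup => // _ [t _ <-].
Qed.

Lemma range_sup_ge0 F : has_ubound (range F) -> (forall t, 0 <= F t) ->
  0 <= sup (range F).
Proof.
move=> hF F0; have [->|/set0P [_ [t _ _]]] := eqVneq (range F) set0.
  by rewrite sup0.
exact: le_trans (F0 t) (range_supP _ hF).
Qed.

End range_sup.

Section cmod_theory.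
Variable R : realType.
Implicit Types z w : R[i].

Lemma cmod_ge0 z : 0 <= cmod z.
Proof. by case: z => a b; exact: sqrtr_ge0. Qed.

Lemma cmodM z w : cmod (z * w) = cmod z * cmod w.
Proof. exact: ComplexField.Normc.normcM. Qed.

Lemma cmodD z w : cmod (z + w) <= cmod z + cmod w.
Proof. exact: le_normcD. Qed.

Lemma cmod0 : cmod (0 : R[i]) = 0.
Proof. exact: ComplexField.Normc.normc0. Qed.

Lemma cmod_eq0 z : cmod z = 0 -> z = 0.
Proof. exact: ComplexField.Normc.eq0_normc. Qed.

Lemma cmodV z : cmod z^-1 = (cmod z)^-1.
Proof. exact: ComplexField.Normc.normcV. Qed.

End cmod_theory.

Section weighted_space.
Variables (R : realType) (d : nat) (rho eta tau L : R)
  (Lam M : set 'rV[R]_d).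
Local Notation V := ((Lam -> R[i]) * (M -> R[i]))%type.
Implicit Types u v : V.

Definition lam_term u (l : Lam) : R :=
  expR (tau * eucl (val l) `^ eta + L * eucl (val l) `^ rho) * cmod (u.1 l).

Definition mu_term u (m : M) : R :=
  expR (tau * eucl (val m) `^ eta) * cmod (u.2 m).

(* The supremum of the empty set is 0 here (sup0). *)
Definition weighted_norm u : R :=
  sup (range (lam_term u)) + sup (range (mu_term u)).

Definition weighted : pred V :=
  [pred u | `[< has_ubound (range (lam_term u)) /\
                has_ubound (range (mu_term u)) >]].

Let lam_lin (a : R[i]) u v l :
  lam_term (a *: u + v) l <= cmod a * lam_term u l + lam_term v l.
Proof.
rewrite /lam_term mulrCA -mulrDr ler_wpM2l ?expR_ge0//.
by rewrite -cmodM; exact: cmodD.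
Qed.

Let mu_lin (a : R[i]) u v m :
  mu_term (a *: u + v) m <= cmod a * mu_term u m + mu_term v m.
Proof.
rewrite /mu_term mulrCA -mulrDr ler_wpM2l ?expR_ge0//.
by rewrite -cmodM; exact: cmodD.
Qed.

Let lam_ge0 u l : 0 <= lam_term u l.
Proof. by rewrite mulr_ge0 ?expR_ge0 ?cmod_ge0. Qed.

Let mu_ge0 u m : 0 <= mu_term u m.
Proof. by rewrite mulr_ge0 ?expR_ge0 ?cmod_ge0. Qed.

Let lam_term0 l : lam_term 0 l = 0.
Proof. by rewrite /lam_term [cmod _]cmod0 mulr0. Qed.

Let mu_term0 m : mu_term 0 m = 0.
Proof. by rewrite /mu_term [cmod _]cmod0 mulr0. Qed.

Fact weighted_submod : submod_closed weighted.
Proof.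
split; first (apply/asboolP; split; exists 0 => _ [t _ <-]).
- by rewrite lam_term0.
- by rewrite mu_term0.
move=> a u v /asboolP[u1 u2] /asboolP[v1 v2]; apply/asboolP; split.
- exists (cmod a * sup (range (lam_term u)) + sup (range (lam_term v))).
  move=> _ [l _ <-]; apply: le_trans (lam_lin a u v l) _.
  by apply: lerD; [apply: ler_wpM2l; [exact: cmod_ge0|]|]; exact: range_supP.
- exists (cmod a * sup (range (mu_term u)) + sup (range (mu_term v))).
  move=> _ [l _ <-]; apply: le_trans (mu_lin a u v l) _.
  by apply: lerD; [apply: ler_wpM2l; [exact: cmod_ge0|]|]; exact: range_supP.
Qed.

HB.instance Definition _ :=
  GRing.isSubmodClosed.Build R[i] V weighted weighted_submod.

Record weighted_space := WeightedSpace {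
  weighted_pair : V;
  weighted_pairP : weighted_pair \in weighted }.

HB.instance Definition _ := [isSub for weighted_pair].
HB.instance Definition _ := [Choice of weighted_space by <:].
HB.instance Definition _ := [SubChoice_isSubLmodule of weighted_space by <:].

Implicit Types U W : weighted_space.

Let wP U : has_ubound (range (lam_term (val U))) /\
           has_ubound (range (mu_term (val U))).
Proof. by case: U => u /= /asboolP. Qed.

Let norm_lin (a : R[i]) U W :
  weighted_norm (val (a *: U + W)) <=
  cmod a * weighted_norm (val U) + weighted_norm (val W).
Proof.
have [u1 u2] := wP U; have [v1 v2] := wP W.
rewrite [val _](_ : _ = a *: val U + val W); last by rewrite linearP.
rewrite /weighted_norm mulrDr addrACA; apply: lerD; apply: range_sup_le.
- rewrite addr_ge0 ?mulr_ge0 ?cmod_ge0//; apply: range_sup_ge0 => //; exact: lam_ge0.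
- move=> l; apply: le_trans (lam_lin a _ _ l) _.
  by apply: lerD; [apply: ler_wpM2l; [exact: cmod_ge0|]|]; exact: range_supP.
- rewrite addr_ge0 ?mulr_ge0 ?cmod_ge0//; apply: range_sup_ge0 => //; exact: mu_ge0.
- move=> l; apply: le_trans (mu_lin a _ _ l) _.
  by apply: lerD; [apply: ler_wpM2l; [exact: cmod_ge0|]|]; exact: range_supP.
Qed.

Let norm0 : weighted_norm (val (0 : weighted_space)) = 0.
Proof.
apply/eqP; rewrite eq_le; apply/andP; split.
  rewrite -[leRHS](addr0 0); apply: lerD; apply: range_sup_le => // t.
  - by rewrite raddf0 lam_term0.
  - by rewrite raddf0 mu_term0.
have [u1 u2] := wP 0.
by rewrite addr_ge0// range_sup_ge0.
Qed.

Let normD U W :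
  (weighted_norm (val (U + W)))%:C <=
  (weighted_norm (val U))%:C + (weighted_norm (val W))%:C.
Proof.
rewrite -rmorphD lecR; have := norm_lin 1 U W.
by rewrite scale1r [cmod 1]ComplexField.Normc.normc1 mul1r.
Qed.

Let normZ_le (a : R[i]) U :
  weighted_norm (val (a *: U)) <= cmod a * weighted_norm (val U).
Proof. by have := norm_lin a U 0; rewrite norm0 !addr0. Qed.

Let normZ (a : R[i]) U :
  (weighted_norm (val (a *: U)))%:C = `|a| * (weighted_norm (val U))%:C.
Proof.
have -> : `|a| = (cmod a)%:C by [].
rewrite -rmorphM; congr (_%:C); apply/eqP; rewrite eq_le normZ_le/=.
have [->|a0] := eqVneq a 0; first by rewrite cmod0 mul0r scale0r norm0.
have ca0 : 0 < cmod a.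
  rewrite lt_neqAle cmod_ge0 andbT eq_sym; apply: contra a0 => /eqP h.
  by apply/eqP; exact: cmod_eq0.
have := normZ_le a^-1 (a *: U); rewrite scalerA mulVf// scale1r cmodV.
by rewrite mulrC ler_pdivlMr// mulrC.
Qed.

Let norm_eq0 U : (weighted_norm (val U))%:C = 0 -> U = 0.
Proof.
move=> /(@complexI R _ 0) /eqP; have [u1 u2] := wP U.
rewrite paddr_eq0; [|by apply: range_sup_ge0 => //; exact: lam_ge0
                    |by apply: range_sup_ge0 => //; exact: mu_ge0].
move=> /andP[/eqP s1 /eqP s2]; apply: val_inj; rewrite raddf0.
case: U u1 u2 s1 s2 => -[al be] /= _ u1 u2 s1 s2.
congr pair; apply/funext => t; apply: cmod_eq0; apply/eqP; rewrite eq_le cmod_ge0 andbT.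
- by have := range_supP t u1; rewrite s1 /lam_term /= pmulr_rle0 ?expR_gt0.
- by have := range_supP t u2; rewrite s2 /mu_term /= pmulr_rle0 ?expR_gt0.
Qed.

HB.instance Definition _ := Lmodule_isNormed.Build R[i] weighted_space
  normD normZ norm_eq0.

End weighted_space.

Section schwartz_space.
Variables (R : realType) (d : nat).
Implicit Types f g : 'rV[R]_d -> R[i].

Let re_lin (a : R[i]) f g : re_fun (a *: f + g) =
  complex.Re a \*: re_fun f + ((- complex.Im a) \*: im_fun f + re_fun g).
Proof.
apply/funext => x; rewrite /re_fun /im_fun /= !fctE /=.
by case: a (f x) (g x) => [a b] [p q] [p' q'] /=; rewrite scaleNr -addrA.
Qed.

Let im_lin (a : R[i]) f g : im_fun (a *: f + g) =
  complex.Re a \*: im_fun f + (complex.Im a \*: re_fun f + im_fun g).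
Proof.
apply/funext => x; rewrite /re_fun /im_fun /= !fctE /=.
by case: a (f x) (g x) => [a b] [p q] [p' q'] /=; rewrite -addrA.
Qed.

Let derivable3 (a b : R) (h1 h2 h3 : 'rV[R]_d -> R) x v :
  derivable h1 x v -> derivable h2 x v -> derivable h3 x v ->
  derivable (a \*: h1 + (b \*: h2 + h3)) x v.
Proof.
move=> d1 d2 d3; apply: derivableD; first exact: derivableZ.
by apply: derivableD => //; exact: derivableZ.
Qed.

Let derive3 (a b : R) (h1 h2 h3 : 'rV[R]_d -> R) x v :
  derivable h1 x v -> derivable h2 x v -> derivable h3 x v ->
  'D_v (a \*: h1 + (b \*: h2 + h3)) x =
  a * 'D_v h1 x + (b * 'D_v h2 x + 'D_v h3 x).
Proof.
move=> d1 d2 d3.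
have e2 : derivable (b \*: h2) x v by exact: derivableZ.
have e1 : derivable (a \*: h1) x v by exact: derivableZ.
by rewrite (deriveD e1 (derivableD e2 d3)) (deriveD e2 d3) !deriveZ.
Qed.

Let continuous3 (a b : R) (h1 h2 h3 : 'rV[R]_d -> R) :
  continuous h1 -> continuous h2 -> continuous h3 ->
  continuous (a \*: h1 + (b \*: h2 + h3)).
Proof.
move=> c1 c2 c3 x.
exact: (cvgD (cvgZl_tmp (c1 x)) (cvgD (cvgZl_tmp (c2 x)) (c3 x))).
Qed.

Let partials_lin (a : R[i]) f g s : smooth f -> smooth g ->
  partials s (a *: f + g) = a *: partials s f + partials s g.
Proof.
move=> sf sg; elim: s => [//|i s IH].
have [_ _ df] := sf s; have [_ _ dg] := sg s.
rewrite /partials /= -/(partials s _) -/(partials s f) -/(partials s g) IH.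
apply/funext => x; have [f1 f2] := df i x; have [g1 g2] := dg i x.
rewrite /partial re_lin im_lin !derive3//.
rewrite [RHS](_ : _ = a * partial i (partials s f) x
                      + partial i (partials s g) x)// /partial.
by case: a {IH} => a b /=; congr (_ +i* _); rewrite addrA ?mulNr.
Qed.

Fact smooth_lin (a : R[i]) f g : smooth f -> smooth g -> smooth (a *: f + g).
Proof.
move=> sf sg s; rewrite partials_lin// re_lin im_lin.
have [cf1 cf2 df] := sf s; have [cg1 cg2 dg] := sg s.
split; [exact: continuous3|exact: continuous3|] => i x.
have [f1 f2] := df i x; have [g1 g2] := dg i x.
by split; exact: derivable3.
Qed.

Let partial0 (i : 'I_d) : partial i (0 : 'rV[R]_d -> R[i]) = 0.
Proof.
apply/funext => x; rewrite /partial.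
have -> : re_fun (0 : 'rV[R]_d -> R[i]) = cst 0 by [].
have -> : im_fun (0 : 'rV[R]_d -> R[i]) = cst 0 by [].
by rewrite derive_cst.
Qed.

Let partials0 s : partials s (0 : 'rV[R]_d -> R[i]) = 0.
Proof.
by elim: s => // i s IH; rewrite /partials /= -/(partials s _) IH partial0.
Qed.

Let smooth0 : smooth (0 : 'rV[R]_d -> R[i]).
Proof.
move=> s; rewrite partials0.
have -> : re_fun (0 : 'rV[R]_d -> R[i]) = cst 0 by [].
have -> : im_fun (0 : 'rV[R]_d -> R[i]) = cst 0 by [].
by split => [||i x]; [exact: cst_continuous|exact: cst_continuous|].
Qed.

Definition schwartz_pred : pred ('rV[R]_d -> R[i]) :=
  [pred f | `[< is_schwartz f >]].

Fact schwartz_submod : submod_closed schwartz_pred.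
Proof.
split; first (apply/asboolP; split; first exact: smooth0).
  move=> k nu; exists 0 => _ [x _ <-].
  by rewrite /schwartz_term /dmulti partials0 cmod0 mulr0.
move=> a f g /asboolP[sf bf] /asboolP[sg bg]; apply/asboolP.
split; first exact: smooth_lin.
move=> k nu; have [Cf hf] := bf k nu; have [Cg hg] := bg k nu.
exists (cmod a * Cf + Cg) => _ [x _ <-].
rewrite /schwartz_term /dmulti partials_lin//.
have w0 : 0 <= (1 + eucl x) ^+ k by rewrite exprn_ge0// addr_ge0 ?sqrtr_ge0.
apply: le_trans (ler_wpM2l w0 (cmodD _ _)) _.
rewrite mulrDr; apply: lerD; last by apply: hg; exists x.
rewrite [cmod (_ *: _)]cmodM mulrCA ler_wpM2l ?cmod_ge0//.
by apply: hf; exists x.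
Qed.

HB.instance Definition _ :=
  GRing.isSubmodClosed.Build R[i] ('rV[R]_d -> R[i]) schwartz_pred
    schwartz_submod.

Record schwartz := Schwartz {
  schwartz_fun :> 'rV[R]_d -> R[i];
  schwartz_funP : schwartz_fun \in schwartz_pred }.

HB.instance Definition _ := [isSub for schwartz_fun].
HB.instance Definition _ := [Choice of schwartz by <:].
HB.instance Definition _ := [SubChoice_isSubLmodule of schwartz by <:].

Definition schwartz_seminorm (k : nat) (nu : {ffun 'I_d -> nat})
    (f : schwartz) : R :=
  sup (range (schwartz_term k nu f)).

Definition schwartz_balls : set (set schwartz) :=
  [set B | exists (f : schwartz) (k : nat) (nu : {ffun 'I_d -> nat}) (e : R),
     0 < e /\ B = [set g | schwartz_seminorm k nu (g - f) < e]].

(* The seminorm topology: open seminorm balls about all points form a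
   subbase. *)
HB.instance Definition _ :=
  @isSubBaseTopological.Build schwartz (set schwartz) schwartz_balls idfun.

End schwartz_space.

(* Main.v *)
(* A template phi is built as a tensor product of (infinite products of sinc
   functions) times cosines: phi and its derivatives are O(exp(-c|x|^eta)) and
   its Fourier transform lives where each (2 pi xi_i)^2 is close to w^2.  There
   |2 pi xi|^(2s) is, up to a constant, the convergent binomial series in
   |2 pi xi|^2/(d w^2) - 1, so that (-Delta)^s phi is a multiple of a function G
   with the same decay and with G(0) close to phi(0) = 1.  The same holds for
   every phi(R (x - p)).

   The interpolant is f = sum_n v_n q_n phi(R_n (x - p_n)) over all points of
   both sets, with R_n = K exp(B |p_n|^rho).  The separation and the decay of
   phi make the interaction of two points of the same set small when K is
   large.  Between the two sets, the factor R^(2s) gained by (-Delta)^s does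
   the work: an atom at a point of M, normalised for (-Delta)^s f, is negligible
   for the values of f because its R_n is huge, and an atom at a point of Lambda
   is negligible for (-Delta)^s f because of the weight exp(-L |p_n|^rho).  The
   weights exp(tau |x|^eta) are harmless because t^eta is subadditive.  So the
   linear system for v is a small perturbation of the identity on bounded
   sequences. *)

From HB Require Import structures.
Require Import Defs.
From mathcomp Require Import all_boot all_order all_algebra.
From mathcomp Require Import all_classical all_reals all_analysis.
From mathcomp Require Import measurable_realfun complex.
From mathcomp Require Import ring lra zify.
Set Implicit Arguments.
Unset Strict Implicit.
Unset Printing Implicit Defensive.
Import Order.TTheory GRing.Theory Num.Theory.
Import numFieldNormedType.Exports.
Local Open Scope classical_set_scope.
Local Open Scope complex_scope.
Local Open Scope ring_scope.


(** * Series and derivatives *)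

(** The multiplier |xi|^(2s) is in general not smooth at the origin, so the fractional Laplacian of
    a Schwartz function usually decays only polynomially. The building blocks are therefore given a
    spectrum away from the origin, and eta < 1 is what makes a compact spectrum compatible with
    decay exp(-c|x|^eta). No Fourier inversion occurs: G is written down in space as a series, its
    transform is computed by integration by parts and dominated convergence, and uniqueness of the
    Fourier transform identifies the result with [frac_lap]. In the same spirit the location of the
    spectrum is never described by a support; it is read off from the geometric decay of the
    iterates of a second-order operator. Smoothness is carried by families that list a function with
    all its derivatives, together with geometric bounds of Bernstein type. The construction is real
    throughout: the solution operator is real-linear on real data, and complex data are treated
    through their real and imaginary parts. *)

Section series_toolbox.
Variable R : realType.
Implicit Types a b : nat -> R.

(** Absolute summability recorded through a bound on all partial sums, so that later exchanges of
    limits come with an explicit constant. *)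
Definition abs_bounded a (B : R) := forall N, \sum_(n < N) `|a n| <= B.

Definition rsum a : R := limn (series a).

Lemma abs_bounded_cvg a B : abs_bounded a B -> cvgn (series a).
Proof.
move=> aB; apply: normed_cvg.
apply: nondecreasing_is_cvgn.
  by apply/nondecreasing_series => n _ _; exact: normr_ge0.
by exists B => _ [n _ <-] /=; apply: le_trans (aB n); rewrite seriesEord.
Qed.

Lemma abs_bounded_ge0 a B : abs_bounded a B -> 0 <= B.
Proof. by move=> /(_ 0%N); rewrite big_ord0. Qed.

Lemma rsum_cvg a B : abs_bounded a B -> (fun N => \sum_(n < N) a n) @ \oo --> rsum a.
Proof.
move=> aB; rewrite (_ : (fun N => _) = series a).
  exact: abs_bounded_cvg aB.
by apply/funext => n; rewrite /series /= big_mkord.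
Qed.

Lemma rsum_unique a l : (fun N => \sum_(n < N) a n) @ \oo --> l -> rsum a = l.
Proof.
move=> al; rewrite /rsum; apply: cvg_lim => //.
rewrite (_ : series a = (fun N => \sum_(n < N) a n)) //.
by apply/funext => n; rewrite /series /= big_mkord.
Qed.

Lemma rsum_le a B C : abs_bounded a B -> (forall N, \sum_(n < N) a n <= C) -> rsum a <= C.
Proof.
move=> aB aC; apply: (cvgr_to_le (rsum_cvg aB)).
exact: nearW.
Qed.

Lemma rsum_norm_le a B : abs_bounded a B -> `|rsum a| <= B.
Proof.
move=> aB; rewrite ler_norml; apply/andP; split; last first.
  apply: (rsum_le aB) => N; apply: le_trans (aB N); apply: ler_sum => i _.
  exact: ler_norm.
apply: (cvgr_to_ge (rsum_cvg aB)).
apply: nearW => N; rewrite lerNl; apply: le_trans (aB N).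
by rewrite -sumrN; apply: ler_sum => i _; rewrite -normrN ler_norm.
Qed.

Lemma abs_boundedW a b B : abs_bounded b B -> (forall n, `|a n| <= `|b n|) -> abs_bounded a B.
Proof. by move=> bB ab N; apply: le_trans (bB N); apply: ler_sum. Qed.

Lemma abs_bounded_le a b B : abs_bounded b B -> (forall n, `|a n| <= b n) -> abs_bounded a B.
Proof.
move=> bB ab; apply: (abs_boundedW bB) => n.
by apply: le_trans (ab n) _; exact: ler_norm.
Qed.

Lemma abs_boundedZ c a B : abs_bounded a B -> abs_bounded (fun n => c * a n) (`|c| * B).
Proof.
move=> aB N; under eq_bigr do rewrite normrM.
by rewrite -mulr_sumr ler_wpM2l.
Qed.

Lemma abs_boundedB a b A B : abs_bounded a A -> abs_bounded b B ->
  abs_bounded (fun n => a n - b n) (A + B).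
Proof.
move=> aA bB N; apply: le_trans (lerD (aA N) (bB N)).
by rewrite -big_split; apply: ler_sum => i _; exact: ler_normB.
Qed.

Lemma rsumD a b A B : abs_bounded a A -> abs_bounded b B ->
  rsum (fun n => a n + b n) = rsum a + rsum b.
Proof.
move=> aA bB; apply: rsum_unique; under eq_fun do rewrite big_split.
by apply: cvgD; [exact: rsum_cvg aA|exact: rsum_cvg bB].
Qed.

Lemma rsumZ c a A : abs_bounded a A -> rsum (fun n => c * a n) = c * rsum a.
Proof.
move=> aA; apply: rsum_unique; under eq_fun do rewrite -mulr_sumr.
by apply: cvgMl_tmp; exact: rsum_cvg aA.
Qed.

Lemma rsumB a b A B : abs_bounded a A -> abs_bounded b B ->
  rsum (fun n => a n - b n) = rsum a - rsum b.
Proof.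
move=> aA bB; rewrite -[- rsum b]mulN1r -(rsumZ _ bB).
rewrite -(rsumD aA (abs_boundedZ (-1) bB)); congr rsum.
by apply/funext => n; rewrite mulN1r.
Qed.

Lemma rsum_recl a A : abs_bounded a A -> rsum a = a 0%N + rsum (fun n => a n.+1).
Proof.
move=> aA; have aS : abs_bounded (fun n => a n.+1) A.
  move=> N; apply: le_trans (aA N.+1); rewrite big_ord_recl /=.
  by rewrite lerDr.
apply: rsum_unique; rewrite -(cvg_shiftS (fun N => \sum_(n < N) a n)) /=.
under eq_fun do rewrite big_ord_recl /=.
by apply: cvgD; [exact: cvg_cst|exact: rsum_cvg aS].
Qed.

Lemma rsumD1 a A m : abs_bounded a A ->
  rsum a = a m + rsum (fun n => if n == m then 0 else a n).
Proof.
move=> aA.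
have b1 : abs_bounded (fun n => if n == m then a n else 0) A.
  by apply: (abs_boundedW aA) => n; case: eqP => // _; rewrite normr0.
have b2 : abs_bounded (fun n => if n == m then 0 else a n) A.
  by apply: (abs_boundedW aA) => n; case: eqP => // _; rewrite normr0.
have -> : a m = rsum (fun n => if n == m then a n else 0).
  apply/esym/rsum_unique; apply: cvg_near_cst; exists m.+1 => // N /= mN.
  by rewrite (bigD1 (Ordinal mN))//= eqxx big1 ?addr0// => i /negPf; rewrite -val_eqE /= => ->.
rewrite -(rsumD b1 b2); congr rsum.
by apply/funext => n; case: eqP => _; rewrite ?addr0 ?add0r.
Qed.

Lemma ler_sum_geo (q : R) N : 0 <= q < 1 -> \sum_(n < N) q ^+ n <= (1 - q)^-1.
Proof.
move=> /andP[q0 q1]; rewrite -[leRHS]mul1r ler_pdivlMr ?subr_gt0//.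
have := subrX1 q N; have := exprn_ge0 N q0.
by move: (\sum_(n < N) _) => S; lra.
Qed.

Lemma abs_bounded_geo (q C : R) a : 0 <= q < 1 -> 0 <= C ->
  (forall n, `|a n| <= C * q ^+ n) -> abs_bounded a (C / (1 - q)).
Proof.
move=> q01 C0 aq N; apply: (@le_trans _ _ (\sum_(n < N) C * q ^+ n)).
  exact: ler_sum.
by rewrite -mulr_sumr ler_wpM2l// ler_sum_geo.
Qed.

End series_toolbox.

Section derivation_toolbox.
Variable R : realType.

(** A remainder of size O(h^2) passes through series and integrals, so differentiation under a sum
    or an integral reduces to a bound on Taylor remainders. *)
Lemma is_derive_quad (V : normedModType R) (F : V -> R) (x v : V) (D r B : R) :
  0 < r -> (forall h, `|h| < r -> `|F (h *: v + x) - F x - h * D| <= B * h ^+ 2) ->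
  is_derive x v F D.
Proof.
move=> r0 H.
have H0 : (fun h : R => h^-1 *: ((F \o shift x) (h *: v) - F x)) @ 0^' --> D.
  apply/cvgrPdist_lt => e e0; near=> h.
  have h0 : h != 0 by near: h; exact: nbhs_dnbhs_neq.
  have hr : `|h| < r.
    by near: h; apply: dnbhs0_lt.
  have he : `|h| < e / (`|B| + 1).
    by near: h; apply: dnbhs0_lt; rewrite divr_gt0// ltr_wpDl.
  have /= := H h hr; rewrite /shift /= => Hh.
  rewrite distrC; set X := F _ - F x in Hh *.
  have -> : h^-1 *: X - D = (X - h * D) / h.
    by rewrite [h^-1 *: X](_ : _ = h^-1 * X)//; field.
  rewrite normrM normfV ltr_pdivrMr ?normr_gt0//; apply: le_lt_trans Hh _.
  rewrite -[h ^+ 2]ger0_norm ?sqr_ge0// normrX expr2 mulrA ltr_pM2r ?normr_gt0//.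
  have : `|h| * (`|B| + 1) < e by rewrite -ltr_pdivlMr// ltr_wpDl.
  apply: le_lt_trans; rewrite mulrC ler_wpM2l//.
  by rewrite (le_trans (ler_norm _))// lerDl.
apply: DeriveDef; first by apply/cvg_ex; exists D.
by apply: cvg_lim.
Unshelve. all: by end_near. Qed.

Lemma is_derive_line (V : normedModType R) (F : V -> R) (x v : V) (D : R) :
  is_derive x v F D <-> is_derive (0 : R) 1 (fun h => F (h *: v + x)) D.
Proof.
have E : (fun h : R => h^-1 *: ((F \o shift x) (h *: v) - F x)) =
  (fun h : R => h^-1 *: (((fun k : R => F (k *: v + x)) \o shift 0) (h *: 1) - F (0 *: v + x))).
  apply/funext => h /=; rewrite /shift /= scale0r add0r addr0.
  by rewrite [h *: 1]mulr1.
split => -[d1 d2]; apply: DeriveDef.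
- by rewrite /derivable -E.
- by rewrite /derive -E.
- by rewrite /derivable E.
- by rewrite /derive E.
Qed.

Lemma MVT_norm (f df : R -> R) (a b M : R) :
  (forall t, t \in `[Num.min a b, Num.max a b] -> is_derive t 1 f (df t) /\ `|df t| <= M) ->
  `|f b - f a| <= M * `|b - a|.
Proof.
wlog ab : a b / a <= b => [hw|].
  have [ab|] := boolP (a <= b); first exact: hw.
  rewrite -ltNge => /ltW ba.
  move=> H; rewrite distrC (distrC b); apply: (hw _ _ ba) => t; rewrite minC maxC; exact: H.
rewrite (min_idPl ab) (max_idPr ab) => H.
have dd t : t \in `]a, b[ -> is_derive t 1 f (df t).
  by move=> tab; apply: (H t _).1; exact: subset_itv_oo_cc.
have cc : {within `[a, b], continuous f}.
  apply: continuous_in_subspaceT => t; rewrite inE /= => /H[d _].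
  exact/differentiable_continuous/derivable1_diffP.
have [c cab ->] := MVT_segment ab dd cc.
by rewrite normrM ler_wpM2r// (H c cab).2.
Qed.

(** The mean value inequality is applied twice, to [f t - t * df x] and to [df]; this yields the
    constant M rather than M/2. *)
Lemma taylor1_norm (f df d2 : R -> R) (x r M : R) :
  (forall t, `|t - x| < r -> [/\ is_derive t 1 f (df t), is_derive t 1 df (d2 t) & `|d2 t| <=
    M]) ->
  forall h, `|h| < r -> `|f (h + x) - f x - h * df x| <= M * h ^+ 2.
Proof.
move=> H h hr.
have sub t : t \in `[Num.min x (h + x), Num.max x (h + x)] -> `|t - x| <= `|h|.
  rewrite in_itv /= => /andP[]; rewrite ge_min le_max => /orP[]h1 /orP[]h2.
  - have -> : t = x by lra.
    by rewrite subrr normr0.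
  - by rewrite ger0_norm ?subr_ge0//; apply: le_trans (ler_norm h); lra.
  - by rewrite ler0_norm ?subr_le0// -normrN; apply: le_trans (ler_norm (- h)); lra.
  - by have -> : t - x = h by lra.
have M0 : 0 <= M.
  have [] := H x; first by rewrite subrr normr0 (le_lt_trans _ hr).
  by move=> _ _; apply: le_trans.
pose g t := f t - t * df x.
have -> : f (h + x) - f x - h * df x = g (h + x) - g x by rewrite /g; ring.
have -> : M * h ^+ 2 = (M * `|h|) * `|h + x - x|.
  by rewrite addrK -mulrA -normrM -expr2 ger0_norm ?sqr_ge0.
apply: (@MVT_norm g (fun t => df t - df x)) => t tI.
have th := sub t tI; have tr := le_lt_trans th hr.
have [d1 d2t Mt] := H t tr; split.
  rewrite /g; apply: is_deriveB.
  rewrite (_ : (fun t => t * df x) = (df x \*: id)); last by apply/funext => u;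
    rewrite /= [RHS]mulrC.
  by apply: is_derive_eq; rewrite [LHS]mulr1.
apply: (@le_trans _ _ (M * `|t - x|)); last by rewrite ler_wpM2l.
apply: (@MVT_norm _ d2) => u uI.
suff /H[_ ? ?] : `|u - x| < r by [].
apply: le_lt_trans tr; move: uI; rewrite in_itv /= ge_min le_max => /andP[/orP[]h1 /orP[]h2].
- have -> : u = x by lra.
  by rewrite subrr normr0.
- by rewrite !ger0_norm ?subr_ge0//; lra.
- by rewrite !ler0_norm ?subr_le0//; lra.
- by have -> : u = t by lra.
Qed.

(** A summable bound on the second derivatives takes the place of uniform convergence of the
    differentiated series: the Taylor remainders add up to at most B h^2. *)
Lemma is_derive_rsum (f df d2 : nat -> R -> R) (M : nat -> R) (x r B : R) :
  0 < r ->
  (forall n t, `|t - x| < r -> [/\ is_derive t 1 (f n) (df n t),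
     is_derive t 1 (df n) (d2 n t) & `|d2 n t| <= M n]) ->
  (forall t, `|t - x| < r -> exists C, abs_bounded (f^~ t) C) ->
  (exists C, abs_bounded (df^~ x) C) -> abs_bounded M B ->
  is_derive x 1 (fun t => rsum (f^~ t)) (rsum (df^~ x)).
Proof.
move=> r0 H Cf [C Cd] MB; apply: (@is_derive_quad _ _ _ _ _ r B) => // h hr.
rewrite [h *: 1]mulr1.
have [C1 HC1] : exists C, abs_bounded (f^~ (h + x)) C by apply: Cf; rewrite addrK.
have [C2 HC2] : exists C, abs_bounded (f^~ x) C by apply: Cf; rewrite subrr normr0.
rewrite -(rsumZ h Cd) -(rsumB HC1 HC2).
rewrite -(rsumB (abs_boundedB HC1 HC2) (abs_boundedZ h Cd)).
apply: rsum_norm_le => N.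
apply: (@le_trans _ _ (\sum_(n < N) `|M n| * h ^+ 2)).
  apply: ler_sum => n _; apply: le_trans (taylor1_norm (H n) hr) _.
  by rewrite ler_wpM2r ?sqr_ge0// ler_norm.
by rewrite -mulr_suml ler_wpM2r ?sqr_ge0.
Qed.

End derivation_toolbox.

(** * A function of one variable with compact spectrum and subexponential decay *)

Section jets.
Variable R : realType.
Implicit Types f g : nat -> R -> R.

(* A jet lists a function with all its derivatives. *)
Definition jet f := forall m (t : R), is_derive t 1 (f m) (f m.+1 t).

(** A Bernstein inequality at a single point: sg plays the role of the radius of the spectrum, while
    M may depend on the point and carries the decay. *)
Definition jet_bound f (sg M t : R) := forall m, `|f m t| <= M * sg ^+ m.

Definition jet_shift f : nat -> R -> R := fun m => f m.+1.

(** The Leibniz rule as a recursion on the order, free of binomial coefficients: the outermost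
    derivative falls on one factor or on the other. *)
Fixpoint jet_mul_rec (m : nat) f g (t : R) : R :=
  if m is k.+1 then jet_mul_rec k (jet_shift f) g t + jet_mul_rec k f (jet_shift g) t
  else f 0%N t * g 0%N t.

Definition jet_mul f g : nat -> R -> R := fun m => jet_mul_rec m f g.

Definition jet_comb (a b : R) f g : nat -> R -> R := fun m t => a * f m t + b * g m t.

Definition jet_one : nat -> R -> R := fun m _ => (m == 0%N)%:R.

Definition jet_affine (a b : R) f : nat -> R -> R := fun m t => a ^+ m * f m (a * t + b).

Lemma jet_shiftP f : jet f -> jet (jet_shift f).
Proof. by move=> jf m t; exact: jf. Qed.

Lemma is_deriveMr (f : R -> R) (t D c : R) :
  is_derive t 1 f D -> is_derive t 1 (fun x => c * f x) (c * D).
Proof. by move=> H; exact: (is_deriveZ c H). Qed.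

Lemma is_deriveMl2 (f g : R -> R) (t D E : R) :
  is_derive t 1 f D -> is_derive t 1 g E ->
  is_derive t 1 (fun x => f x * g x) (D * g t + f t * E).
Proof.
move=> F G; have := is_deriveM F G; move/is_derive_eq; apply.
by rewrite addrC [_ *: D]mulrC.
Qed.

Lemma is_deriveDl (f g : R -> R) (t D E : R) :
  is_derive t 1 f D -> is_derive t 1 g E ->
  is_derive t 1 (fun x => f x + g x) (D + E).
Proof. by move=> F G; exact: is_deriveD. Qed.

Lemma is_derive_affine (f : R -> R) (a b t D : R) :
  is_derive (a * t + b) 1 f D -> is_derive t 1 (fun x => f (a * x + b)) (a * D).
Proof.
move=> H.
have G : is_derive t 1 (fun x : R => a * x + b) a.
  apply: (@is_derive_eq _ _ _ _ _ _ _ (a * 1 + 0)); last by rewrite mulr1 addr0.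
have := @is_derive1_comp R f (fun x : R => a * x + b) t D a H G.
by move/is_derive_eq; apply; rewrite mulrC.
Qed.

Lemma jet_combP a b f g : jet f -> jet g -> jet (jet_comb a b f g).
Proof.
by move=> jf jg m t; apply: is_deriveDl; apply: is_deriveMr; [exact: jf|exact: jg].
Qed.

Lemma jet_mulP f g : jet f -> jet g -> jet (jet_mul f g).
Proof.
move=> jf jg m; elim: m f g jf jg => [|m IH] f g jf jg t.
  by rewrite /jet_mul /=; apply: is_deriveMl2; [exact: jf|exact: jg].
apply: is_deriveDl; first by apply: IH => //; exact: jet_shiftP.
by apply: IH => //; exact: jet_shiftP.
Qed.

Lemma jet_oneP : jet jet_one.
Proof. by move=> m t; exact: is_derive_cst. Qed.

Lemma jet_affineP a b f : jet f -> jet (jet_affine a b f).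
Proof.
move=> jf m t; rewrite /jet_affine exprSr -mulrA.
by apply: is_deriveMr; apply: is_derive_affine; exact: jf.
Qed.

Lemma jet_bound_ge0 f sg M t : jet_bound f sg M t -> 0 <= M.
Proof. by move=> /(_ 0%N); rewrite expr0 mulr1; apply: le_trans. Qed.

Lemma jet_bound_shift f sg M t : jet_bound f sg M t -> jet_bound (jet_shift f) sg (M * sg) t.
Proof. by move=> H m; rewrite -mulrA -exprS; exact: H. Qed.

(** Spectral radii add under multiplication. In the recursion a shift of one factor costs sg or sg',
    which reproduces (sg + sg')^(m+1). *)
Lemma jet_bound_mul f g sg sg' M M' t :
  jet_bound f sg M t -> jet_bound g sg' M' t ->
  jet_bound (jet_mul f g) (sg + sg') (M * M') t.
Proof.
move=> bf bg m; elim: m f g M M' bf bg => [|m IH] f g M M' bf bg.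
  have := bf 0%N; have := bg 0%N.
  by rewrite /jet_mul /= !expr0 !mulr1 normrM => ? ?; exact: ler_pM.
apply: le_trans (ler_normD _ _) _.
have := IH _ _ _ _ (jet_bound_shift bf) bg.
have := IH _ _ _ _ bf (jet_bound_shift bg).
rewrite /jet_mul exprS => h1 h2; apply: le_trans (lerD h2 h1) _.
by rewrite le_eqVlt; apply/orP; left; apply/eqP; ring.
Qed.

Lemma jet_bound_comb a b f g sg M M' t :
  jet_bound f sg M t -> jet_bound g sg M' t ->
  jet_bound (jet_comb a b f g) sg (`|a| * M + `|b| * M') t.
Proof.
move=> bf bg m; apply: le_trans (ler_normD _ _) _.
rewrite !normrM mulrDl -!mulrA; by apply: lerD; rewrite ler_wpM2l.
Qed.

Lemma jet_boundW f sg M sg' M' t : 0 <= sg -> sg <= sg' -> M <= M' ->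
  jet_bound f sg M t -> jet_bound f sg' M' t.
Proof.
move=> s0 ss MM bf m; apply: le_trans (bf m) _.
have M0 := jet_bound_ge0 bf.
apply: ler_pM => //; first exact: exprn_ge0.
by apply: lerXn2r => //; rewrite nnegrE// (le_trans s0).
Qed.

Lemma jet_bound_affine a b f sg M t : 0 <= a ->
  jet_bound f sg M (a * t + b) -> jet_bound (jet_affine a b f) (a * sg) M t.
Proof.
move=> a0 bf m; rewrite normrM normrX ger0_norm// exprMn mulrCA.
by rewrite ler_wpM2l ?exprn_ge0.
Qed.

(** Each derivative of cos(t + c) adds pi/2 to the phase; c = 0 gives the cosine and c = -pi/2 the
    sine. *)
Definition jet_trig (c : R) : nat -> R -> R := fun m t => cos (t + c + (pi / 2) *+ m).

Lemma jet_trigP c : jet (jet_trig c).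
Proof.
move=> m t; rewrite /jet_trig.
have -> : (fun t0 => cos (t0 + c + pi / 2 *+ m)) =
          (fun t0 => cos (1 * t0 + (c + pi / 2 *+ m))).
  by apply/funext => u; rewrite mul1r addrA.
apply: (@is_derive_eq _ _ _ _ _ _ _ (1 * - sin (1 * t + (c + pi / 2 *+ m)))).
  exact: is_derive_affine.
by rewrite !mul1r [_ *+ m.+1]mulrSr [in RHS]addrA cosDpihalf !addrA.
Qed.

Lemma norm_cos_le1 (x : R) : `|cos x| <= 1.
Proof. by rewrite ler_norml cos_geN1 cos_le1. Qed.

Lemma norm_sin_le1 (x : R) : `|sin x| <= 1.
Proof. by rewrite ler_norml sin_geN1 sin_le1. Qed.

Lemma jet_bound_trig c t : jet_bound (jet_trig c) 1 1 t.
Proof. by move=> m; rewrite expr1n mulr1 norm_cos_le1. Qed.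

Lemma jet_trig0 m t : jet_trig (- (pi / 2)) m.+1 t = jet_trig 0 m t.
Proof. by rewrite /jet_trig [_ *+ m.+1]mulrS addr0 addrA subrK. Qed.

Lemma jet_trig_sin t : jet_trig (- (pi / 2)) 0 t = sin t.
Proof. by rewrite /jet_trig mulr0n addr0 cosBpihalf. Qed.

Lemma jet_trig_cos t : jet_trig 0 0 t = cos t.
Proof. by rewrite /jet_trig mulr0n !addr0. Qed.

End jets.

Section sinc.
Variable R : realType.
Local Notation mu := (@lebesgue_measure R).

Lemma jet_continuous (f : nat -> R -> R) m : jet f -> continuous (f m).
Proof. by move=> jf t; apply/differentiable_continuous/derivable1_diffP;
  exact: (@ex_derive _ _ _ _ _ _ _ (jf m t)). Qed.

Lemma continuous_integrable01 (g : R -> R) : continuous g ->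
  mu.-integrable `[0, 1] (EFin \o g).
Proof.
move=> cg; apply: continuous_compact_integrable; first exact: segment_compact.
exact: continuous_subspaceT.
Qed.

Definition int01 (g : R -> R) : R := Rintegral mu `[0%R, 1%R] g.

Lemma int01_norm_le (g : R -> R) c : continuous g ->
  (forall u, 0 <= u <= 1 -> `|g u| <= c) -> `|int01 g| <= c.
Proof.
move=> cg gc; have ig := continuous_integrable01 cg.
have c0 : 0 <= c by apply: le_trans (gc 0 _); rewrite // lexx ler01.
apply: le_trans (le_normr_Rintegral _ ig) _ => //.
apply: (@le_trans _ _ (Rintegral mu `[0%R, 1%R] (cst c))).
  apply: le_Rintegral => //.
  - exact: integrable_norm.
  - exact/continuous_integrable01/cst_continuous.
by rewrite Rintegral_cst//= lebesgue_measure_itv/= lte_fin ltr01 oppr0 addr0 mulr1.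
Qed.

Lemma int01_comb (f g : R -> R) (a b : R) : continuous f -> continuous g ->
  int01 (fun u => a * f u + b * g u) = a * int01 f + b * int01 g.
Proof.
move=> cf cg; have If := continuous_integrable01 cf; have Ig := continuous_integrable01 cg.
have cc c (h : R -> R) : continuous h -> continuous (fun u => c * h u).
  by move=> ch u; apply: cvgMl_tmp; exact: ch.
rewrite /int01 RintegralD//; last 2 first.
  exact/continuous_integrable01/cc.
  exact/continuous_integrable01/cc.
by rewrite !RintegralZl.
Qed.

Lemma int01_FTC (F f : R -> R) : (forall u : R, is_derive u 1 F (f u)) -> continuous f ->
  int01 f = F 1 - F 0.
Proof.
move=> dF cf.
have cF : continuous F.
  by move=> t; apply/differentiable_continuous/derivable1_diffP;
    exact: (@ex_derive _ _ _ _ _ _ _ (dF t)).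
rewrite /int01 /Rintegral (@continuous_FTC2 _ _ F)//=.
- exact: continuous_subspaceT.
- split => [x _||]; first exact: (@ex_derive _ _ _ _ _ _ _ (dF x)).
  + exact/cvg_at_right_filter/cF.
  + exact/cvg_at_left_filter/cF.
- by move=> x _; rewrite derive1E; exact: (@derive_val _ _ _ _ _ _ _ (dF x)).
Qed.

(** The derivatives of sin(x)/x, written as the integral of cos(xu) over [0, 1]: there is no
    removable singularity, and the bound 1 is immediate at every order. *)
Definition sincj : nat -> R -> R := fun m x => int01 (fun u => u ^+ m * jet_trig 0 m (x * u)).

Lemma sincj_cont m x : continuous (fun u : R => u ^+ m * jet_trig 0 m (x * u)).
Proof.
move=> u; apply: cvgM; first exact: exprn_continuous.
apply: (@continuous_comp _ _ _ (fun u => x * u) (jet_trig 0 m)).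
  by apply: cvgMl_tmp; exact: cvg_id.
by apply: jet_continuous; exact: jet_trigP.
Qed.

Lemma sincj_jet : jet sincj.
Proof.
move=> m x; apply: (@is_derive_quad _ _ _ _ _ _ 1 1) => // h _.
rewrite [h *: 1]mulr1 mul1r /sincj.
have c1 := @sincj_cont m (h + x); have c2 := @sincj_cont m x.
have c3 := @sincj_cont m.+1 x.
have -> : int01 (fun u => u ^+ m * jet_trig 0 m ((h + x) * u)) -
  int01 (fun u => u ^+ m * jet_trig 0 m (x * u)) -
  h * int01 (fun u => u ^+ m.+1 * jet_trig 0 m.+1 (x * u)) =
  int01 (fun u => 1 * (1 * (u ^+ m * jet_trig 0 m ((h + x) * u)) +
    (-1) * (u ^+ m * jet_trig 0 m (x * u))) +
    (- h) * (u ^+ m.+1 * jet_trig 0 m.+1 (x * u))).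
  rewrite (int01_comb _ _ _ c3); last first.
    by move=> u; apply: cvgD; apply: cvgMl_tmp; [exact: c1|exact: c2].
  by rewrite (int01_comb _ _ c1 c2); ring.
apply: int01_norm_le.
  move=> u; apply: cvgD; apply: cvgMl_tmp; last exact: c3.
  by apply: cvgD; apply: cvgMl_tmp; [exact: c1|exact: c2].
move=> u /andP[u0 u1].
have -> : 1 * (1 * (u ^+ m * jet_trig 0 m ((h + x) * u)) +
    (-1) * (u ^+ m * jet_trig 0 m (x * u))) +
    (- h) * (u ^+ m.+1 * jet_trig 0 m.+1 (x * u)) =
    jet_affine u 0 (jet_trig 0) m (h + x) - jet_affine u 0 (jet_trig 0) m x -
    h * jet_affine u 0 (jet_trig 0) m.+1 x.
  by rewrite /jet_affine !addr0 !(mulrC u); ring.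
rewrite -[h ^+ 2]mul1r.
apply: (@taylor1_norm _ _ _ (jet_affine u 0 (jet_trig 0) m.+2) _ (`|h| + 1)).
  move=> t _; split; [exact/jet_affineP/jet_trigP|exact/jet_affineP/jet_trigP|].
  apply: le_trans (jet_bound_affine u0 (@jet_bound_trig _ _ _) _) _.
  by rewrite mul1r mulr1 exprn_ile1.
by rewrite ltrDl.
Qed.

Lemma sincj_le1 m x : `|sincj m x| <= 1.
Proof.
apply: int01_norm_le; first exact: sincj_cont.
move=> u /andP[u0 u1]; rewrite normrM -[leRHS]mulr1 ler_pM// ?norm_cos_le1//.
by rewrite normrX ger0_norm// exprn_ile1.
Qed.

(** Integration by parts expresses x times the derivative of order m+1 as a trigonometric term minus
    m+1 times the derivative of order m, and 1 + (m+1) <= 2^(m+1). At order 0 the product is sin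
    x. *)
Lemma sincj_decay m x : `|x| * `|sincj m x| <= 2 ^+ m.
Proof.
have dU k (u : R) : is_derive u 1 (fun u : R => u ^+ k.+1) (k.+1%:R * u ^+ k).
  have -> : (fun u : R => u ^+ k.+1) = (id : R -> R) ^+ k.+1.
    by apply/funext => y; rewrite fctE.
  by apply: is_derive_eq; rewrite /= [LHS]mulr1.
rewrite -normrM.
have E u n : jet_affine x 0 (jet_trig 0) n u = x ^+ n * jet_trig 0 n (x * u).
  by rewrite /jet_affine addr0.
case: m => [|m].
  have -> : x * sincj 0 x = sin x - sin 0.
    rewrite -!jet_trig_sin -[x in RHS]mulr1 -[0 in RHS](mulr0 x) /sincj.
    have -> : (fun u => u ^+ 0 * jet_trig 0 0 (x * u)) = (fun u => jet_trig 0 0 (x * u)).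
      by apply/funext => u; rewrite mul1r.
    have c0 : continuous (fun u => jet_trig 0 0 (x * u)).
      by have := @sincj_cont 0 x; under eq_fun do rewrite mul1r.
    transitivity (int01 (fun u => x * jet_trig 0 0 (x * u) + 0 * jet_trig 0 0 (x * u))).
      by rewrite int01_comb// mul0r addr0.
    apply: (int01_FTC (F := fun u => jet_trig (- (pi / 2)) 0 (x * u))) => [u|u]; last first.
      by apply: cvgD; apply: cvgMl_tmp; exact: c0.
    have := @is_derive_affine _ (jet_trig (- (pi / 2)) 0) x 0 u _ (@jet_trigP _ _ _ _).
    by rewrite jet_trig0; under eq_fun do rewrite addr0; rewrite addr0 mul0r addr0.
  by rewrite sin0 subr0 expr0 norm_sin_le1.
have -> : x * sincj m.+1 x = jet_trig 0 m x - m.+1%:R * sincj m x.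
  apply/eqP; rewrite eq_sym subr_eq; apply/eqP.
  rewrite -int01_comb; [|exact: sincj_cont|exact: sincj_cont].
  transitivity (1 ^+ m.+1 * jet_trig 0 m (x * 1) - 0 ^+ m.+1 * jet_trig 0 m (x * 0)).
    by rewrite expr1n mul1r mulr1 expr0n /= mul0r subr0.
  apply/esym/(int01_FTC (F := fun u => u ^+ m.+1 * jet_trig 0 m (x * u))) => u; last first.
    by apply: cvgD; apply: cvgMl_tmp; exact: sincj_cont.
  have d2 := @is_derive_affine _ (jet_trig 0 m) x 0 u _ (@jet_trigP _ _ _ _).
  have := is_deriveMl2 (dU m u) d2.
  under eq_fun do rewrite addr0.
  by move/is_derive_eq; apply; rewrite addr0; ring.
apply: le_trans (ler_normB _ _) _; rewrite normrM.
apply: (@le_trans _ _ (1 + m.+1%:R * 1)).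
  apply: lerD; first exact: norm_cos_le1.
  by rewrite normr_nat ler_wpM2l// sincj_le1.
rewrite mulr1 -natr1 addrC natr1 natr1 -natrX ler_nat.
exact: ltn_expl.
Qed.

Lemma sincj00 : sincj 0 0 = 1.
Proof.
rewrite /sincj /int01; under eq_Rintegral do rewrite mul0r jet_trig_cos cos0 mulr1.
by rewrite Rintegral_cst//= lebesgue_measure_itv/= lte_fin ltr01 oppr0 addr0 mulr1.
Qed.

End sinc.

Section decaying_jet.
Variable R : realType.
Implicit Types f g : nat -> R -> R.
Fixpoint jet_pow f (n : nat) : nat -> R -> R :=
  if n is k.+1 then jet_mul f (jet_pow f k) else @jet_one R.
Lemma jet_powP f n : jet f -> jet (jet_pow f n).
Proof. by move=> jf; elim: n => [|n IH]; [exact: jet_oneP|exact: jet_mulP]. Qed.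

Lemma jet_bound_one t : jet_bound (@jet_one R) 0 1 t.
Proof. by move=> [|m]; rewrite /jet_one /= mul1r ?expr0 ?expr0n ?normr1 ?normr0. Qed.

Lemma jet_bound_pow f n sg M t : jet_bound f sg M t ->
  jet_bound (jet_pow f n) (n%:R * sg) (M ^+ n) t.
Proof.
move=> bf; elim: n => [|n IH] /=; first by rewrite mul0r expr0; exact: jet_bound_one.
have := jet_bound_mul bf IH.
by rewrite -exprS -natr1 mulrDl mul1r addrC.
Qed.

Lemma jet_mul_comb f a b g h m t :
  jet_mul f (jet_comb a b g h) m t = a * jet_mul f g m t + b * jet_mul f h m t.
Proof.
rewrite /jet_mul; elim: m f g h => [|m IH] f g h; first by rewrite /= /jet_comb; ring.
by rewrite /= -/(jet_comb a b (jet_shift g) (jet_shift h)) !IH; ring.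
Qed.

Lemma jet_mul1 f m t : jet_mul f (@jet_one R) m t = f m t.
Proof.
have Z k g : jet_mul_rec k g (jet_shift (@jet_one R)) t = 0.
  elim: k g => [|k IH] g /=; first by rewrite mulr0.
  rewrite IH add0r.
  have -> : jet_shift (jet_shift (@jet_one R)) = jet_shift (@jet_one R) by [].
  exact: IH.
rewrite /jet_mul; elim: m f => [|m IH] f /=; first by rewrite mulr1.
by rewrite IH Z addr0.
Qed.

Variable eta : R.
Hypothesis eta0 : 0 < eta.
Hypothesis eta1 : eta < 1.

Let r : R := expR (- (ln 2 / eta)).

Let sg : R := 2 / (1 - 2 * r).

Let ln2_gt0 : 0 < ln 2 :> R. Proof. by rewrite ln_gt0// ltr1n. Qed.

Let r_gt0 : 0 < r. Proof. by rewrite expR_gt0. Qed.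

(** Here eta < 1 enters, as 2r = 2^(1 - 1/eta). The spectral radii 2(2r)^N of the factors form a
    convergent geometric series with sum [sg], so the infinite product keeps a compact spectrum. *)
Let r2 : 2 * r < 1.
Proof.
rewrite /r -[X in X * _](@lnK R) ?posrE// -expRD expR_lt1 subr_lt0.
by rewrite ltr_pdivlMr// gtr_pMr.
Qed.

Let sg_gt0 : 0 < sg. Proof. by rewrite divr_gt0// subr_gt0. Qed.

(* The factors are sinc(r^N t)^(2^N) with r = 2^(-1/eta): about
   |t|^eta of them, counted with multiplicity, are at most 1/2 at t. *)
Let fac N : nat -> R -> R := jet_pow (jet_affine (r ^+ N) 0 (@sincj R)) (2 ^ N).

Let sN N : R := 2 * (2 * r) ^+ N.

Let facP N : jet (fac N).
Proof. by apply/jet_powP/jet_affineP; exact: sincj_jet. Qed.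

Let fac_bound1 N t : jet_bound (fac N) (sN N) 1 t.
Proof.
have H : jet_bound (jet_affine (r ^+ N) 0 (@sincj R)) (r ^+ N * 2) 1 t.
  apply: jet_bound_affine; first by rewrite exprn_ge0 // ltW.
  move=> m; rewrite mul1r; apply: le_trans (sincj_le1 m _) _.
  by rewrite exprn_ege1// ler1n.
have := jet_bound_pow (2 ^ N) H; rewrite expr1n.
suff -> : (2 ^ N)%:R * (r ^+ N * 2) = sN N by [].
by rewrite /sN exprMn natrX; ring.
Qed.

(** The rate 2 for the sinc jet, instead of 1, matches the factor 2^m in [sincj_decay]. Once r^N |t|
    >= 2, each of the 2^N copies of sinc contributes a factor 1/2. *)
Let fac_bound2 N t : 2 <= r ^+ N * `|t| ->
  jet_bound (fac N) (sN N) (2^-1 ^+ (2 ^ N)) t.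
Proof.
move=> Ht.
have rN : 0 < r ^+ N by rewrite exprn_gt0.
have H : jet_bound (jet_affine (r ^+ N) 0 (@sincj R)) (r ^+ N * 2) 2^-1 t.
  apply: jet_bound_affine; first exact: ltW.
  move=> m; rewrite addr0 -ler_pdivrMl ?invr_gt0// invrK.
  apply: le_trans (sincj_decay m (r ^+ N * t)).
  by rewrite ler_wpM2r// normrM gtr0_norm.
have := jet_bound_pow (2 ^ N) H.
suff -> : (2 ^ N)%:R * (r ^+ N * 2) = sN N by [].
by rewrite /sN exprMn natrX; ring.
Qed.

Let fac00 N : fac N 0%N 0 = 1.
Proof.
rewrite /fac; elim: (2 ^ N)%N => [//|n IH].
by rewrite /= /jet_mul /= -/(jet_mul _ _ 0%N 0) IH /jet_affine mulr0 addr0 sincj00 !mulr1.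
Qed.

Let fin N : nat -> R -> R := iteri N (fun n f => jet_mul f (fac n)) (@jet_one R).

Let finP N : jet (fin N).
Proof. by elim: N => [|N IH]; [exact: jet_oneP|exact: jet_mulP]. Qed.

Let sum_sN N : \sum_(n < N) sN n <= sg.
Proof.
rewrite -mulr_sumr ler_wpM2l// ler_sum_geo// mulr_ge0//=; exact: ltW.
Qed.

Let sN_ge0 n : 0 <= sN n.
Proof. by rewrite mulr_ge0// exprn_ge0// mulr_ge0// ltW. Qed.

Let sN_le n : sN n <= sg.
Proof.
apply: le_trans (sum_sN n.+1); rewrite big_ord_recr /= lerDr.
by apply: sumr_ge0.
Qed.

Let sg1 : 1 <= 1 + sg. Proof. by rewrite lerDl ltW. Qed.

Let sg_ge0 : 0 <= 1 + sg. Proof. exact: le_trans sg1. Qed.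

Let sg2_ge0 : 0 <= 1 + 2 * sg. Proof. by rewrite addr_ge0// mulr_ge0// ltW. Qed.

Let fin_bound_aux N t M : (forall n, exists2 m, jet_bound (fac n) (sN n) m t & m <= M n) ->
  (forall n, 0 <= M n) ->
  jet_bound (fin N) (\sum_(n < N) sN n) (\prod_(n < N) M n) t.
Proof.
move=> H M0; elim: N => [|N IH]; first by rewrite !big_ord0; exact: jet_bound_one.
rewrite !big_ord_recr /=; have [m bm mM] := H N.
by apply: jet_bound_mul => //; exact: jet_boundW bm.
Qed.

Let fin_bound1 N t : jet_bound (fin N) sg 1 t.
Proof.
apply: (jet_boundW _ (sum_sN N) _ (fin_bound_aux N (M := fun=> 1) _ _)) => //.
- exact: sumr_ge0.
- by rewrite big1.
- by move=> n; exists 1.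
Qed.

(** One well-chosen factor already gives the decay, the others being bounded by 1. *)
Let fin_bound2 j N t : (j < N)%N -> 2 <= r ^+ j * `|t| ->
  jet_bound (fin N) sg (2^-1 ^+ (2 ^ j)) t.
Proof.
move=> jN Ht.
have M0 n : 0 <= (if n == j then 2^-1 ^+ (2 ^ j) else 1) :> R.
  by case: ifP => // _; rewrite exprn_ge0 ?invr_ge0.
apply: (jet_boundW _ (sum_sN N) _ (fin_bound_aux N (M := fun n => if n == j then 2^-1 ^+ (2 ^
  j) else 1) _ _)) => //.
- exact: sumr_ge0.
- by rewrite (bigD1 (Ordinal jN))//= eqxx big1 ?mulr1// => i; rewrite -val_eqE /= => /negPf ->.
- move=> n; case: ifP => [/eqP ->|_]; [exists (2^-1 ^+ (2 ^ j))|exists 1] => //.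
  exact: fac_bound2.
Qed.

Let dif N : nat -> R -> R := jet_mul (fin N) (jet_comb 1 (-1) (fac N) (@jet_one R)).

Let difE N m t : dif N m t = fin N.+1 m t - fin N m t.
Proof. by rewrite /dif jet_mul_comb mul1r mulN1r jet_mul1. Qed.

Let difP N : jet (dif N).
Proof.
apply: jet_mulP => //; apply: jet_combP => //; exact: jet_oneP.
Qed.

(** [fac N] equals 1 at 0 and has slope at most [sN N]. Hence the differences of consecutive partial
    products are summable, locally uniformly and together with their derivatives. *)
Let dif_bound N t T : 1 <= T -> `|t| <= T ->
  jet_bound (dif N) (1 + 2 * sg) (sN N * T) t.
Proof.
move=> T1 tT.
have T0 : 0 <= T by lra.
have b : jet_bound (jet_comb 1 (-1) (fac N) (@jet_one R)) (1 + sg) (sN N * T) t.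
  move=> [|m]; rewrite /jet_comb mul1r mulN1r /jet_one /=.
    rewrite expr0 mulr1 -(fac00 N).
    apply: (@le_trans _ _ (sN N * `|t - 0|)).
      apply: (@MVT_norm _ (fac N 0%N) (fac N 1%N)) => u _; split; first exact: facP.
      by have := fac_bound1 N u 1; rewrite mul1r expr1.
    by rewrite subr0 ler_wpM2l.
  rewrite subr0; apply: le_trans (fac_bound1 N t m.+1) _.
  rewrite mul1r exprS -mulrA ler_wpM2l//.
  apply: (@le_trans _ _ ((1 + sg) ^+ m)).
    by apply: lerXn2r; rewrite ?nnegrE// (le_trans (sN_le N))// lerDr.
  apply: (@le_trans _ _ ((1 + sg) ^+ m.+1)).
    by rewrite exprS ler_peMl ?exprn_ge0.
  by rewrite ler_peMl// exprn_ge0.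
have := jet_bound_mul (fin_bound1 N t) b.
by rewrite mul1r addrCA -mulr2n mulr_natl.
Qed.

(** The infinite product as a telescoping series, a form that can be differentiated term by term. *)
Let S : nat -> R -> R := fun m t => jet_one m t + rsum (fun N => dif N m t).

Let dif_sum m t T : 1 <= T -> `|t| <= T ->
  abs_bounded (fun N => dif N m t) (sg * T * (1 + 2 * sg) ^+ m).
Proof.
move=> T1 tT; have T0 : 0 <= T by lra.
move=> N; apply: (@le_trans _ _ (\sum_(n < N) (sN n * (T * (1 + 2 * sg) ^+ m)))).
  apply: ler_sum => n _; rewrite mulrA; exact: dif_bound.
by rewrite -mulr_suml -mulrA ler_wpM2r// mulr_ge0// exprn_ge0.
Qed.

Let fin_cvg m t : (fun N => fin N m t) @ \oo --> S m t.
Proof.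
have := rsum_cvg (@dif_sum m t (`|t| + 1) _ _).
have -> : (fun N => \sum_(n < N) dif n m t) = (fun N => - jet_one m t + fin N m t).
  apply/funext => N; under eq_bigr do rewrite difE.
  rewrite -(big_mkord xpredT (fun n => fin n.+1 m t - fin n m t)) telescope_sumr//.
  by rewrite addrC.
move=> /(_ _ _)H; rewrite /S.
have {}H : (fun N => - jet_one m t + fin N m t) @ \oo --> rsum (fun N => dif N m t).
  by apply: H; rewrite ?lerDl// lerDr.
have -> : (fun N => fin N m t) = (fun N => jet_one m t + (- jet_one m t + fin N m t)).
  by apply/funext => N; rewrite addrA subrr add0r.
by apply: cvgD => //; exact: cvg_cst.
Qed.

Let SP : jet S.
Proof.
move=> m x; apply: (is_deriveDl (@jet_oneP R m x)).
have B t : `|t - x| < 1 -> `|t| <= `|x| + 1.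
  move=> tx; rewrite -(subrK x t) addrC (le_trans (ler_normD _ _))// lerD2l.
  exact: ltW.
have T1 : 1 <= `|x| + 1 by rewrite lerDr.
apply: (@is_derive_rsum R (fun N => dif N m) (fun N => dif N m.+1) (fun N => dif N m.+2)
  (fun N => sN N * (`|x| + 1) * (1 + 2 * sg) ^+ m.+2) x 1 (sg * (`|x| + 1) * (1 + 2 * sg) ^+
    m.+2)) => //.
- move=> n t tx; split; [exact: difP|exact: difP|].
  by apply: dif_bound => //; exact: B.
- by move=> t tx; eexists; apply: dif_sum; [exact: T1|exact: B].
- by eexists; apply: dif_sum; [exact: T1|rewrite lerDl].
- move=> N; under eq_bigr => n _.
    rewrite ger0_norm; last first.
      apply: mulr_ge0; last exact: exprn_ge0.
      by apply: mulr_ge0; [exact: sN_ge0|exact: le_trans T1].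
    over.
  rewrite -2!mulr_suml ler_wpM2r//; first exact: exprn_ge0.
  by rewrite ler_wpM2r//; exact: le_trans T1.
Qed.

Let S_bound t M : (exists K, forall N, (K <= N)%N -> jet_bound (fin N) sg M t) ->
  jet_bound S sg M t.
Proof.
move=> [K H] m; have c : (fun N => `|fin N m t|) @ \oo --> `|S m t|.
  by apply: cvg_norm; exact: fin_cvg.
by apply: (cvgr_to_le c); exists K => // N /= KN; exact: H.
Qed.

Lemma exists_decaying_jet : exists S : nat -> R -> R, exists sg C c : R,
  [/\ 0 < sg, 1 <= C, 0 < c, jet S & [/\ S 0%N 0 = 1,
    forall t, jet_bound S sg 1 t &
    forall t, jet_bound S sg (C * expR (- (c * `|t| `^ eta))) t]].
Proof.
pose c : R := ln 2 / 2 * 2^-1 `^ eta.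
have c0 : 0 < c by rewrite mulr_gt0 ?divr_gt0// powR_gt0 ?invr_gt0.
(* The constant exp(ln 2 / 2) makes the claimed bound at least 1 for |t| <= 2, where only the
   boundedness of S is available. *)
exists S, sg, (expR (ln 2 / 2)), c; split => //.
- by rewrite -[leLHS]expR0 ler_expR divr_ge0// ltW.
split.
- have /cvg_lim <- // := @fin_cvg 0%N 0.
  apply: lim_near_cst => //; apply: nearW; elim => [//|N IH].
  by rewrite /= /jet_mul /= IH -/(fac N 0%N 0) fac00 mulr1.
- by move=> t; apply: S_bound; exists 0%N => N _; exact: fin_bound1.
- move=> t.
  have cE : c * `|t| `^ eta = ln 2 / 2 * (`|t| / 2) `^ eta.
    by rewrite /c powRM ?invr_ge0 ?normr_ge0//; ring.
  rewrite cE -expRD -[X in X + _]mulr1 -mulrBr.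
  have [t2|t2] := leP 2 `|t|; last first.
    apply: (jet_boundW (ltW sg_gt0) (lexx sg) _ (S_bound _)); last first.
      by exists 0%N => N _; exact: fin_bound1.
    rewrite -[leLHS]expR0 ler_expR mulr_ge0 ?divr_ge0 ?(ltW ln2_gt0)// subr_ge0.
    have : (`|t| / 2) `^ eta <= 1 `^ eta.
      by rewrite ge0_ler_powR ?nnegrE ?(ltW eta0) ?divr_ge0// ler_pdivrMr// mul1r ltW.
    by rewrite powR1.
  pose x := ln (`|t| / 2).
  have xE : expR x = `|t| / 2 by rewrite lnK// posrE divr_gt0//; lra.
  have x0 : 0 <= x by rewrite ln_ge0// ler_pdivlMr// mul1r.
  (* j is the integer part of the binary logarithm of (|t|/2)^eta. Then r^j |t| >= 2, so factor j
     gives 2^(-2^j), and 2^(j+1) > (|t|/2)^eta turns this into the claimed decay. *)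
  pose y := x * eta / ln 2.
  have y0 : 0 <= y by rewrite divr_ge0 ?mulr_ge0// ltW.
  pose j := Num.truncn y.
  have /andP[jy yj] := truncn_itv y0.
  apply: (jet_boundW (ltW sg_gt0) (lexx sg) _ (S_bound _)); last first.
    exists j.+1 => N jN; apply: (fin_bound2 jN).
    have -> : `|t| = expR x * 2 by rewrite xE divfK.
    have -> : r ^+ j = expR (- (j%:R * (ln 2 / eta))) by rewrite /r -expRM_natl mulrN.
    rewrite mulrA ler_pMl// -expRD -[leLHS]expR0 ler_expR addrC subr_ge0 mulrA ler_pdivrMr//.
    by rewrite -ler_pdivlMr.
  have -> : (2^-1 : R) ^+ (2 ^ j) = expR (- (ln 2 * (2 ^ j)%:R)).
    rewrite -mulrN mulrC mulNr -mulrN -lnV ?posrE// expRM_natl lnK//.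
    by rewrite posrE invr_gt0.
  rewrite ler_expR lerNl -mulrN opprB mulrAC -mulrA ler_wpM2l ?(ltW ln2_gt0)//.
  rewrite ler_pdivrMr// lerBlDr.
  have -> : (`|t| / 2) `^ eta = expR (x * eta) by rewrite expRM xE.
  have -> : ((2 ^ j)%:R : R) = expR (j%:R * ln 2) by rewrite expRM_natl lnK ?posrE// natrX.
  have : expR (x * eta) <= expR (j%:R * ln 2) * 2.
    have -> : expR (j%:R * ln 2) * 2 = expR (j.+1%:R * ln 2) :> R.
      by rewrite -[j.+1%:R]natr1 mulrDl mul1r expRD [expR (ln 2)]lnK ?posrE.
    by rewrite ler_expR -ler_pdivrMr// ltW.
  by lra.
Qed.

End decaying_jet.

(** * Moving the spectrum away from the origin by modulation *)

Section modulated.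
Variable R : realType.
Variables (S : nat -> R -> R) (sg w dl : R).
Hypothesis jS : jet S.
Hypothesis sg0 : 0 < sg.
Hypothesis w0 : 0 < w.
Hypothesis dl0 : 0 < dl.
Hypothesis wdl : (sg / w) ^+ 2 + 2 * (sg / w) <= dl.

(** Amplitudes (P, Q) for which P cos(wt) + Q sin(wt) results from S cos(wt) by k applications of
    -w^(-2) D^2 - 1. On the Fourier side one application multiplies by (frequency/w)^2 - 1, which is
    small on the spectrum when w is large compared with sg. *)
Fixpoint amplitudes k : (nat -> R -> R) * (nat -> R -> R) :=
  if k is n.+1 then
    let: (P, Q) := amplitudes n in
    (jet_comb (- w ^- 2) (- (2 / w)) (jet_shift (jet_shift P)) (jet_shift Q),
     jet_comb (2 / w) (- w ^- 2) (jet_shift P) (jet_shift (jet_shift Q)))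
  else (S, jet_comb 0 0 S S).

Definition carrier c := jet_affine w 0 (@jet_trig R c).

Definition modulated k : nat -> R -> R :=
  jet_comb 1 1 (jet_mul (amplitudes k).1 (carrier 0))
               (jet_mul (amplitudes k).2 (carrier (- (pi / 2)))).

Lemma amplitudesP k : jet (amplitudes k).1 /\ jet (amplitudes k).2.
Proof.
elim: k => [|k] /=; first by split => //; exact: jet_combP.
case: (amplitudes k) => P Q /= [jP jQ].
by split; apply: jet_combP; do ?apply: jet_shiftP.
Qed.

Lemma modulatedP k : jet (modulated k).
Proof.
have [jP jQ] := amplitudesP k.
by apply: jet_combP; apply: jet_mulP => //; exact/jet_affineP/jet_trigP.
Qed.

(** The operator annihilates cos(wt) and sin(wt), so only terms with a derivative of an amplitude
    remain; they cost sg^2/w^2 + 2 sg/w <= dl. *)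
Lemma amplitudes_bound k M t : jet_bound S sg M t ->
  jet_bound (amplitudes k).1 sg (M * dl ^+ k) t /\
  jet_bound (amplitudes k).2 sg (M * dl ^+ k) t.
Proof.
move=> bS; have M0 := jet_bound_ge0 bS.
elim: k => [|k] /=.
  rewrite expr0 mulr1; split => //.
  apply: jet_boundW (jet_bound_comb 0 0 bS bS) => //; first exact: ltW.
  by rewrite !normr0 !mul0r addr0.
case: (amplitudes k) => P Q /= [bP bQ].
have H : w ^- 2 * (M * dl ^+ k * sg * sg) + 2 / w * (M * dl ^+ k * sg) <= M * dl ^+ k.+1.
  have -> : w ^- 2 * (M * dl ^+ k * sg * sg) + 2 / w * (M * dl ^+ k * sg) =
     M * dl ^+ k * ((sg / w) ^+ 2 + 2 * (sg / w)) by field; rewrite gt_eqF.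
  by rewrite [dl ^+ k.+1]exprSr [leRHS]mulrA ler_wpM2l// mulr_ge0// exprn_ge0// ltW.
have n1 : `|w ^- 2| = w ^- 2 by rewrite ger0_norm// invr_ge0 exprn_ge0// ltW.
have n2 : `|2 / w| = 2 / w by rewrite ger0_norm// divr_ge0// ltW.
have h1 := jet_bound_comb (- w ^- 2) (- (2 / w))
  (jet_bound_shift (jet_bound_shift bP)) (jet_bound_shift bQ).
have h2 := jet_bound_comb (2 / w) (- w ^- 2)
  (jet_bound_shift bP) (jet_bound_shift (jet_bound_shift bQ)).
split; [apply: jet_boundW h1|apply: jet_boundW h2]; rewrite ?lexx ?(ltW sg0)//.
- by rewrite !normrN n1 n2.
- by rewrite !normrN n1 n2 addrC.
Qed.

Lemma modulated_bound k M t : jet_bound S sg M t ->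
  jet_bound (modulated k) (sg + w) (2 * M * dl ^+ k) t.
Proof.
move=> bS; have [bP bQ] := amplitudes_bound k bS.
have bc c : jet_bound (carrier c) w 1 t.
  by rewrite -[w]mulr1; apply: jet_bound_affine; [exact: ltW|exact: jet_bound_trig].
apply: jet_boundW (jet_bound_comb 1 1 (jet_bound_mul bP (bc _)) (jet_bound_mul bQ (bc _))) =>
  //.
  by rewrite addr_ge0 ?ltW.
by rewrite normr1 !mul1r mulr1 -mulr2n -mulrA mulr_natl.
Qed.

Lemma modulated_rel k t :
  modulated k 2%N t = - w ^+ 2 * (modulated k.+1 0%N t + modulated k 0%N t).
Proof.
rewrite /modulated /=; case: (amplitudes k) => P Q /=.
rewrite /jet_comb /jet_mul /= /jet_shift /= /carrier /jet_affine.
have T1 x : jet_trig 0 1 x = - sin x by rewrite /jet_trig addr0 cosDpihalf.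
have T2 x : jet_trig 0 2 x = - cos x.
  by rewrite /jet_trig addr0 [pi / 2 *+ 2]mulr2n addrA cosDpihalf sinDpihalf.
rewrite !jet_trig0 jet_trig_sin T1 T2 jet_trig_cos !addr0.
by field; rewrite gt_eqF.
Qed.

Lemma modulated00 : S 0%N 0 = 1 -> modulated 0 0%N 0 = 1.
Proof.
move=> S1; rewrite /modulated /= /jet_comb /jet_mul /= /carrier /jet_affine.
by rewrite mulr0 addr0 jet_trig_cos cos0 S1; ring.
Qed.

End modulated.

Lemma exists_modulated (R : realType) (eta dl : R) : 0 < eta -> eta < 1 -> 0 < dl -> dl <= 1 ->
  exists th : nat -> nat -> R -> R, exists w A C c : R,
  [/\ 0 < w, 1 <= A, 1 <= C & 0 < c] /\
  [/\ forall k, jet (th k), th 0%N 0%N 0 = 1,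
    forall k t, th k 2%N t = - w ^+ 2 * (th k.+1 0%N t + th k 0%N t),
    forall k t, jet_bound (th k) A (2 * dl ^+ k) t &
    forall k t, jet_bound (th k) A (C * expR (- (c * `|t| `^ eta)) * dl ^+ k) t].
Proof.
move=> e0 e1 d0 d1.
have [S [sg [C [c [sg0 C1 c0 jS [S1 bS bS2]]]]]] := exists_decaying_jet e0 e1.
(* With sg/w = dl/3 one application costs (dl/3)^2 + 2 dl/3, which is at most dl because dl <= 1. *)
pose w := 3 * sg / dl.
have w0 : 0 < w by rewrite divr_gt0// mulr_gt0.
have wdl : (sg / w) ^+ 2 + 2 * (sg / w) <= dl.
  have -> : sg / w = dl / 3 by rewrite /w; field; rewrite !gt_eqF.
  have : dl ^+ 2 <= dl by rewrite expr2 ler_piMr// ltW.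
  by rewrite expr_div_n; lra.
exists (modulated S w), w, (sg + w + 1), (2 * C), c; split; first by split => //; lra.
split.
- exact: modulatedP.
- exact: modulated00.
- by move=> k t; exact: modulated_rel.
- move=> k t; apply: (jet_boundW _ _ _ (modulated_bound sg0 w0 d0 wdl k (bS t))).
  + by rewrite addr_ge0 ?ltW.
  + by rewrite lerDl.
  + by rewrite mulr1.
- move=> k t; apply: (jet_boundW _ _ _ (modulated_bound sg0 w0 d0 wdl k (bS2 t))).
  + by rewrite addr_ge0 ?ltW.
  + by rewrite lerDl.
  + by rewrite !mulrA.
Qed.

(** * The binomial series with a real exponent *)

Section binomial_series.
Variable R : realType.
Variable s : R.
Hypothesis s0 : 0 < s.

Fixpoint gbinom (k : nat) : R := if k is n.+1 then gbinom n * ((s - n%:R) / n.+1%:R) else 1.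

Lemma gbinomS n : n.+1%:R * gbinom n.+1 = (s - n%:R) * gbinom n.
Proof. by rewrite /= mulrCA [_ * (_ / _)]mulrC divfK ?pnatr_eq0// mulrC. Qed.

(** A crude bound from |s - n| <= (1 + s)(n + 1), sufficient because the series is only summed in a
    small disc. *)
Lemma gbinom_norm k : `|gbinom k| <= (1 + s) ^+ k.
Proof.
elim: k => [|k IH] /=; first by rewrite normr1.
rewrite normrM exprSr ler_pM// normrM normfV normr_nat ler_pdivrMr ?ltr0n//.
apply: le_trans (ler_normB _ _) _; rewrite normr_nat gtr0_norm// -[k.+1%:R]natr1.
have : 0 <= s * k%:R by rewrite mulr_ge0// ltW.
lra.
Qed.

(** At this radius coefficients of size (4(1 + s))^i sum with ratio 1/2; this covers the series
    differentiated twice. *)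
Let K : R := (8 * (1 + s))^-1.

Let s1 : 0 <= 1 + s. Proof. by rewrite addr_ge0// ltW. Qed.

Let K_ge0 : 0 <= K. Proof. by rewrite invr_ge0 mulr_ge0. Qed.

Let nat_le_exp2 n : n.+1%:R <= 2 ^+ n :> R.
Proof. by rewrite -natrX ler_nat; exact: ltn_expl. Qed.

Let cvg_geo (a : nat -> R) C v : 0 <= C -> `|v| <= K ->
  (forall i, `|a i| <= C * (4 * (1 + s)) ^+ i) ->
  abs_bounded (fun i => a i * v ^+ i) (C / (1 - 2^-1)).
Proof.
move=> C0 vK H; apply: abs_bounded_geo => //.
  by rewrite invr_ge0 ler0n /= invf_lt1// ltr1n.
move=> i; rewrite normrM normrX.
apply: (@le_trans _ _ (C * (4 * (1 + s)) ^+ i * K ^+ i)).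
  by rewrite ler_pM// lerXn2r// nnegrE.
rewrite -mulrA -exprMn ler_wpM2l// /K.
rewrite (_ : 4 * (1 + s) / (8 * (1 + s)) = 2^-1)//.
by field; rewrite gt_eqF// addr_gt0.
Qed.

Let d1 := fun n : nat => (s - n%:R) * gbinom n.

Let gb_le i : `|gbinom i| <= 1 * (4 * (1 + s)) ^+ i.
Proof.
rewrite mul1r (le_trans (gbinom_norm i))// lerXn2r// ?nnegrE ?mulr_ge0 ?addr_ge0 ?ltW//.
by rewrite ltr_pMl ?addr_gt0// ltr1n.
Qed.

Let d1_le i : `|d1 i| <= (1 + s) * (2 * (1 + s)) ^+ i.
Proof.
rewrite /d1 normrM exprMn mulrA ler_pM// ?gbinom_norm//.
apply: le_trans (ler_normB _ _) _; rewrite normr_nat gtr0_norm//.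
apply: (@le_trans _ _ ((1 + s) * i.+1%:R)); last by rewrite ler_wpM2l.
have : 0 <= s * i%:R by rewrite mulr_ge0// ltW.
by rewrite -natr1; lra.
Qed.

Let ib_le i : `|i%:R * gbinom i| <= 1 * (4 * (1 + s)) ^+ i.
Proof.
rewrite normrM normr_nat mul1r (_ : 4 * (1 + s) = 4 * 1 * (1 + s)); last by ring.
rewrite exprMn ler_pM// ?gbinom_norm// mulr1.
apply: (@le_trans _ _ (2 ^+ i)); last by rewrite lerXn2r ?nnegrE// ler_nat.
by apply: le_trans (nat_le_exp2 i); rewrite ler_nat.
Qed.

Let F v := rsum (fun i => gbinom i * v ^+ i).

Let D v := rsum (fun i => d1 i * v ^+ i).

Let F_derive (v : R) : `|v| < K -> is_derive v 1 F (D v).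
Proof.
move=> vK; have K0 : 0 < K by rewrite invr_gt0 mulr_gt0// addr_gt0.
have E : pseries_diffs gbinom = d1.
  by apply/funext => i; rewrite /pseries_diffs gbinomS.
have KK : `|K| <= K by rewrite gtr0_norm.
have := @pseries_snd_diffs R gbinom K v; rewrite E; apply.
- exact: abs_bounded_cvg (cvg_geo ler01 KK gb_le).
- apply: (@abs_bounded_cvg _ (fun i => d1 i * K ^+ i) ((1 + s) / (1 - 2^-1))).
  apply: (cvg_geo s1 KK) => i; apply: le_trans (d1_le i) _.
  by rewrite ler_wpM2l// lerXn2r// ?nnegrE ?mulr_ge0// ler_wpM2r// ler_nat.
- have C0 : 0 <= (1 + s) * (2 * (1 + s)) by rewrite !mulr_ge0.
  apply: (@abs_bounded_cvg _ (fun i => pseries_diffs d1 i * K ^+ i) ((1 + s) * (2 * (1 + s)) /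
    (1 - 2^-1))).
  apply: (cvg_geo C0 KK) => i; rewrite /pseries_diffs normrM normr_nat.
  apply: (@le_trans _ _ (2 ^+ i * ((1 + s) * (2 * (1 + s)) ^+ i.+1))).
    by apply: ler_pM => //; exact: d1_le.
  rewrite le_eqVlt; apply/orP; left; apply/eqP.
  rewrite exprS (_ : 4 * (1 + s) = 2 * (2 * (1 + s))); last by ring.
  by rewrite (exprMn i 2 (2 * (1 + s))); ring.
- by rewrite (gtr0_norm K0).
Qed.

Let ode v : `|v| <= K -> (1 + v) * D v = s * F v.
Proof.
move=> vK.
have bF := cvg_geo ler01 vK gb_le.
have bI := cvg_geo ler01 vK ib_le.
have E : D v = s * F v - rsum (fun i => i%:R * gbinom i * v ^+ i).
  rewrite -(rsumZ s bF) -(rsumB (abs_boundedZ s bF) bI).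
  by congr rsum; apply/funext => i; rewrite /d1; ring.
have bS : abs_bounded (fun i => d1 i * v ^+ i) ((1 + s) / (1 - 2^-1)).
  apply: (cvg_geo s1 vK) => i; apply: le_trans (d1_le i) _.
  by rewrite ler_wpM2l// lerXn2r// ?nnegrE ?mulr_ge0// ler_wpM2r// ler_nat.
have E2 : rsum (fun i => i%:R * gbinom i * v ^+ i) = v * D v.
  rewrite (rsum_recl bI) !mul0r add0r -(rsumZ v bS); congr rsum.
  by apply/funext => i; rewrite gbinomS exprS /d1; ring.
by move: E; rewrite E2; lra.
Qed.

(** The sum F satisfies (1 + v) F' = s F, so F(v) (1 + v)^(-s) has derivative zero and keeps its
    value 1 at the origin. *)
Lemma binomial_series v : `|v| < (8 * (1 + s))^-1 ->
  rsum (fun i => gbinom i * v ^+ i) = (1 + v) `^ s.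
Proof.
rewrite -/K => vK.
have K1 : K < 1.
  have h : 1 < 8 * (1 + s) by have := s0; lra.
  by rewrite /K invf_lt1// (lt_trans _ h).
have pos u : `|u| < K -> 0 < 1 + u by rewrite ltr_norml => /andP[]; lra.
pose g u := F u * expR (- s * ln (1 + u)).
have : `|g v - g 0| <= 0 * `|v - 0|.
  apply: (@MVT_norm _ g (fun u => 0)) => u uI; split => //; last by rewrite normr0.
  have uK : `|u| < K.
    move: vK uI; rewrite in_itv /= !ltr_norml ge_min le_max => /andP[? ?] /andP[/orP[]?
      /orP[]?]; lra.
  have u0 := pos u uK.
  have dl : is_derive u 1 (fun x => ln (1 + x)) (1 + u)^-1.
    have := @is_derive_affine _ (@ln R) 1 1 u _ (is_derive1_ln _).
    under eq_fun do rewrite mul1r addrC.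
    by rewrite !mul1r addrC; apply.
  have de : is_derive u 1 (fun x => expR (- s * ln (1 + x)))
      (expR (- s * ln (1 + u)) * (- s * (1 + u)^-1)).
    have h := is_deriveMr (- s) dl.
    by have := @is_derive1_comp R expR (fun x => - s * ln (1 + x)) u _ _ (is_derive_expR _) h.
  have := is_deriveMl2 (F_derive uK) de; move/is_derive_eq; apply.
  have o := ode (ltW uK).
  have -> : D u = s * F u / (1 + u) by rewrite -o mulrAC mulfV ?mul1r// gt_eqF.
  ring.
rewrite mul0r normr_le0 subr_eq0 /g => /eqP.
have -> : F 0 = 1.
  apply: rsum_unique; apply: cvg_near_cst; exists 1%N => // -[//|N] _ /=.
  by rewrite big_ord_recl big1 => [|i _]; rewrite ?expr0 ?mulr1 ?addr0// expr0n mulr0.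
rewrite addr0 ln1 mulr0 expR0 mulr1 /F => h.
rewrite /powR gt_eqF ?pos//.
apply: (@mulIf _ (expR (- s * ln (1 + v)))); first by rewrite gt_eqF ?expR_gt0.
by rewrite h -expRD mulNr subrr expR0.
Qed.

End binomial_series.

(** * Integrals and Fourier transforms *)

Section real_integration.
Context d (T : measurableType d) (R : realType) (mu : {measure set T -> \bar R}).
Implicit Types f g : T -> R.

Definition rintegrable f := mu.-integrable setT (EFin \o f).

Definition rint f : R := Rintegral mu setT f.

Lemma rintegrable_measurable f : rintegrable f -> measurable_fun setT f.
Proof. by move=> /measurable_int /measurable_EFinP. Qed.

Lemma le_rintegrable f g : measurable_fun setT f -> (forall x, `|f x| <= g x) ->
  rintegrable g -> rintegrable f.
Proof.
move=> mf fg; apply: le_integrable => //; first exact/measurable_EFinP.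
by move=> x _ /=; rewrite lee_fin (le_trans (fg x))// ler_norm.
Qed.

Lemma rintegrableD f g : rintegrable f -> rintegrable g -> rintegrable (fun x => f x + g x).
Proof. by move=> If Ig; have := integrableD measurableT If Ig. Qed.

Lemma rintegrableZ c f : rintegrable f -> rintegrable (fun x => c * f x).
Proof. by move=> If; have := integrableZl measurableT c If. Qed.

Lemma rintegrableM f g C : rintegrable f -> measurable_fun setT g ->
  (forall x, `|g x| <= C) -> rintegrable (fun x => f x * g x).
Proof.
move=> If mg gC; have mf := rintegrable_measurable If.
have := rintegrableZ C (integrable_norm If).
apply: le_rintegrable; first exact: measurable_funM.
by move=> x; rewrite normrM mulrC ler_wpM2r.
Qed.

Lemma rint_comb a b f g : rintegrable f -> rintegrable g ->
  rint (fun x => a * f x + b * g x) = a * rint f + b * rint g.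
Proof.
move=> If Ig; rewrite /rint (RintegralD measurableT (rintegrableZ a If) (rintegrableZ b Ig)).
by rewrite !RintegralZl.
Qed.

Lemma rintZ a f : rintegrable f -> rint (fun x => a * f x) = a * rint f.
Proof. by move=> If; exact: RintegralZl. Qed.

Lemma rint_norm_le f g : rintegrable f -> rintegrable g -> (forall x, `|f x| <= g x) ->
  `|rint f| <= rint g.
Proof.
move=> If Ig fg; apply: le_trans (le_normr_Rintegral measurableT If) _.
by apply: le_Rintegral => //; exact: integrable_norm.
Qed.

Lemma le_rint f g : rintegrable f -> rintegrable g -> (forall x, f x <= g x) -> rint f <= rint
  g.
Proof. by move=> If Ig fg; apply: le_Rintegral. Qed.

Lemma measurable_fun_lim (f_ : nat -> T -> R) f : (forall n, measurable_fun setT (f_ n)) ->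
  (forall x, f_ ^~ x @ \oo --> f x) -> measurable_fun setT f.
Proof.
move=> mf ff; apply/measurable_EFinP.
apply: (@emeasurable_fun_cvg _ _ _ _ (fun n x => (f_ n x)%:E)).
  by move=> n; exact/measurable_EFinP.
by move=> x _; apply: cvg_EFin; [exact: nearW|exact: ff].
Qed.

Lemma rdominated (f_ : nat -> T -> R) f g : (forall n, measurable_fun setT (f_ n)) ->
  (forall x, f_ ^~ x @ \oo --> f x) -> (forall n x, `|f_ n x| <= g x) -> rintegrable g ->
  rintegrable f /\ (fun n => rint (f_ n)) @ \oo --> rint f.
Proof.
move=> mf ff fg Ig; have mF := measurable_fun_lim mf ff.
have fg' x : `|f x| <= g x.
  have c : (fun n => `|f_ n x|) @ \oo --> `|f x| by apply: cvg_norm; exact: ff.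
  by apply: (cvgr_to_le c); exact: nearW.
have If := le_rintegrable mF fg' Ig; split => //.
have In n : rintegrable (f_ n) by exact: le_rintegrable (fg n) Ig.
have ffE x : (fun n => (f_ n x)%:E) @ \oo --> (f x)%:E.
  by apply: cvg_EFin; [exact: nearW|exact: ff].
have [] := @dominated_convergence _ T R mu setT measurableT
  (fun n => EFin \o f_ n) (EFin \o f) (EFin \o g).
- by move=> n; exact/measurable_EFinP/mf.
- exact/measurable_EFinP.
- by apply: aeW => x _; exact: ffE.
- exact: Ig.
- by apply: aeW => x n _; rewrite /= lee_fin.
move=> _ _  H; rewrite /rint /Rintegral; apply: fine_cvg.
by rewrite fineK ?integrable_fin_num.
Qed.

End real_integration.

Section growth.
Variable R : realType.

(* e^y >= (y/k)^k with y = c r^eta and k = a/eta *)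
Lemma powR_le_expR (a c eta : R) : 0 < a -> 0 < c -> 0 < eta ->
  exists2 C, 0 < C & forall r, 0 <= r -> r `^ a <= C * expR (c * r `^ eta).
Proof.
move=> a0 c0 e0; have [k kE] : exists k, k = a / eta by exists (a / eta).
have k0 : 0 < k by rewrite kE divr_gt0.
have kc : 0 < k / c by exact: divr_gt0.
exists ((k / c) `^ k); first exact: powR_gt0.
move=> r r0.
have -> : r `^ a = (k / c * (c * r `^ eta / k)) `^ k.
  have -> : k / c * (c * r `^ eta / k) = r `^ eta by field; rewrite !gt_eqF.
  by rewrite -powRrM kE mulrC divfK// gt_eqF.
have y0 : 0 <= c * r `^ eta / k by rewrite divr_ge0 ?mulr_ge0 ?powR_ge0// ltW.
rewrite (powRM _ (ltW kc) y0) ler_wpM2l ?powR_ge0//.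
have -> : expR (c * r `^ eta) = expR (c * r `^ eta / k) `^ k.
  by rewrite -expRM divfK// gt_eqF.
rewrite ge0_ler_powR ?nnegrE ?(ltW k0) ?expR_ge0//.
by apply: le_trans (expR_ge1Dx _); rewrite lerDr.
Qed.

(** Beyond [r1] one has r^(eta - rho) >= 1/e. In this way the factors exp(B|p|^rho) produced by the
    scales are absorbed by a small part of exp(-tau|p|^eta). *)
Lemma powR_le_eps (rho eta e : R) : 0 < rho -> rho < eta -> 0 < e ->
  exists2 C, 0 <= C & forall r, 0 <= r -> r `^ rho <= C + e * r `^ eta.
Proof.
move=> r0 re e0; pose r1 := (e^-1) `^ ((eta - rho)^-1).
have eta0 : 0 < eta by exact: lt_trans re.
exists (r1 `^ rho); first exact: powR_ge0.
move=> r rr; have [rr1|/ltW rr1] := leP r r1.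
  rewrite -[leLHS]addr0 lerD ?mulr_ge0 ?powR_ge0 ?(ltW e0)//.
  by rewrite ge0_ler_powR ?nnegrE ?powR_ge0 ?(ltW r0).
rewrite -[leLHS]add0r lerD ?powR_ge0//.
have H : e^-1 <= r `^ (eta - rho).
  have -> : e^-1 = r1 `^ (eta - rho).
    by rewrite /r1 -powRrM mulVf ?powRr1 ?invr_ge0 ?(ltW e0)// subr_eq0 gt_eqF.
  by rewrite ge0_ler_powR ?nnegrE ?powR_ge0 ?subr_ge0 ?(ltW re).
have -> : r `^ eta = r `^ (eta - rho) * r `^ rho.
  by rewrite -powRD subrK// gt_eqF.
rewrite mulrA -[leLHS]mul1r ler_wpM2r ?powR_ge0//.
by rewrite -(mulfV (lt0r_neq0 e0)) ler_wpM2l// ltW.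
Qed.

Lemma subexp_le_invsq (c eta : R) : 0 < c -> 0 < eta ->
  exists2 C, 0 < C & forall t : R, expR (- (c * `|t| `^ eta)) <= C / (1 + t ^+ 2).
Proof.
move=> c0 e0; have [C C0 H] := powR_le_expR (ltr0Sn _ 1) c0 e0.
exists (1 + C); first by rewrite addr_gt0.
move=> t; have := H `|t| (normr_ge0 t).
rewrite powR_mulrn// real_normK ?num_real// => {}H.
set y := c * _ in H *.
rewrite ler_pdivlMr; last by rewrite ltr_wpDr ?sqr_ge0.
rewrite mulrDr mulr1; apply: lerD.
  by rewrite -[leRHS]expR0 ler_expR oppr_le0 mulr_ge0 ?powR_ge0// ltW.
by rewrite mulrC expRN ler_pdivrMr ?expR_gt0.
Qed.

End growth.

Section fourier1d.
Variable R : realType.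
Local Notation leb := (@lebesgue_measure R).
Implicit Types f : R -> R.

(** The integrable majorant in one variable: its integral is explicit and, up to a constant, it
    dominates exp(-c|t|^eta). *)
Definition invsq (t : R) : R := (1 + t ^+ 2)^-1.

Lemma invsq_continuous : continuous invsq.
Proof. exact: continuous_oneDsqrV. Qed.

Lemma continuous_measurable f : continuous f -> measurable_fun setT f.
Proof. exact: continuous_measurable_fun. Qed.

Lemma invsq_integrable : rintegrable leb invsq.
Proof.
apply/integrableP; split.
  by apply/measurable_EFinP; exact: (continuous_measurable invsq_continuous).
have i0 t : 0 <= invsq t by rewrite invr_ge0 addr_ge0// sqr_ge0.
under eq_integral do rewrite /= ger0_norm//.
rewrite ge0_symfun_integralT//; last 2 first.
- exact: invsq_continuous.
- by move=> t; rewrite /= /invsq sqrrN.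
have -> : [set x : R | 0 <= x] = `[0, +oo[%classic by rewrite set_itvcy.
by rewrite integral0y_oneDsqr -EFinM ltry.
Qed.

Lemma invsq_dominated f K : continuous f -> (forall t, `|f t| <= K * invsq t) ->
  rintegrable leb f.
Proof.
move=> cf fK; apply: (@le_rintegrable _ _ R leb f (fun t => K * invsq t)) => //.
  exact: continuous_measurable.
exact/rintegrableZ/invsq_integrable.
Qed.

(** The fundamental theorem of calculus on [-n, n]: the end values are O(1/n), and the truncated
    integrals converge by domination. *)
Lemma rint_derive0 (h dh : R -> R) K : (forall t : R, is_derive t 1 h (dh t)) -> continuous dh
  ->
  (forall t, `|h t| <= K * invsq t) -> (forall t, `|dh t| <= K * invsq t) ->
  rint leb dh = 0.
Proof.
move=> dH cdh hK dhK.
have ch : continuous h.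
  by move=> t; apply/differentiable_continuous/derivable1_diffP;
    exact: (@ex_derive _ _ _ _ _ _ _ (dH t)).
have K0 : 0 <= K.
  by have := le_trans (normr_ge0 _) (hK 0); rewrite pmulr_lge0// invr_gt0 expr0n addr0.
pose I n : set R := `[- n.+1%:R, n.+1%:R]%classic.
have mI n : measurable (I n) by exact: measurable_itv.
have mIt n : measurable_fun setT (fun t => dh t * \1_(I n) t).
  by apply: measurable_funM; [exact: continuous_measurable|exact: measurable_indic].
have cIt x : (fun n => dh x * \1_(I n) x) @ \oo --> dh x.
  apply: cvg_near_cst; exists (Num.truncn `|x|) => // n /= xn.
  suff xI : I n x by rewrite indicE mem_set ?mulr1.
  rewrite /I /= in_itv /= -ler_norml.
  have := truncnS_gt `|x|; move/ltW/le_trans; apply.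
  by rewrite ler_nat.
have bIt n x : `|dh x * \1_(I n) x| <= K * invsq x.
  rewrite normrM; apply: le_trans (dhK x).
  by rewrite ler_piMr// indicE; case: (_ \in _); rewrite ?normr1 ?normr0.
have [_ H] := @rdominated _ _ R leb _ dh _ mIt cIt bIt (rintegrableZ K invsq_integrable).
have {}H : (fun n => h n.+1%:R - h (- n.+1%:R)) @ \oo --> rint leb dh.
  have -> : (fun n => h n.+1%:R - h (- n.+1%:R)) =
            (fun n => rint leb (fun t => dh t * \1_(I n) t)).
    apply/funext => n; rewrite /rint /Rintegral.
    transitivity (fine (\int[leb]_(x in I n) (dh x)%:E)); last first.
      rewrite [in LHS]integral_mkcond; congr (fine (integral _ _ _)); apply/funext => x.
      by rewrite patchE indicE; case: ifP => _; rewrite ?mulr1 ?mulr0.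
    rewrite (@continuous_FTC2 _ dh h)//=.
    - by rewrite -subr_gt0 opprK addr_gt0.
    - exact: continuous_subspaceT.
    - split => [x _||]; first exact: (@ex_derive _ _ _ _ _ _ _ (dH x)).
      + exact/cvg_at_right_filter/ch.
      + exact/cvg_at_left_filter/ch.
    - by move=> x _; rewrite derive1E; exact: (@derive_val _ _ _ _ _ _ _ (dH x)).
  exact: H.
have Z : (fun n => h n.+1%:R - h (- n.+1%:R)) @ \oo --> (0 : R).
  have c2 : (fun n => (2 * K) * n.+1%:R^-1) @ \oo --> (0 : R).
    by rewrite -[X in _ --> X](mulr0 (2 * K)); apply: cvgMl_tmp; exact: cvg_harmonic.
  have c1 : (fun n => - ((2 * K) * n.+1%:R^-1)) @ \oo --> (0 : R).
    by rewrite -[X in _ --> X]oppr0; exact: cvgN.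
  apply: squeeze_cvgr c1 c2; apply: nearW => n.
  rewrite -ler_norml; apply: le_trans (ler_normB _ _) _.
  have B (x : R) : x ^+ 2 = n.+1%:R ^+ 2 -> `|h x| <= K * n.+1%:R^-1.
    move=> xE; apply: le_trans (hK x) _; rewrite ler_wpM2l// /invsq xE lef_pV2 ?posrE//.
      rewrite -[n.+1%:R]natr1; have : 0 <= n%:R :> R by []. nra.
  rewrite -mulrA mulr_natl mulr2n lerD// B// sqrrN//.
by apply: (cvg_unique _ H Z).
Qed.

Definition cosint a f := rint leb (fun t => f t * cos (a * t)).

Definition sinint a f := rint leb (fun t => f t * sin (a * t)).

Lemma cosa_continuous a : continuous (fun t : R => cos (a * t)).
Proof.
move=> t; apply: continuous_comp; last exact: continuous_cos.
by apply: cvgMl_tmp; exact: cvg_id.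
Qed.

Lemma sina_continuous a : continuous (fun t : R => sin (a * t)).
Proof.
move=> t; apply: continuous_comp; last exact: continuous_sin.
by apply: cvgMl_tmp; exact: cvg_id.
Qed.

Lemma trig_rintegrable a f : rintegrable leb f ->
  rintegrable leb (fun t => f t * cos (a * t)) /\ rintegrable leb (fun t => f t * sin (a * t)).
Proof.
move=> If; split; apply: (rintegrableM (C := 1) If).
- exact: (continuous_measurable (@cosa_continuous a)).
- by move=> x; exact: norm_cos_le1.
- exact: (continuous_measurable (@sina_continuous a)).
- by move=> x; exact: norm_sin_le1.
Qed.

Lemma is_derive_cosa (a t : R) : is_derive t 1 (fun t => cos (a * t)) (a * - sin (a * t)).
Proof.
have := @is_derive_affine _ (@cos R) a 0 t _ (is_derive_cos _).
by under eq_fun do rewrite addr0; rewrite addr0.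
Qed.

Lemma is_derive_sina (a t : R) : is_derive t 1 (fun t => sin (a * t)) (a * cos (a * t)).
Proof.
have := @is_derive_affine _ (@sin R) a 0 t _ (is_derive_sin _).
by under eq_fun do rewrite addr0; rewrite addr0.
Qed.

(** Both integrations by parts are done at once: f'' cos + a^2 f cos is the derivative of f' cos + a
    f sin, and f'' sin + a^2 f sin that of f' sin - a f cos. *)
Lemma fourier_second_derivative (f : nat -> R -> R) a K : jet f ->
  (forall m t, (m <= 2)%N -> `|f m t| <= K * invsq t) ->
  cosint a (f 2%N) = - a ^+ 2 * cosint a (f 0%N) /\
  sinint a (f 2%N) = - a ^+ 2 * sinint a (f 0%N).
Proof.
move=> jf fK.
have cf m : continuous (f m) by exact: jet_continuous.
have If m : (m <= 2)%N -> rintegrable leb (f m) by move=> m2;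
  apply: (invsq_dominated (cf m)) => t; exact: fK.
have [c0 s0] := trig_rintegrable a (If 0%N isT).
have [c2 s2] := trig_rintegrable a (If 2%N isT).
have B (g1 g2 : R -> R) b1 b2 m1 m2 (t : R) : (m1 <= 2)%N -> (m2 <= 2)%N ->
    `|g1 t| <= 1 -> `|g2 t| <= 1 ->
   `|b1 * (f m1 t * g1 t) + b2 * (f m2 t * g2 t)| <= (`|b1| + `|b2|) * K * invsq t.
  move=> h1 h2 G1 G2; apply: le_trans (ler_normD _ _) _; rewrite !normrM -mulrA mulrDl.
  by apply: lerD; rewrite ler_wpM2l// -[leRHS]mulr1 ler_pM// fK.
have C (g1 g2 : R -> R) b1 b2 m1 m2 : continuous g1 -> continuous g2 ->
   continuous (fun t => b1 * (f m1 t * g1 t) + b2 * (f m2 t * g2 t)).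
  move=> C1 C2 t; apply: cvgD; apply: cvgMl_tmp; apply: cvgM.
  - exact: cf.
  - exact: C1.
  - exact: cf.
  - exact: C2.
have K0 : 0 <= K.
  by have := le_trans (normr_ge0 _) (fK 0%N 0 isT); rewrite pmulr_lge0// invr_gt0 expr0n addr0.
have i0 (t : R) : 0 <= invsq t by rewrite invr_ge0 addr_ge0// sqr_ge0.
pose KK := (1 + `|a| + `|a ^+ 2|) * K.
have L1 (t b : R) : `|b| <= `|a| + `|a ^+ 2| -> (1 + `|b|) * K * invsq t <= KK * invsq t.
  by move=> h; rewrite ler_wpM2r// ler_wpM2r// -addrA lerD2l.
split.
- suff : rint leb (fun t => 1 * (f 2%N t * cos (a * t)) + a ^+ 2 * (f 0%N t * cos (a * t))) = 0.
    by rewrite rint_comb// mul1r => /eqP; rewrite addr_eq0 -mulNr => /eqP.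
  apply: (@rint_derive0 (fun t => 1 * (f 1%N t * cos (a * t)) + a * (f 0%N t * sin (a * t))) _
    KK).
  + move=> t.
    have d1 := is_deriveMr 1 (is_deriveMl2 (jf 1%N t) (is_derive_cosa a t)).
    have d2 := is_deriveMr a (is_deriveMl2 (jf 0%N t) (is_derive_sina a t)).
    by have := is_deriveDl d1 d2; move/is_derive_eq; apply; ring.
  + by apply: C; exact: cosa_continuous.
  + move=> t; apply: le_trans (B (fun t => cos (a * t)) (fun t => sin (a * t)) 1 a 1%N 0%N t
    isT isT (norm_cos_le1 _) (norm_sin_le1 _)) _.
    by rewrite normr1; apply: L1; rewrite lerDl.
  + move=> t; apply: le_trans (B (fun t => cos (a * t)) (fun t => cos (a * t)) 1 (a ^+ 2) 2%N
    0%N t isT isT (norm_cos_le1 _) (norm_cos_le1 _)) _.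
    by rewrite normr1; apply: L1; rewrite lerDr.
- suff : rint leb (fun t => 1 * (f 2%N t * sin (a * t)) + a ^+ 2 * (f 0%N t * sin (a * t))) = 0.
    by rewrite rint_comb// mul1r => /eqP; rewrite addr_eq0 -mulNr => /eqP.
  apply: (@rint_derive0 (fun t => 1 * (f 1%N t * sin (a * t)) + (- a) * (f 0%N t * cos (a *
    t))) _ KK).
  + move=> t.
    have d1 := is_deriveMr 1 (is_deriveMl2 (jf 1%N t) (is_derive_sina a t)).
    have d2 := is_deriveMr (- a) (is_deriveMl2 (jf 0%N t) (is_derive_cosa a t)).
    by have := is_deriveDl d1 d2; move/is_derive_eq; apply; ring.
  + by apply: C; exact: sina_continuous.
  + move=> t; apply: le_trans (B (fun t => sin (a * t)) (fun t => cos (a * t)) 1 (- a) 1%N 0%N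
    t isT isT (norm_sin_le1 _) (norm_cos_le1 _)) _.
    by rewrite normr1; apply: L1; rewrite normrN lerDl.
  + move=> t; apply: le_trans (B (fun t => sin (a * t)) (fun t => sin (a * t)) 1 (a ^+ 2) 2%N
    0%N t isT isT (norm_sin_le1 _) (norm_sin_le1 _)) _.
    by rewrite normr1; apply: L1; rewrite lerDr.
Qed.

End fourier1d.

(** * Fubini's theorem for the measure on tuples *)

Section tuple_integration.
Variable R : realType.
Local Notation RT := (measurableTypeR R).
Local Notation leb := (@lebesgue_measure R).
Local Notation mu := (@lebesgue_tuple R).

Fixpoint tuple_cube (k : nat) (n : nat) : set (n.-tuple RT) :=
  if n is m.+1 then
    [set t : m.+1.-tuple RT | tuple_cube k [tuple of behead t] /\ `[- k%:R, k%:R]%classic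
      (thead t)]
  else setT.

Lemma measurable_thead n : measurable_fun setT (fun t : n.+1.-tuple RT => thead t).
Proof. exact: measurable_tnth. Qed.

Lemma tuple_cons_behead n (p : n.-tuple RT * RT) : [tuple of behead (tuple_cons p)] = p.1.
Proof. by apply: val_inj. Qed.

Lemma tuple_cons_thead n (p : n.-tuple RT * RT) : thead (tuple_cons p) = p.2.
Proof. by []. Qed.

Lemma measurable_tuple_cube k n : measurable (@tuple_cube k n).
Proof.
elim: n => [|n IH] /=; first exact: measurableT.
apply: measurableI.
- rewrite -[X in measurable X]setTI; exact: measurable_behead.
- have := @measurable_thead n measurableT _ (measurable_itv `[- k%:R, k%:R]).
  by rewrite setTI.
Qed.

Lemma tuple_cube_finite k n : (mu n (@tuple_cube k n) < +oo)%E.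
Proof.
elim: n => [|n IH]; first by rewrite /= diracE; case: (_ \in _); rewrite ltry.
change (mu n.+1 (@tuple_cube k n.+1)) with
  ((mu n \x leb)%E (@tuple_cons R n @^-1` (@tuple_cube k n.+1))).
have -> : @tuple_cons R n @^-1` (@tuple_cube k n.+1) = @tuple_cube k n `*` `[- k%:R,
  k%:R]%classic.
  apply/seteqP; split => p /=; rewrite tuple_cons_behead tuple_cons_thead.
    by [].
  by [].
rewrite product_measure1E//; last exact: measurable_tuple_cube.
rewrite lte_mul_pinfty//.
  by rewrite ge0_fin_numE.
by rewrite /= lebesgue_measure_itv /=; case: ifP => _; rewrite ?ltry// -EFinD ltry.
Qed.

Lemma tuple_cube_cover n : [set: n.-tuple RT] = \bigcup_k (@tuple_cube k n).
Proof.
apply/seteqP; split => // t _.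
suff [k H] : exists k, forall j, (k <= j)%N -> @tuple_cube j n t by exists k => //; exact: H.
elim: n t => [|n IH] t /=; first by exists 0%N.
have [k H] := IH [tuple of behead t].
exists (maxn k (Num.truncn `|thead t : R|).+1) => j; rewrite geq_max => /andP[kj tj].
split; first exact: H.
rewrite /= in_itv /= -ler_norml; have := truncnS_gt `|thead t : R|; move/ltW/le_trans; apply.
by rewrite ler_nat.
Qed.

Lemma lebesgue_tuple_sigma_finite n : sigma_finite setT (mu n).
Proof.
exists (fun k => @tuple_cube k n); first exact: tuple_cube_cover.
by move=> k; split; [exact: measurable_tuple_cube|exact: tuple_cube_finite].
Qed.

(** The same measure under a name to which the sigma-finite structure required by Fubini's theorem
    can be attached. *)
Definition sf_tuple n : set (n.-tuple RT) -> \bar R := mu n.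
Arguments sf_tuple : clear implicits.

HB.instance Definition _ n := isMeasure.Build _ _ _ (sf_tuple n)
  (measure0 (mu n)) (measure_ge0 (mu n)) (@measure_semi_sigma_additive _ _ _ (mu n)).

HB.instance Definition _ n := Measure_isSigmaFinite.Build _ _ _ (sf_tuple n)
  (@lebesgue_tuple_sigma_finite n).

(** [mu n.+1] is by construction the pushforward of a product measure, so this is Fubini's theorem
    followed by a change of variables. *)
Lemma rintegrable_tupleS n (A : n.-tuple RT -> R) (B : R -> R) :
  rintegrable (mu n) A -> rintegrable leb B ->
  rintegrable (mu n.+1) (fun t => A [tuple of behead t] * B (thead t)) /\
  rint (mu n.+1) (fun t => A [tuple of behead t] * B (thead t)) = rint (mu n) A * rint leb B.
Proof.
move=> IA IB.
have mA := rintegrable_measurable IA; have mB := rintegrable_measurable IB.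
pose F (p : n.-tuple RT * RT) : R := A p.1 * B p.2.
have mF : measurable_fun setT F.
  apply: measurable_funM; first exact: (measurableT_comp mA).
  exact: (measurableT_comp mB).
have IF : (sf_tuple n \x leb)%E.-integrable setT (EFin \o F).
  apply/integrable12ltyP; first exact/measurable_EFinP.
  have fB : (\int[leb]_y `|(B y)%:E|)%E \is a fin_num.
    by apply/fin_numPlt; case/integrableP : IB => _ h;
      rewrite h andbT (lt_le_trans _ (integral_ge0 _ _)).
  have E x : (\int[leb]_y `|(EFin \o F) (x, y)| = `|(A x)%:E| * \int[leb]_y `|(B y)%:E|)%E.
    rewrite -ge0_integralZl//; last by apply: measurableT_comp => //; exact/measurable_EFinP.
    by apply: eq_integral => y _; rewrite -abseM -EFinM.
  under eq_integral do rewrite E.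
  rewrite -(fineK fB) ge0_integralZr//; last 2 first.
    by apply: measurableT_comp => //; exact/measurable_EFinP.
    by rewrite lee_fin fine_ge0// integral_ge0.
  rewrite lte_mul_pinfty//; first exact: integral_ge0.
    rewrite ge0_fin_numE ?integral_ge0//.
    by case/integrableP : IA.
  by rewrite ltry.
have EF : rint (sf_tuple n \x leb)%E F = rint (mu n) A * rint leb B.
  rewrite {1}/rint /Rintegral -integral12_prod_meas1//.
  transitivity (rint (mu n) (fun x => rint leb B * A x)); last by rewrite rintZ// mulrC.
  rewrite /rint /Rintegral; congr (fine (integral _ _ _)); apply/funext => x.
  rewrite /fubini_F; under eq_integral do rewrite /F /= EFinM.
  by rewrite integralZl// EFinM fineK ?integrable_fin_num// muleC.
have mS : measurable_fun setT (fun t : n.+1.-tuple RT => A [tuple of behead t] * B (thead t)).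
  apply: measurable_funM.
  - apply: (measurableT_comp mA); exact: measurable_behead.
  - apply: (measurableT_comp mB); exact: measurable_thead.
have FE : (fun t : n.+1.-tuple RT => A [tuple of behead t] * B (thead t)) \o @tuple_cons R n =
  F.
  by apply/funext => p; rewrite /= tuple_cons_behead tuple_cons_thead.
have mc := @measurable_tuple_cons R n.
split.
  apply: (@integrable_pushforward _ _ _ _ _ _ mc) => //; first exact/measurable_EFinP.
  by rewrite preimage_setT; rewrite -FE in IF; exact: IF.
rewrite -EF -FE /rint /Rintegral.
rewrite (@integral_pushforward _ _ _ _ _ _ mc)//; first exact/measurable_EFinP.
by rewrite preimage_setT; rewrite -FE in IF; exact: IF.
Qed.

End tuple_integration.

Section tuple_products.
Variable R : realType.
Local Notation RT := (measurableTypeR R).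
Local Notation leb := (@lebesgue_measure R).
Local Notation mu := (@lebesgue_tuple R).

Lemma rint_tuple0 (f : 0.-tuple RT -> R) : measurable_fun setT f ->
  rintegrable (mu 0) f /\ rint (mu 0) f = f [tuple].
Proof.
move=> mf; split.
  apply/integrableP; split; first exact/measurable_EFinP.
  rewrite /= integral_dirac//; first by rewrite diracT mul1e ltry.
  by apply/measurable_EFinP; apply: measurableT_comp.
rewrite /rint /Rintegral /= integral_dirac//; last exact/measurable_EFinP.
by rewrite diracT mul1e.
Qed.

Lemma measurable_phase n (a : 'I_n -> R) :
  measurable_fun setT (fun t : n.-tuple RT => \sum_i a i * tnth t i).
Proof.
apply: measurable_sum => i; apply: measurable_funM => //.
exact: measurable_tnth.
Qed.

Lemma rintegrable_phase n (A : n.-tuple RT -> R) (a : 'I_n -> R) : rintegrable (mu n) A ->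
  rintegrable (mu n) (fun t => A t * cos (\sum_i a i * tnth t i)) /\
  rintegrable (mu n) (fun t => A t * sin (\sum_i a i * tnth t i)).
Proof.
move=> IA; split; apply: (rintegrableM (C := 1) IA).
- apply: (measurableT_comp (continuous_measurable (@continuous_cos R))).
  exact: measurable_phase.
- by move=> t; exact: norm_cos_le1.
- apply: (measurableT_comp (continuous_measurable (@continuous_sin R))).
  exact: measurable_phase.
- by move=> t; exact: norm_sin_le1.
Qed.

Lemma tnth_behead' n (t : n.+1.-tuple RT) i : tnth [tuple of behead t] i = tnth t (lift ord0 i).
Proof. by rewrite (tuple_eta t) tnthS; congr tnth; apply: val_inj. Qed.

Lemma prod_tupleS n (h : 'I_n.+1 -> R -> R) (t : n.+1.-tuple RT) :
  \prod_i h i (tnth t i) =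
  (\prod_(i < n) h (lift ord0 i) (tnth [tuple of behead t] i)) * h ord0 (thead t).
Proof.
rewrite big_ord_recl mulrC; congr (_ * _).
by apply: eq_bigr => i _; rewrite tnth_behead'.
Qed.

Lemma tuple_prod n (h : 'I_n -> R -> R) : (forall i, rintegrable leb (h i)) ->
  rintegrable (mu n) (fun t => \prod_i h i (tnth t i)) /\
  rint (mu n) (fun t => \prod_i h i (tnth t i)) = \prod_i rint leb (h i).
Proof.
elim: n h => [|n IH] h Ih.
  have := @rint_tuple0 (fun t => \prod_i h i (tnth t i)); rewrite !big_ord0; apply.
  by under eq_fun do rewrite big_ord0; exact: measurable_cst.
under eq_fun do rewrite prod_tupleS.
have [IA EA] := IH (fun i => h (lift ord0 i)) (fun i => Ih _).
have [I E] := rintegrable_tupleS IA (Ih ord0); split; first exact: I.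
by rewrite E EA big_ord_recl mulrC.
Qed.

(** Pairing the cosine and sine integrals into one complex number turns the addition formulas into
    complex multiplication, and the induction peels off one factor at a time. *)
Lemma tuple_fourier n (h : 'I_n -> R -> R) (a : 'I_n -> R) : (forall i, rintegrable leb (h i))
  ->
  (rint (mu n) (fun t => (\prod_i h i (tnth t i)) * cos (\sum_i a i * tnth t i))
  +i* rint (mu n) (fun t => (\prod_i h i (tnth t i)) * sin (\sum_i a i * tnth t i)))%C =
  \prod_i (cosint (a i) (h i) +i* sinint (a i) (h i))%C.
Proof.
elim: n h a => [|n IH] h a Ih.
  have Z : (fun t : 0.-tuple RT => \sum_i a i * tnth t i) = (fun=> 0).
    by apply/funext => t; rewrite big_ord0.
  rewrite !(@rint_tuple0 _ _).2; last 2 first.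
  - by under eq_fun do rewrite !big_ord0; exact: measurable_cst.
  - by under eq_fun do rewrite !big_ord0; exact: measurable_cst.
  by rewrite !big_ord0 cos0 sin0 mulr0 mulr1.
pose A := fun t : n.-tuple RT => \prod_(i < n) h (lift ord0 i) (tnth t i).
pose b i := a (lift ord0 i).
have [IA _] := @tuple_prod n (fun i => h (lift ord0 i)) (fun i => Ih _).
have [IAc IAs] := @rintegrable_phase n A b IA.
have [IBc IBs] := trig_rintegrable (a ord0) (Ih ord0).
have [Icc Ecc] := rintegrable_tupleS IAc IBc.
have [Iss Ess] := rintegrable_tupleS IAs IBs.
have [Ics Ecs] := rintegrable_tupleS IAc IBs.
have [Isc Esc] := rintegrable_tupleS IAs IBc.
have ph (t : n.+1.-tuple RT) : \sum_i a i * tnth t i =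
    a ord0 * thead t + \sum_i b i * tnth [tuple of behead t] i.
  rewrite big_ord_recl; congr (_ + _).
  by apply: eq_bigr => i _; rewrite tnth_behead'.
under eq_fun do rewrite prod_tupleS ph cosD.
under [X in (_ +i* rint _ X)%C]eq_fun do rewrite prod_tupleS ph sinD.
rewrite big_ord_recl -(IH (fun i => h (lift ord0 i)) b (fun i => Ih _)).
rewrite (_ : (fun _ => _) = (fun t : n.+1.-tuple RT =>
  1 * (A [tuple of behead t] * cos (\sum_i b i * tnth [tuple of behead t] i) * (h ord0 (thead
    t) * cos (a ord0 * thead t)))
  + -1 * (A [tuple of behead t] * sin (\sum_i b i * tnth [tuple of behead t] i) * (h ord0
    (thead t) * sin (a ord0 * thead t))))); last first.
  by apply/funext => t; rewrite /A; ring.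
rewrite [X in (_ +i* rint _ X)%C](_ : _ = (fun t : n.+1.-tuple RT =>
  1 * (A [tuple of behead t] * cos (\sum_i b i * tnth [tuple of behead t] i) * (h ord0 (thead
    t) * sin (a ord0 * thead t)))
  + 1 * (A [tuple of behead t] * sin (\sum_i b i * tnth [tuple of behead t] i) * (h ord0
    (thead t) * cos (a ord0 * thead t))))); last first.
  by apply/funext => t; rewrite /A; ring.
rewrite (rint_comb 1 (-1) Icc Iss) (rint_comb 1 1 Ics Isc) Ecc Ess Ecs Esc /=.
rewrite -/(cosint _ _) -/(sinint _ _).
by simpc; congr (_ +i* _)%C; rewrite /A; ring.
Qed.

End tuple_products.

Section cos_power_limit.
Variable R : realType.

Lemma norm_exprB (a b : R) m : `|a| <= 1 -> `|b| <= 1 -> `|a ^+ m - b ^+ m| <= m%:R * `|a - b|.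
Proof.
move=> a1 b1; elim: m => [|m IH]; first by rewrite !expr0 subrr normr0 mul0r.
have -> : a ^+ m.+1 - b ^+ m.+1 = a * (a ^+ m - b ^+ m) + (a - b) * b ^+ m.
  by rewrite !exprS; ring.
apply: le_trans (ler_normD _ _) _; rewrite !normrM -natr1 mulrDl mul1r; apply: lerD.
  by apply: le_trans IH; rewrite ler_piMl.
by rewrite ler_piMr// normrX exprn_ile1.
Qed.

Lemma expRN_taylor (u : R) : 0 <= u -> u < 1 -> `|1 - u - expR (- u)| <= expR 1 * u ^+ 2.
Proof.
move=> u0 u1.
have D (t : R) : is_derive t 1 (fun t => expR (- t)) (- expR (- t)).
  have := @is_derive_affine R expR (-1) 0 t _ (is_derive_expR _).
  under eq_fun do rewrite addr0 mulN1r.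
  by rewrite addr0 !mulN1r.
have D2 (t : R) : is_derive t 1 (fun t => - expR (- t)) (expR (- t)).
  by rewrite -[X in is_derive _ _ _ X]opprK; apply: is_deriveN.
have := @taylor1_norm R (fun t => expR (- t)) (fun t => - expR (- t)) (fun t => expR (- t)) 0
  1 (expR 1).
move=> /(_ _ u); rewrite !addr0 oppr0 expR0 ger0_norm// => H.
rewrite -normrN; have -> : - (1 - u - expR (- u)) = expR (- u) - 1 - u * -1 by ring.
apply: H => // t; rewrite addr0 => t1; split => //.
rewrite ger0_norm ?expR_ge0// ler_expR; apply: le_trans (ler_norm _) _.
by rewrite normrN ltW.
Qed.

Lemma cvg_sqrtV (x : R) : (fun m => x / Num.sqrt m.+1%:R) @ \oo --> (0 : R).
Proof.
rewrite -[X in _ --> X](mulr0 x); apply: cvgMl_tmp.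
have -> : (fun m => (Num.sqrt (m.+1%:R : R))^-1) = (fun m => Num.sqrt (m.+1%:R^-1)).
  by apply/funext => m; rewrite sqrtrV.
rewrite -[X in _ --> X](sqrtr0 R); apply: continuous_cvg; first exact: sqrt_continuous.
exact: cvg_harmonic.
Qed.

(** The central limit theorem for fair signs, in terms of characteristic functions. With x/sqrt(m+1)
    = 2v, the base cos(2v) = 1 - 2 sin^2 v differs from exp(-2v^2) by O(|v|^3). The power multiplies
    this error by at most m+1, and (m+1) v^2 does not depend on m. *)
Lemma cos_power_cvg (x : R) :
  (fun m => cos (x / Num.sqrt m.+1%:R) ^+ m.+1) @ \oo --> expR (- (x ^+ 2 / 2)).
Proof.
pose v m : R := x / 2 / Num.sqrt m.+1%:R.
have v0 : v @ \oo --> (0 : R) by exact: cvg_sqrtV.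
have s0 m : 0 < Num.sqrt m.+1%:R :> R by rewrite sqrtr_gt0 ltr0n.
have Mv m : m.+1%:R * v m ^+ 2 = x ^+ 2 / 4.
  rewrite /v expr_div_n sqr_sqrtr// mulrCA mulfV ?pnatr_eq0// mulr1 expr_div_n.
  by congr (_ / _); rewrite -natrX.
pose b m := x ^+ 2 / 4 * (expR 1 * 4 * v m ^+ 2 + 4 * `|v m|).
have b0 : b @ \oo --> (0 : R).
  rewrite -[X in _ --> X](mulr0 (x ^+ 2 / 4)); apply: cvgMl_tmp.
  rewrite -[X in _ --> X](_ : expR 1 * 4 * 0 ^+ 2 + 4 * `|0 : R| = 0); last first.
    by rewrite expr0n normr0 !mulr0 addr0.
  apply: cvgD; apply: cvgMl_tmp; last exact: cvg_norm.
  exact: (cvg_comp _ _ v0 (@exprn_continuous _ 2 0)).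
have H : \forall m \near \oo,
    `|cos (x / Num.sqrt m.+1%:R) ^+ m.+1 - expR (- (x ^+ 2 / 2))| <= b m.
  near=> m.
  have v1 : `|v m| < 2^-1.
    near: m; have /cvgrPdist_lt /(_ 2^-1) := v0.
    rewrite invr_gt0 ltr0n => /(_ isT); apply: filterS => m.
    by rewrite sub0r normrN.
  have -> : x / Num.sqrt m.+1%:R = v m *+ 2.
    by rewrite /v -[RHS]mulr_natr; field; rewrite gt_eqF.
  have -> : expR (- (x ^+ 2 / 2)) = expR (- (2 * v m ^+ 2)) ^+ m.+1.
    rewrite -expRM_natl mulrN; congr (expR (- _)).
    by rewrite mulrCA Mv; field.
  apply: le_trans (norm_exprB _ (norm_cos_le1 _) _) _.
    by rewrite ger0_norm ?expR_ge0// -[leRHS]expR0 ler_expR oppr_le0 mulr_ge0// sqr_ge0.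
  rewrite /b -(Mv m) -mulrA ler_wpM2l//.
  have vv : v m ^+ 2 = `|v m| ^+ 2 by rewrite real_normK ?num_real.
  have n0 : 0 <= `|v m| by [].
  move: (v m) v1 vv n0 => w v1 vv n0.
  have sw : `|sin w| <= `|w|.
    have := @MVT_norm R sin cos 0 w 1; rewrite sin0 !subr0 mul1r; apply => t _; split;
      [exact: is_derive_sin|exact: norm_cos_le1].
  have sw2 : `|sin w - w| <= w ^+ 2.
    have := @taylor1_norm R sin cos (fun t => - sin t) 0 1 1.
    move=> /(_ _ w); rewrite addr0 sin0 subr0 cos0 mulr1 mul1r; apply; last by lra.
    by move=> t _; split; [exact: is_derive_sin|exact: is_derive_cos|rewrite normrN
      norm_sin_le1].
  have d1 : `|cos (w *+ 2) - (1 - 2 * w ^+ 2)| <= 4 * `|w| * w ^+ 2.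
    have -> : cos (w *+ 2) - (1 - 2 * w ^+ 2) = 2 * (w - sin w) * (w + sin w).
      by rewrite cos_mulr2n cos2sin2 -mulr_natl; ring.
    rewrite !normrM ger0_norm// distrC.
    have : `|w + sin w| <= 2 * `|w| by apply: le_trans (ler_normD _ _) _; lra.
    have h3 := ler_pM (normr_ge0 _) (normr_ge0 _) sw2 _.
    move=> /h3; lra.
  have u1 : 2 * w ^+ 2 < 1 by rewrite vv; nra.
  have d2 := expRN_taylor (mulr_ge0 (ler0n R 2) (sqr_ge0 w)) u1.
  apply: (@le_trans _ _ (4 * `|w| * w ^+ 2 + expR 1 * (2 * w ^+ 2) ^+ 2)).
    rewrite -[X in `|X|](subrKA (1 - 2 * w ^+ 2)).
    by apply: le_trans (ler_normD _ _) _; apply: lerD.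
  by rewrite le_eqVlt; apply/orP; left; apply/eqP; ring.
apply: (@squeeze_cvgr _ _ _ _ (fun m => expR (- (x ^+ 2 / 2)) - b m)
  (fun m => expR (- (x ^+ 2 / 2)) + b m)).
- by apply: filterS H => m; rewrite ler_distl.
- rewrite -[X in _ --> X]subr0; apply: cvgB => //; exact: cvg_cst.
- rewrite -[X in _ --> X]addr0; apply: cvgD => //; exact: cvg_cst.
Unshelve. all: by end_near. Qed.

End cos_power_limit.

(** * Uniqueness of the Fourier transform *)

Section fourier_uniqueness.
Variable R : realType.
Variable n : nat.
Local Notation RT := (measurableTypeR R).
Local Notation leb := (@lebesgue_measure R).
Local Notation mu := (@lebesgue_tuple R n).
Local Notation T := (n.-tuple RT).

Definition phase (a : 'I_n -> R) (t : T) : R := \sum_i a i * tnth t i.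

Definition no_frequency (f : T -> R) := forall a : 'I_n -> R,
  rint mu (fun t => f t * cos (phase a t)) = 0 /\ rint mu (fun t => f t * sin (phase a t)) = 0.

Lemma phaseD a b t : phase (fun i => a i + b i) t = phase a t + phase b t.
Proof. by rewrite /phase -big_split; apply: eq_bigr => i _; rewrite /= mulrDl. Qed.

Lemma phaseB a b t : phase (fun i => a i - b i) t = phase a t - phase b t.
Proof. by rewrite /phase -sumrB; apply: eq_bigr => i _; rewrite mulrBl. Qed.

(* product-to-sum formulas: multiplying by a character only shifts frequencies *)
Lemma no_frequency_cosM f a c : rintegrable mu f -> no_frequency f ->
  rintegrable mu (fun t => f t * cos (phase a t + c)) /\
  no_frequency (fun t => f t * cos (phase a t + c)).
Proof.
move=> If nf; split.
  have [h1 h2] := rintegrable_phase a If.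
  have := rintegrableD (rintegrableZ (cos c) h1) (rintegrableZ (- sin c) h2).
  congr rintegrable; apply/funext => t; rewrite cosD /phase; ring.
move=> b; pose p i := b i + a i; pose m i := b i - a i.
have [p1 p2] := rintegrable_phase p If; have [m1 m2] := rintegrable_phase m If.
have [np1 np2] := nf p; have [nm1 nm2] := nf m.
have E1 t : cos (phase b t) * cos (phase a t + c) =
   2^-1 * (cos c * (cos (phase p t) + cos (phase m t)) - sin c * (sin (phase p t) - sin (phase
     m t))).
  by rewrite /p /m phaseD phaseB !cosD !sinD sinN cosN; field.
have E2 t : sin (phase b t) * cos (phase a t + c) =
   2^-1 * (cos c * (sin (phase p t) + sin (phase m t)) - sin c * (cos (phase m t) - cos (phase
     p t))).
  by rewrite /p /m phaseD phaseB !cosD !sinD sinN cosN; field.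
have Z4 (c1 c2 c3 c4 : R) (g1 g2 g3 g4 : T -> R) :
    rintegrable mu g1 -> rintegrable mu g2 -> rintegrable mu g3 -> rintegrable mu g4 ->
    rint mu g1 = 0 -> rint mu g2 = 0 -> rint mu g3 = 0 -> rint mu g4 = 0 ->
    rint mu (fun t => 1 * (c1 * g1 t + c2 * g2 t) + 1 * (c3 * g3 t + c4 * g4 t)) = 0.
  move=> I1 I2 I3 I4 z1 z2 z3 z4.
  rewrite rint_comb; try (apply: rintegrableD; exact: rintegrableZ).
  by rewrite (rint_comb c1 c2 I1 I2) (rint_comb c3 c4 I3 I4) z1 z2 z3 z4; ring.
split.
- rewrite -(Z4 (2^-1 * cos c) (2^-1 * cos c) (- 2^-1 * sin c) (2^-1 * sin c) _ _ _ _ p1 m1 p2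
  m2)//.
  congr rint; apply/funext => t.
  rewrite -mulrA [cos (phase a t + c) * _]mulrC E1 /phase; ring.
- rewrite -(Z4 (2^-1 * cos c) (2^-1 * cos c) (2^-1 * sin c) (- 2^-1 * sin c) _ _ _ _ p2 m2 p1
  m1)//.
  congr rint; apply/funext => t.
  rewrite -mulrA [cos (phase a t + c) * _]mulrC E2 /phase; ring.
Qed.

Lemma no_frequency_cosX f a c m : rintegrable mu f -> no_frequency f ->
  rintegrable mu (fun t => f t * cos (phase a t + c) ^+ m) /\
  no_frequency (fun t => f t * cos (phase a t + c) ^+ m).
Proof.
move=> If nf; elim: m => [|m [IH1 IH2]].
  by under eq_fun do rewrite expr0 mulr1.
under eq_fun do rewrite exprSr mulrA.
exact: no_frequency_cosM.
Qed.

Lemma phase_coord (b : R) (i : 'I_n) t : phase (fun j => if j == i then b else 0) t = b * tnth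
  t i.
Proof.
rewrite /phase (bigD1 i)//= eqxx big1 ?addr0// => j /negPf ->.
by rewrite mul0r.
Qed.

Lemma no_frequency_prod f b (y : 'I_n -> R) m : rintegrable mu f -> no_frequency f ->
  rint mu (fun t => f t * \prod_(i < n) cos (b * (tnth t i - y i)) ^+ m) = 0.
Proof.
move=> If nf.
suff H (s : seq 'I_n) : rintegrable mu (fun t => f t * \prod_(i <- s) cos (b * (tnth t i - y
  i)) ^+ m) /\
    no_frequency (fun t => f t * \prod_(i <- s) cos (b * (tnth t i - y i)) ^+ m).
  have [_ /(_ (fun=> 0)) [+ _]] := H (index_enum 'I_n).
  under eq_fun => t.
    have -> : phase (fun=> 0) t = 0 by rewrite /phase big1// => i _; rewrite mul0r.
    rewrite cos0 mulr1; over.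
  by [].
elim: s => [|i s [IH1 IH2]].
  by under eq_fun do rewrite big_nil mulr1.
have := @no_frequency_cosX _ (fun j => if j == i then b else 0) (- (b * y i)) m IH1 IH2.
have -> // : (fun t => f t * \prod_(j <- s) cos (b * (tnth t j - y j)) ^+ m *
    cos (phase (fun j => if j == i then b else 0) t - b * y i) ^+ m) =
  (fun t => f t * \prod_(j <- i :: s) cos (b * (tnth t j - y j)) ^+ m).
apply/funext => t; rewrite big_cons phase_coord -mulrBr.
by rewrite -mulrA; congr (_ * _); rewrite mulrC.
Qed.

(** b = sqrt(2N) makes the limit exp(-(bu)^2/2) of the cosine powers equal to exp(-N u^2); [|f|] is
    a majorant because cosines are bounded by 1. *)
Lemma no_frequency_gauss f N (y : 'I_n -> R) : 0 <= N -> rintegrable mu f -> no_frequency f ->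
  rint mu (fun t => f t * expR (- (N * \sum_(i < n) (tnth t i - y i) ^+ 2))) = 0.
Proof.
move=> N0 If nf; pose b := Num.sqrt (2 * N).
pose g m t := f t * \prod_(i < n) cos (b / Num.sqrt m.+1%:R * (tnth t i - y i)) ^+ m.+1.
have mf := rintegrable_measurable If.
have mg m : measurable_fun setT (g m).
  apply: measurable_funM => //; apply: measurable_prod => i _; apply: measurable_funX.
  apply: (measurableT_comp (continuous_measurable (@continuous_cos R))).
  apply: measurable_funM => //; apply: measurable_funB => //; exact: measurable_tnth.
have gc t : g ^~ t @ \oo --> f t * expR (- (N * \sum_(i < n) (tnth t i - y i) ^+ 2)).
  apply: cvgMl_tmp.
  have -> : expR (- (N * \sum_(i < n) (tnth t i - y i) ^+ 2)) =
      \prod_(i < n) expR (- ((b * (tnth t i - y i)) ^+ 2 / 2)).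
    rewrite -expR_sum sumrN; congr (expR (- _)); rewrite mulr_sumr; apply: eq_bigr => i _.
    by rewrite exprMn sqr_sqrtr ?mulr_ge0//; field.
  apply: (@cvg_big R 'I_n *%R 1 xpredT _ nat \oo (index_enum 'I_n)
    (fun i m => cos (b / Num.sqrt m.+1%:R * (tnth t i - y i)) ^+ m.+1)
    (fun i => expR (- ((b * (tnth t i - y i)) ^+ 2 / 2)))).
    exact: mul_continuous.
  move=> i _; have := @cos_power_cvg R (b * (tnth t i - y i)).
  by under eq_fun do rewrite mulrAC.
have gb m t : `|g m t| <= `|f t|.
  rewrite normrM ler_piMr// normr_prod; apply: prodr_ile1 => i _.
  by rewrite normr_ge0 /= normrX exprn_ile1// norm_cos_le1.
have [_ L] := rdominated mg gc gb (integrable_norm If).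
have Z m : rint mu (g m) = 0 by exact: no_frequency_prod.
have L0 : (fun m => rint mu (g m)) @ \oo --> (0 : R).
  by under eq_fun do rewrite Z; exact: cvg_cst.
by apply: (cvg_unique _ L L0).
Qed.

(* Multiplying by products of cosines preserves the absence of frequencies, and
   cos(b/sqrt n)^n converges to a Gaussian: so h integrates to 0 against every
   Gaussian. *)
Lemma no_frequency_eq0 (h : 'rV[R]_n -> R) : continuous h ->
  rintegrable mu (fun t => h (row_of t)) -> no_frequency (fun t => h (row_of t)) ->
  forall y, h y <= 0.
Proof.
move=> ch Ih nh y; rewrite leNgt; apply/negP => hy.
pose a := h y / 2; have a0 : 0 < a by rewrite divr_gt0.
have [dl dl0 near_y] : exists2 dl : R, 0 < dl &
    forall x : 'rV[R]_n, (forall i, `|x ord0 i - y ord0 i| < dl) -> a <= h x.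
  have : \forall x \near y, a <= h x.
    have := ch y; move/cvgrPdist_lt => /(_ a a0); apply: filterS => x.
    by rewrite ltr_norml => /andP[_]; rewrite /a; lra.
  move=> /nbhs_ballP[dl /= dl0 H]; exists dl => // x Hx.
  apply: H; split => // i j; rewrite /ball /= !ord1 distrC; exact: Hx.
(* The Gaussian exp(-N|x - y|^2) is at least exp(-N dl^2/2) on the cube of half-width d1, and at
   most exp(-N dl^2) outside the cube of half-width dl, the only place where h may be negative. *)
pose d1 := dl / (2 * n.+1%:R).
have d10 : 0 < d1 by rewrite divr_gt0// mulr_gt0// ltr0n.
have d1dl : d1 < dl.
  rewrite ltr_pdivrMr ?mulr_gt0 ?ltr0n// ltr_pMr// -natrM ltr1n.
  by rewrite mulnS.
have nd1 : n%:R * d1 ^+ 2 <= dl ^+ 2 / 2.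
  have n0 : 0 < 2 * n.+1%:R :> R by rewrite mulr_gt0// ltr0n.
  rewrite /d1 expr_div_n mulrCA ler_wpM2l ?sqr_ge0// ler_pdivrMr ?exprn_gt0//.
  rewrite -[n.+1%:R]natr1; have : 0 <= n%:R :> R by []. nra.
pose q (t : T) := \sum_(i < n) (tnth t i - y ord0 i) ^+ 2.
pose box (t : T) : R := \prod_(i < n) (\1_(`[y ord0 i - d1, y ord0 i + d1]%classic) (tnth t i)).
pose V := rint mu box.
have Ii i : rintegrable leb (\1_(`[y ord0 i - d1, y ord0 i + d1]%classic) : R -> R).
  exact: integrable_indic_itv.
have [Ib EV] := tuple_prod Ii.
have V0 : 0 < V.
  rewrite /V /box EV; apply: prodr_gt0 => i _.
  rewrite /rint /Rintegral integral_indic//= setIT lebesgue_measure_itv /= lte_fin.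
  have lt : y ord0 i - d1 < y ord0 i + d1 by rewrite ltrD2l gtrN.
  by rewrite lt -EFinD /= subr_gt0.
pose H := rint mu (fun t => `|h (row_of t)|).
have INh := integrable_norm Ih.
have qE t i : (tnth t i - y ord0 i) ^+ 2 <= q t.
  by rewrite /q (bigD1 i)//= lerDl sumr_ge0// => j _; rewrite sqr_ge0.
have mq : measurable_fun setT q.
  apply: measurable_sum => i; apply: measurable_funX; apply: measurable_funB => //.
  exact: measurable_tnth.
have q0 t : 0 <= q t by apply: sumr_ge0 => i _; rewrite sqr_ge0.
have key N : 0 <= N -> a * expR (- (N * (dl ^+ 2 / 2))) * V <= expR (- (N * dl ^+ 2)) * H.
  move=> N0; have G := no_frequency_gauss (fun i => y ord0 i) N0 Ih nh.
  rewrite -subr_le0 -G.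
  have -> : a * expR (- (N * (dl ^+ 2 / 2))) * V - expR (- (N * dl ^+ 2)) * H =
    rint mu (fun t => a * expR (- (N * (dl ^+ 2 / 2))) * box t +
       (- expR (- (N * dl ^+ 2))) * `|h (row_of t)|).
    by rewrite (rint_comb _ _ Ib INh) mulNr.
  apply: le_rint.
  - by apply: rintegrableD; apply: rintegrableZ.
  - apply: (rintegrableM (C := 1) Ih).
      apply: (measurableT_comp (continuous_measurable (@continuous_expR R))).
      by apply: measurableT_comp => //; exact: measurable_funM.
    move=> t; rewrite ger0_norm ?expR_ge0// -[leRHS]expR0 ler_expR oppr_le0 mulr_ge0//.
    exact: q0.
  move=> t; rewrite -/(q t).
  have [inbox|/existsNP[i /negP]] := pselect (forall i, `|tnth t i - y ord0 i| < dl).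
    have ah : a <= h (row_of t) by apply: near_y => i; rewrite mxE.
    have h0 : 0 <= h (row_of t) by apply: le_trans ah; exact: ltW.
    rewrite -lerBrDr mulNr opprK; apply: (@le_trans _ _ (h (row_of t) * expR (- (N * q t))));
      last first.
      by rewrite lerDl mulr_ge0// expR_ge0.
    have [inb|/existsNP[i /negP ni]] := pselect (forall i, `|tnth t i - y ord0 i| <= d1).
      rewrite /box big1 ?mulr1; last first.
        move=> i _; rewrite indicE mem_set//= in_itv /=.
        by have := inb i; rewrite ler_distl.
      apply: ler_pM => //; first exact: ltW.
      rewrite ler_expR lerN2 ler_wpM2l//; apply: le_trans nd1.
      rewrite -[n in leRHS]card_ord -sum1_card natr_sum mulr_suml.
      apply: ler_sum => i _; rewrite mul1r -[leLHS]real_normK ?num_real//.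
      by rewrite lerXn2r ?nnegrE// ltW.
    rewrite /box (bigD1 i)//= indicE memNset; last first.
      by rewrite /= in_itv /= -ler_distl; exact/negP.
    by rewrite mul0r mulr0 mulr_ge0// expR_ge0.
  rewrite -leNgt => ni.
  rewrite /box (bigD1 i)//= indicE memNset; last first.
    by rewrite /= in_itv /= -ler_distl => /(le_trans ni); rewrite leNgt d1dl.
  rewrite mul0r mulr0 add0r mulNr lerNl.
  apply: (@le_trans _ _ (`|h (row_of t)| * expR (- (N * q t)))).
    by rewrite -mulNr ler_wpM2r ?expR_ge0// -normrN ler_norm.
  rewrite mulrC ler_wpM2r// ler_expR lerN2 ler_wpM2l//; apply: le_trans (qE t i).
  by rewrite -[leRHS]real_normK ?num_real// lerXn2r ?nnegrE// ltW.
have H0 : 0 <= H by apply: Rintegral_ge0.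
(* With u = N dl^2/2, [key] says a V e^u <= H. This N makes u larger than H/(aV), which contradicts
   e^u > u. *)
pose N := (H / (a * V) + 1) / (dl ^+ 2 / 2).
have dd : 0 < dl ^+ 2 / 2 by rewrite divr_gt0// exprn_gt0.
have aV : 0 < a * V by exact: mulr_gt0.
have w0 : 0 <= H / (a * V) by apply: divr_ge0 => //; exact: ltW.
have N0 : 0 <= N by apply: divr_ge0; [exact: addr_ge0|exact: ltW].
have := key N N0.
have -> : N * (dl ^+ 2 / 2) = H / (a * V) + 1 by rewrite divfK// gt_eqF.
have -> : N * dl ^+ 2 = (H / (a * V) + 1) *+ 2.
  by rewrite -[RHS]mulr_natr /N; field; rewrite !gt_eqF.
set u := _ + 1; have u0 : H / (a * V) < u by rewrite ltrDl.
have e0 := expR_gt0 (- u).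
rewrite -mulNrn mulr2n expRD -mulrA [expR (- u) * V]mulrC mulrA -[X in _ <= X]mulrA [expR (-
  u) * H]mulrC mulrA.
rewrite [expR (- u) * H]mulrC ler_pM2r// leNgt => /negP; apply.
have : u < expR u by apply: lt_le_trans (expR_ge1Dx u); rewrite ltrDr.
move/(lt_trans u0); rewrite ltr_pdivrMr// => h1.
by rewrite expRN ltr_pdivrMr ?expR_gt0// mulrC.
Qed.

Lemma fourier_uniqueness (h : 'rV[R]_n -> R) : continuous h ->
  rintegrable mu (fun t => h (row_of t)) -> no_frequency (fun t => h (row_of t)) ->
  forall y, h y = 0.
Proof.
move=> ch Ih nh y; apply/eqP; rewrite eq_le (no_frequency_eq0 ch Ih nh)/= -oppr_le0.
apply: (@no_frequency_eq0 (fun x => - h x)).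
- by move=> x; exact: (cvgN (ch x)).
- by have := rintegrableZ (-1) Ih; under eq_fun do rewrite mulN1r.
- move=> a; have [I1 I2] := rintegrable_phase a Ih; have [n1 n2] := nh a.
  have := rintZ (-1) I1; have := rintZ (-1) I2; rewrite n1 n2 mulr0 => z2 z1; split.
    by rewrite -[RHS]z1; congr rint; apply/funext => t; rewrite mulN1r mulNr.
  by rewrite -[RHS]z2; congr rint; apply/funext => t; rewrite mulN1r mulNr.
Qed.

End fourier_uniqueness.

(** * The template and its fractional Laplacian *)

Section djets.
Variables (R : realType) (d : nat).
Implicit Types F : seq 'I_d -> 'rV[R]_d -> R.

(* [F J] is the partial derivative of [F [::]] along the directions in [J]. *)
Definition djet F := forall J i (x : 'rV[R]_d), is_derive x (basis_vec R i) (F J) (F (i :: J)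
  x).

Definition djet_affine (r : R) (p : 'rV[R]_d) F : seq 'I_d -> 'rV[R]_d -> R :=
  fun J x => r ^+ size J * F J (r *: (x - p)).

Lemma is_derive_line_at F J i (x : 'rV[R]_d) (h : R) : djet F ->
  is_derive h 1 (fun k => F J (k *: basis_vec R i + x)) (F (i :: J) (h *: basis_vec R i + x)).
Proof.
move=> jF; have /is_derive_line H := jF J i (h *: basis_vec R i + x).
have := @is_derive_affine R (fun k => F J (k *: basis_vec R i + (h *: basis_vec R i + x))) 1
  (- h) h.
rewrite mul1r subrr => /(_ _ H); rewrite mul1r.
under eq_fun do rewrite mul1r addrA -scalerDl subrK.
exact.
Qed.

Lemma djet_affineP r p F : djet F -> djet (djet_affine r p F).
Proof.
move=> jF J i x; apply/is_derive_line; rewrite /djet_affine.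
have := @is_derive_line_at F J i (r *: (x - p)) 0 jF; rewrite scale0r add0r => H.
have H1 := @is_derive_affine R (fun k => F J (k *: basis_vec R i + r *: (x - p))) r 0 0 (F (i
  :: J) (r *: (x - p))).
rewrite mulr0 addr0 in H1; have {H1}H := H1 H.
have -> : (fun h => r ^+ size J * F J (r *: (h *: basis_vec R i + x - p))) =
  (fun h => r ^+ size J * F J ((r * h + 0) *: basis_vec R i + r *: (x - p))).
  by apply/funext => h; rewrite addr0 -scalerA -scalerDr addrA.
by rewrite /= exprSr -mulrA; exact: is_deriveMr.
Qed.

Lemma djet_rsum (F : nat -> seq 'I_d -> 'rV[R]_d -> R) (M : seq 'I_d -> nat -> R) (B : seq
  'I_d -> R) :
  (forall n, djet (F n)) -> (forall n J x, `|F n J x| <= M J n) ->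
  (forall J, abs_bounded (M J) (B J)) ->
  djet (fun J x => rsum (fun n => F n J x)).
Proof.
move=> jF FM MB J i x; apply/is_derive_line.
have b K y : abs_bounded (fun n => F n K y) (B K).
  by apply: (abs_bounded_le (MB K)) => n; exact: FM.
have := @is_derive_rsum R (fun n h => F n J (h *: basis_vec R i + x))
  (fun n h => F n (i :: J) (h *: basis_vec R i + x))
  (fun n h => F n (i :: i :: J) (h *: basis_vec R i + x)) (M (i :: i :: J)) 0 1 (B (i :: i ::
    J)).
rewrite scale0r add0r; apply => //.
- by move=> n t _; split; [exact: is_derive_line_at|exact: is_derive_line_at|exact: FM].
- by move=> t _; exists (B J); exact: b.
- by exists (B (i :: J)); exact: b.
Qed.

(** The path from x to y that changes one coordinate at a time: along it, bounds on the partial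
    derivatives alone give a Lipschitz estimate. *)
Definition mix (x y : 'rV[R]_d) (k : nat) : 'rV[R]_d :=
  \row_i (if (i < k)%N then y ord0 i else x ord0 i).

Lemma djet_lipschitz F J (D : R) : djet F -> (forall i x, `|F (i :: J) x| <= D) ->
  forall x y, `|F J y - F J x| <= D * \sum_(i < d) `|y ord0 i - x ord0 i|.
Proof.
move=> jF FD x y.
have -> : F J y - F J x = \sum_(i < d) (F J (mix x y i.+1) - F J (mix x y i)).
  rewrite -(big_mkord xpredT (fun i => F J (mix x y i.+1) - F J (mix x y i))) telescope_sumr//.
  congr (F J _ - F J _); apply/rowP => i; rewrite mxE ?ltn_ord//.
rewrite mulr_sumr; apply: le_trans (ler_norm_sum _ _ _) _; apply: ler_sum => i _.
have -> : mix x y i.+1 = (y ord0 i - x ord0 i) *: basis_vec R i + mix x y i.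
  apply/rowP => j; rewrite !mxE eqxx /= ltnS.
  have [->|ji] := eqVneq j i; first by rewrite leqnn ltnn mulr1 subrK.
  by rewrite mulr0 add0r ltn_neqAle -val_eqE in ji *; rewrite ji.
have := @MVT_norm R (fun k => F J (k *: basis_vec R i + mix x y i))
  (fun k => F (i :: J) (k *: basis_vec R i + mix x y i)) 0 (y ord0 i - x ord0 i) D.
rewrite scale0r add0r subr0; apply => t _; split; last exact: FD.
exact: is_derive_line_at.
Qed.

Lemma djet_continuous F J (D : R) : djet F -> (forall i x, `|F (i :: J) x| <= D) -> continuous
  (F J).
Proof.
move=> jF FD x; apply/(@cvgrPdist_lt _ _ _ (nbhs x) (nbhs_filter x)) => e e0.
have D0 : 0 <= `|D| + 1 by rewrite addr_ge0.
have dd : 0 < e / ((`|D| + 1) * d.+1%:R).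
  by rewrite divr_gt0// mulr_gt0 ?ltr0n// ltr_wpDl.
apply/nbhs_ballP; exists (e / ((`|D| + 1) * d.+1%:R)) => //= y [_ xy].
have L := @djet_lipschitz F J (`|D|) jF (fun i z => le_trans (FD i z) (ler_norm D)) y x.
apply: le_lt_trans L _.
apply: (@le_lt_trans _ _ (`|D| * \sum_(i < d) (e / ((`|D| + 1) * d.+1%:R)))).
  rewrite ler_wpM2l//; apply: ler_sum => i _; have := xy ord0 i.
  by rewrite /ball /= => /ltW.
rewrite sumr_const card_ord -[_ *+ d]mulr_natl.
have -> : `|D| * (d%:R * (e / ((`|D| + 1) * d.+1%:R))) =
   e * ((`|D| / (`|D| + 1)) * (d%:R / d.+1%:R)).
  by rewrite invfM; ring.
rewrite gtr_pMr//.
apply: (@le_lt_trans _ _ (1 * (d%:R / d.+1%:R))).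
  rewrite ler_wpM2r ?divr_ge0// ler_pdivrMr ?mul1r ?ltr_wpDl//.
  by rewrite lerDl.
by rewrite mul1r ltr_pdivrMr ?ltr0n// mul1r ltr_nat.
Qed.

End djets.

Section tensor.
Variables (R : realType) (d : nat).
Hypothesis d0 : (0 < d)%N.
Variable th : nat -> nat -> R -> R.
Variables (A dl : R).
Hypothesis jth : forall k, jet (th k).
Hypothesis A1 : 1 <= A.
Hypothesis dl0 : 0 < dl.
Local Notation leb := (@lebesgue_measure R).
Local Notation mu := (@lebesgue_tuple R d).

(** The list l counts, for each coordinate, how far the factor has been moved along the sequence
    [th]; J lists the directions of differentiation, as in [djet]. *)
Definition tensor (l J : seq 'I_d) (x : 'rV[R]_d) : R :=
  \prod_(i < d) th (count_mem i l) (count_mem i J) (x ord0 i).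

(** Under [th_rel], adding i to l applies -w^(-2) D_i^2 - 1. The mean over i is therefore
    -Laplacian/(d w^2) - 1, and this function is its k-th iterate on the tensor product. *)
Fixpoint tensor_avg (k : nat) (l J : seq 'I_d) (x : 'rV[R]_d) : R :=
  if k is n.+1 then d%:R^-1 * \sum_(i < d) tensor_avg n (i :: l) J x else tensor l J x.

Lemma tensorP l : djet (tensor l).
Proof.
move=> J i x; apply/is_derive_line.
pose c := \prod_(j < d | j != i) th (count_mem j l) (count_mem j J) (x ord0 j).
have E (J' : seq 'I_d) h : (forall j, j != i -> count_mem j J' = count_mem j J) ->
    tensor l J' (h *: basis_vec R i + x) = c * th (count_mem i l) (count_mem i J') (1 * h + x
      ord0 i).
  move=> HJ; rewrite /tensor (bigD1 i)//= mulrC; congr (_ * _).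
    apply: eq_bigr => j ji; rewrite HJ// !mxE eqxx /= (negPf ji) mulr0 add0r//.
  by rewrite !mxE !eqxx mulr1 mul1r.
under eq_fun do rewrite E//.
have -> : tensor l (i :: J) x = c * th (count_mem i l) (count_mem i J).+1 (1 * 0 + x ord0 i).
  rewrite -[x in LHS]add0r -[X in X + x](scale0r (basis_vec R i)) E /= ?eqxx//.
  by move=> j ji; rewrite eq_sym (negPf ji).
apply: is_deriveMr; rewrite -[X in is_derive _ _ _ X]mul1r; apply: is_derive_affine.
exact: jth.
Qed.

Lemma prod_count_mem (c : R) (l : seq 'I_d) : \prod_(i < d) c ^+ (count_mem i l) = c ^+ size l.
Proof.
elim: l => [|j l IH] /=; first by rewrite big1.
under eq_bigr do rewrite exprD.
rewrite big_split /= IH exprS; congr (_ * _).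
rewrite (bigD1 j)//= eqxx expr1 big1 ?mulr1// => i ij.
by rewrite eq_sym (negPf ij).
Qed.

Lemma tensor_bound (K : R -> R) l J x : (forall k t, jet_bound (th k) A (K t * dl ^+ k) t) ->
  `|tensor l J x| <= \prod_(i < d) K (x ord0 i) * (dl ^+ size l * A ^+ size J).
Proof.
move=> HK; rewrite normr_prod -(prod_count_mem dl) -(prod_count_mem A) -!big_split /=.
apply: ler_prod => i _; rewrite normr_ge0 /= mulrA; exact: HK.
Qed.

Lemma avg_le (f : 'I_d -> R) M : (forall i, `|f i| <= M) -> `|d%:R^-1 * \sum_i f i| <= M.
Proof.
move=> fM; rewrite normrM normfV normr_nat mulrC ler_pdivrMr ?ltr0n//.
apply: le_trans (ler_norm_sum _ _ _) _; apply: le_trans (ler_sum _ (fun i _ => fM i)) _.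
by rewrite sumr_const card_ord mulr_natr.
Qed.

Lemma tensor_avg_bound (K : R -> R) k l J x : (forall k t, jet_bound (th k) A (K t * dl ^+ k)
  t) ->
  `|tensor_avg k l J x| <= \prod_(i < d) K (x ord0 i) * (dl ^+ (k + size l) * A ^+ size J).
Proof.
move=> HK; elim: k l => [|k IH] l /=; first exact: tensor_bound.
by apply: avg_le => i; apply: le_trans (IH _) _; rewrite /= addnS addSn.
Qed.

Lemma djet_avg (F : 'I_d -> seq 'I_d -> 'rV[R]_d -> R) (c : R) : (forall i, djet (F i)) ->
  djet (fun J x => c * \sum_(i < d) F i J x).
Proof.
move=> jF J i x.
have -> : (fun x => c * \sum_(i < d) F i J x) = c \*: \sum_(j < d) F j J.
  by apply/funext => y; rewrite /= fct_sumE.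
rewrite [X in is_derive _ _ _ X](_ : _ = c *: \sum_(j < d) F j (i :: J) x)//.
by apply: is_deriveZ; apply: is_derive_sum => j; exact: jF.
Qed.

Lemma tensor_avgP k l : djet (tensor_avg k l).
Proof.
elim: k l => [|k IH] l; first exact: tensorP.
exact: (@djet_avg (fun i => tensor_avg k (i :: l))).
Qed.

Variables (r w : R) (p : 'rV[R]_d) (a : 'I_d -> R).
Hypothesis r0 : 0 < r.
Hypothesis w0 : 0 < w.
Hypothesis th_rel : forall k t, th k 2%N t = - w ^+ 2 * (th k.+1 0%N t + th k 0%N t).
Variable C : R.
Hypothesis th_int : forall k t, jet_bound (th k) A (C * invsq t * dl ^+ k) t.

(** The factor by which one more step along [th] in coordinate i multiplies the transform at
    frequency a, for atoms of scale r. *)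
Let v i : R := (a i / (r * w)) ^+ 2 - 1.

Let g k i (t : R) : R := th k 0%N (r * (t - p ord0 i)).

(** The cost of rescaling and recentring the majorant: 1 + t^2 <= kap (1 + y^2) when t = y/r + p. *)
Let kap i : R := 1 + 2 * p ord0 i ^+ 2 + 2 * r ^- 2.

Let C0 : 0 <= C.
Proof.
have := jet_bound_ge0 (th_int 0 0); rewrite expr0 mulr1 pmulr_lge0//.
by rewrite invr_gt0 expr0n addr0.
Qed.

Let invsq_ge0 (t : R) : 0 <= invsq t. Proof. by rewrite invr_ge0 addr_ge0// sqr_ge0. Qed.

Let kap_ge0 i : 0 <= kap i.
Proof.
apply: addr_ge0; first by apply: addr_ge0 => //; apply: mulr_ge0 => //; exact: sqr_ge0.
by apply: mulr_ge0 => //; rewrite invr_ge0 sqr_ge0.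
Qed.

Let invsq_kap i t : invsq (r * (t - p ord0 i)) <= kap i * invsq t.
Proof.
have pos (u : R) : 0 < 1 + u ^+ 2 by rewrite ltr_wpDr// sqr_ge0.
rewrite /invsq -div1r ler_pdivrMr// mulrAC ler_pdivlMr// mul1r.
set y := r * _.
have -> : t = y / r + p ord0 i by rewrite /y mulrAC mulfV ?gt_eqF// mul1r subrK.
have h1 : (y / r + p ord0 i) ^+ 2 <= 2 * (y ^+ 2 * r ^- 2) + 2 * p ord0 i ^+ 2.
  rewrite -exprVn -exprMn; move: (y / r) (p ord0 i) => u1 u2.
  by have := sqr_ge0 (u1 - u2); rewrite sqrrB sqrrD; lra.
have h2 : 0 <= p ord0 i ^+ 2 * y ^+ 2 by rewrite mulr_ge0 ?sqr_ge0.
have h3 : 0 <= r ^- 2 by rewrite invr_ge0 exprn_ge0// ltW.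
have h4 := sqr_ge0 y.
rewrite /kap; move: h1; rewrite -[y ^+ 2 * r ^- 2]mulrC;
  move: (r ^- 2) h3 (y ^+ 2) h4 (p ord0 i ^+ 2) h2 => u3 h3 u4 h4 u5 h2 h1.
by lra.
Qed.

Let scaled k i := jet_affine r (- (r * p ord0 i)) (th k).

Let scaledE k i m t : scaled k i m t = r ^+ m * th k m (r * (t - p ord0 i)).
Proof. by rewrite /scaled /jet_affine mulrBr. Qed.

Let scaled_bound k i m t : (m <= 2)%N ->
  `|scaled k i m t| <= C * kap i * A ^+ 2 * (1 + r) ^+ 2 * dl ^+ k * invsq t.
Proof.
move=> m2; have r1 : 1 <= 1 + r by rewrite lerDl ltW.
rewrite scaledE normrM normrX gtr0_norm//.
have h1 : r ^+ m <= (1 + r) ^+ 2.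
  apply: (@le_trans _ _ ((1 + r) ^+ m)); last by rewrite ler_weXn2l.
  by rewrite lerXn2r ?nnegrE ?addr_ge0 ?ltW// ltrDr.
have h2 := th_int k (r * (t - p ord0 i)) m.
have h3 : A ^+ m <= A ^+ 2 by rewrite ler_weXn2l.
have h4 := invsq_kap i t.
have A0 : 0 <= A by apply: le_trans A1.
have -> : C * kap i * A ^+ 2 * (1 + r) ^+ 2 * dl ^+ k * invsq t =
  (1 + r) ^+ 2 * ((C * (kap i * invsq t) * dl ^+ k) * A ^+ 2) by ring.
apply: ler_pM => //; first by rewrite exprn_ge0// ltW.
apply: le_trans h2 _; apply: ler_pM => //.
- by rewrite !mulr_ge0// exprn_ge0// ltW.
- exact: exprn_ge0.
- by rewrite ler_wpM2r ?exprn_ge0 ?(ltW dl0)// ler_wpM2l.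
Qed.

Let scaled_cont k i m : continuous (scaled k i m).
Proof. by apply: jet_continuous; apply: jet_affineP. Qed.

Let scaled0 k i : scaled k i 0%N = g k i.
Proof. by apply/funext => t; rewrite scaledE expr0 mul1r. Qed.

Let Kc i := C * kap i * A ^+ 2 * (1 + r) ^+ 2.

Let scaled_bound' k i m t : (m <= 2)%N -> `|scaled k i m t| <= Kc i * dl ^+ k * invsq t.
Proof. exact: scaled_bound. Qed.

Let gI k i : rintegrable leb (g k i).
Proof.
have h := @invsq_dominated R (scaled k i 0%N) (Kc i * dl ^+ k)
  (@scaled_cont k i 0%N) (fun t => @scaled_bound' k i 0%N t isT).
by rewrite -scaled0.
Qed.

Let second k i : cosint (a i) (g k.+1 i) = v i * cosint (a i) (g k i) /\
                 sinint (a i) (g k.+1 i) = v i * sinint (a i) (g k i).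
Proof.
have jS : jet (scaled k i) by exact: jet_affineP.
have [] := @fourier_second_derivative R (scaled k i) (a i) (Kc i * dl ^+ k) jS.
  by move=> m t m2; exact: scaled_bound'.
have E t : scaled k i 2%N t = (- (r * w) ^+ 2) * g k.+1 i t + (- (r * w) ^+ 2) * g k i t.
  by rewrite scaledE th_rel /g; ring.
have rw : (r * w) ^+ 2 != 0 by rewrite expf_neq0// mulf_neq0// gt_eqF.
have [c1 s1] := trig_rintegrable (a i) (gI k.+1 i).
have [c2 s2] := trig_rintegrable (a i) (gI k i).
have -> : cosint (a i) (scaled k i 2%N) =
   (- (r * w) ^+ 2) * cosint (a i) (g k.+1 i) + (- (r * w) ^+ 2) * cosint (a i) (g k i).
  by rewrite -(rint_comb _ _ c1 c2); congr rint; apply/funext => t; rewrite E mulrDl !mulrA.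
have -> : sinint (a i) (scaled k i 2%N) =
   (- (r * w) ^+ 2) * sinint (a i) (g k.+1 i) + (- (r * w) ^+ 2) * sinint (a i) (g k i).
  by rewrite -(rint_comb _ _ s1 s2); congr rint; apply/funext => t; rewrite E mulrDl !mulrA.
rewrite scaled0 /v => H1 H2.
have [r_ w_] : r != 0 /\ w != 0 by rewrite !gt_eqF.
split; apply: (mulfI rw).
- rewrite (_ : _ * ((_ - 1) * _) = a i ^+ 2 * cosint (a i) (g k i) - (r * w) ^+ 2 * cosint (a
  i) (g k i)); last first.
    by field; rewrite r_ w_.
  by move: H1; lra.
- rewrite (_ : _ * ((_ - 1) * _) = a i ^+ 2 * sinint (a i) (g k i) - (r * w) ^+ 2 * sinint (a
  i) (g k i)); last first.
    by field; rewrite r_ w_.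
  by move: H2; lra.
Qed.

Let trig_small k i (tr : R -> R) : measurable_fun setT tr -> (forall t, `|tr t| <= 1) ->
  `|rint leb (fun t => g k i t * tr t)| <= (Kc i * rint leb (@invsq R)) * dl ^+ k.
Proof.
move=> mt t1.
have -> : Kc i * rint leb (@invsq R) * dl ^+ k = Kc i * dl ^+ k * rint leb (@invsq R) by ring.
rewrite -rintZ; last exact: invsq_integrable.
apply: rint_norm_le; [exact: rintegrableM (gI k i) mt t1|exact/rintegrableZ/invsq_integrable|].
move=> t; rewrite normrM -[leRHS]mulr1; apply: ler_pM => //.
by rewrite -scaled0; exact: scaled_bound'.
Qed.

(** This stands for a description of the spectral support. At a fixed frequency the transforms along
    [th] form a geometric progression of ratio v, while the bounds in space make them O(dl^k); so
    |v| <= dl unless the progression vanishes. *)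
Let geom_ratio_le (z : nat -> R) (x M : R) : z 0%N != 0 -> (forall k, z k.+1 = x * z k) ->
  (forall k, `|z k| <= M * dl ^+ k) -> `|x| <= dl.
Proof.
move=> z0 zS zM; rewrite leNgt; apply/negP => xd.
have x0 : 0 < `|x| by exact: lt_trans xd.
have zE k : `|z k| = `|x| ^+ k * `|z 0%N|.
  elim: k => [|k IH]; first by rewrite mul1r.
  by rewrite zS normrM IH exprS mulrA.
have H : (fun k => M * (dl / `|x|) ^+ k) @ \oo --> (0 : R).
  rewrite -[X in _ --> X](mulr0 M); apply: cvgMl_tmp; apply: cvg_expr.
  by rewrite ger0_norm ?divr_ge0 ?(ltW dl0)// ltr_pdivrMr// mul1r.
have : `|z 0%N| <= 0.
  apply: (cvgr_to_ge H); apply: nearW => k.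
  rewrite expr_div_n mulrA ler_pdivlMr ?exprn_gt0// mulrC -zE; exact: zM.
by rewrite normr_le0 (negPf z0).
Qed.

Let v_small i : (cosint (a i) (g 0 i) +i* sinint (a i) (g 0 i))%C != 0 -> `|v i| <= dl.
Proof.
have [c0|c0] := eqVneq (cosint (a i) (g 0 i)) 0; last first.
  move=> _; apply: (geom_ratio_le c0) => [k|k]; first exact: (second k i).1.
  exact: (trig_small k i (continuous_measurable (@cosa_continuous R (a i))) (fun t =>
    norm_cos_le1 _)).
rewrite c0 eq_complex /= eqxx /= => s0.
apply: (geom_ratio_le s0) => [k|k]; first exact: (second k i).2.
  exact: (trig_small k i (continuous_measurable (@sina_continuous R (a i))) (fun t =>
    norm_sin_le1 _)).
Qed.

Local Notation T := (d.-tuple (measurableTypeR R)).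

Let sc (t : T) : 'rV[R]_d := r *: (row_of t - p).

Let ten l (t : T) := tensor l [::] (sc t).

Let tenE l : ten l = fun t => \prod_(i < d) g (count_mem i l) i (tnth t i).
Proof. by apply/funext => t; apply: eq_bigr => i _; rewrite !mxE. Qed.

Let ten_hat l : (rint mu (fun t => ten l t * cos (phase a t)) +i*
   rint mu (fun t => ten l t * sin (phase a t)))%C =
   \prod_(i < d) (cosint (a i) (g (count_mem i l) i) +i* sinint (a i) (g (count_mem i l) i))%C.
Proof. by rewrite tenE; apply: (tuple_fourier a (h := fun i => g (count_mem i l) i)) => i;
  exact: gI. Qed.

Let ten_hatS i l :
  rint mu (fun t => ten (i :: l) t * cos (phase a t)) = v i * rint mu (fun t => ten l t * cos
    (phase a t)) /\
  rint mu (fun t => ten (i :: l) t * sin (phase a t)) = v i * rint mu (fun t => ten l t * sin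
    (phase a t)).
Proof.
have E : (rint mu (fun t => ten (i :: l) t * cos (phase a t)) +i*
    rint mu (fun t => ten (i :: l) t * sin (phase a t)))%C =
   (v i)%:C * (rint mu (fun t => ten l t * cos (phase a t)) +i*
    rint mu (fun t => ten l t * sin (phase a t)))%C.
  rewrite !ten_hat (bigD1 i)//= [in RHS](bigD1 i)//= eqxx mulrA; congr (_ * _); last first.
    by apply: eq_bigr => j ji; rewrite eq_sym (negPf ji).
  have [-> ->] := second (count_mem i l) i.
  by simpc.
by move: E; simpc => -[-> ->].
Qed.

Let mten k l : measurable_fun setT (fun t : T => tensor_avg k l [::] (sc t)).
Proof.
elim: k l => [|k IH] l /=; last first.
  by apply: measurable_funM => //; apply: measurable_sum => i; exact: IH.
have := tenE l; rewrite /ten => ->; apply: measurable_prod => i _.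
have cg : continuous (g (count_mem i l) i) by rewrite -scaled0; exact: scaled_cont.
apply: (measurableT_comp (continuous_measurable cg)); exact: measurable_tnth.
Qed.

Let H (t : T) := \prod_(i < d) (C * kap i * invsq (tnth t i)).

Let HI : rintegrable mu H.
Proof.
have := @tuple_prod R d (fun i t => C * kap i * invsq t) _.
by move=> /(_ (fun i => rintegrableZ _ (@invsq_integrable R)))[].
Qed.

Let avg_H k l t : `|tensor_avg k l [::] (sc t)| <= H t * dl ^+ (k + size l).
Proof.
have := @tensor_avg_bound (fun t => C * invsq t) k l [::] (sc t) th_int.
move/le_trans; apply; rewrite expr0 mulr1 ler_wpM2r ?exprn_ge0 ?(ltW dl0)//.
apply: ler_prod => i _; rewrite mulr_ge0//= -mulrA ler_wpM2l//.
by rewrite !mxE; exact: invsq_kap.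
Qed.

Let avgI k l : rintegrable mu (fun t => tensor_avg k l [::] (sc t)).
Proof.
apply: (le_rintegrable (mten k l) (g := fun t => dl ^+ (k + size l) * H t));
  last exact: rintegrableZ.
by move=> t; rewrite mulrC; exact: avg_H.
Qed.

Let vb : R := d%:R^-1 * \sum_(i < d) v i.

Let rint_sum (f : 'I_d -> T -> R) (s : seq 'I_d) : (forall i, rintegrable mu (f i)) ->
  rintegrable mu (fun t => \sum_(i <- s) f i t) /\
  rint mu (fun t => \sum_(i <- s) f i t) = \sum_(i <- s) rint mu (f i).
Proof.
move=> If; elim: s => [|i s [I1 I2]].
  under eq_fun do rewrite big_nil; rewrite big_nil; split.
    have := rintegrableZ 0 HI; congr rintegrable; apply/funext => t; exact: mul0r.
  by rewrite /rint /Rintegral integral0.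
under eq_fun do rewrite big_cons; rewrite big_cons; split; first exact: rintegrableD.
have := rint_comb 1 1 (If i) I1; rewrite !mul1r I2 => <-.
by congr rint; apply/funext => t; rewrite !mul1r.
Qed.

(** One averaging multiplies the transform by [vb], the mean of the v i. The list l stays arbitrary
    because unfolding the average lengthens it. *)
Let avg_hat k l :
  rint mu (fun t => tensor_avg k l [::] (sc t) * cos (phase a t)) = vb ^+ k * rint mu (fun t
    => ten l t * cos (phase a t)) /\
  rint mu (fun t => tensor_avg k l [::] (sc t) * sin (phase a t)) = vb ^+ k * rint mu (fun t
    => ten l t * sin (phase a t)).
Proof.
have S (tr : T -> R) k' l' (G : seq 'I_d -> R) :
    (forall l, rintegrable mu (fun t => tensor_avg k' l [::] (sc t) * tr t)) ->
    (forall l, rint mu (fun t => tensor_avg k' l [::] (sc t) * tr t) = vb ^+ k' * G l) ->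
    (forall i l, G (i :: l) = v i * G l) ->
    rint mu (fun t => tensor_avg k'.+1 l' [::] (sc t) * tr t) = vb ^+ k'.+1 * G l'.
  move=> It E GS.
  have [I1 I2] := rint_sum (index_enum 'I_d) (fun i => It (i :: l')).
  have -> : (fun t => tensor_avg k'.+1 l' [::] (sc t) * tr t) =
    (fun t => d%:R^-1 * \sum_(i < d) tensor_avg k' (i :: l') [::] (sc t) * tr t).
    by apply/funext => t; rewrite /= -mulrA mulr_suml.
  rewrite rintZ// I2; under eq_bigr do rewrite E GS mulrCA.
  by rewrite -mulr_suml exprS /vb; ring.
elim: k l => [|k IH] l; first by rewrite expr0 !mul1r.
split.
- apply: (S _ _ _ (fun l => rint mu (fun t => ten l t * cos (phase a t)))).
  + by move=> l'; exact: (rintegrable_phase a (avgI k l')).1.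
  + by move=> l'; exact: (IH l').1.
  + by move=> i l'; exact: (ten_hatS i l').1.
- apply: (S _ _ _ (fun l => rint mu (fun t => ten l t * sin (phase a t)))).
  + by move=> l'; exact: (rintegrable_phase a (avgI k l')).2.
  + by move=> l'; exact: (IH l').2.
  + by move=> i l'; exact: (ten_hatS i l').2.
Qed.

Variable s : R.
Hypothesis s0 : 0 < s.
Hypothesis sdl : 16 * (1 + s) * dl <= 1.

(** The power s of -Laplacian/(d w^2), expanded around 1 by the binomial series and applied in
    space. *)
Definition tensor_series (J : seq 'I_d) (x : 'rV[R]_d) : R :=
  rsum (fun k => gbinom s k * tensor_avg k [::] J x).

Let s1 : 0 <= 1 + s. Proof. by rewrite addr_ge0// ltW. Qed.

Let qle : (1 + s) * dl <= 2^-1.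
Proof. by have := sdl; lra. Qed.

Let q0 : 0 <= (1 + s) * dl. Proof. by rewrite mulr_ge0// ltW. Qed.

Let term_H k t : `|gbinom s k * tensor_avg k [::] [::] (sc t)| <= H t * ((1 + s) * dl) ^+ k.
Proof.
rewrite normrM exprMn mulrCA; apply: ler_pM => //; first exact: gbinom_norm.
by have := avg_H k [::] t; rewrite addn0.
Qed.

Let H0 t : 0 <= H t.
Proof. by apply: prodr_ge0 => i _; rewrite !mulr_ge0. Qed.

Let term_bounded t : abs_bounded (fun k => gbinom s k * tensor_avg k [::] [::] (sc t)) (2 * H
  t).
Proof.
have B : abs_bounded (fun k => gbinom s k * tensor_avg k [::] [::] (sc t)) (H t / (1 - (1 + s)
  * dl)).
  by apply: abs_bounded_geo => //; rewrite q0 (le_lt_trans qle)// invf_lt1// ltr1n.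
move=> N; apply: le_trans (B N) _; rewrite mulrC ler_wpM2r//.
rewrite -[leRHS]invrK lef_pV2 ?posrE ?invr_gt0//; have := qle; lra.
Qed.

(** 1 + vb equals |a|^2 / (d (rw)^2), so the binomial series in vb sums to the symbol. The majorant
    2H allows the transform to be taken term by term. *)
Lemma tensor_series_fourier :
  [/\ rintegrable mu (fun t => tensor [::] [::] (sc t)),
      rintegrable mu (fun t => tensor_series [::] (sc t)),
      rint mu (fun t => tensor_series [::] (sc t) * cos (phase a t)) =
        ((\sum_(i < d) a i ^+ 2) / (d%:R * (r * w) ^+ 2)) `^ s *
        rint mu (fun t => tensor [::] [::] (sc t) * cos (phase a t)) &
      rint mu (fun t => tensor_series [::] (sc t) * sin (phase a t)) =
        ((\sum_(i < d) a i ^+ 2) / (d%:R * (r * w) ^+ 2)) `^ s *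
        rint mu (fun t => tensor [::] [::] (sc t) * sin (phase a t))].
Proof.
have vbE : 1 + vb = (\sum_(i < d) a i ^+ 2) / (d%:R * (r * w) ^+ 2).
  have E : \sum_(i < d) (a i / (r * w)) ^+ 2 = (\sum_(i < d) a i ^+ 2) / (r * w) ^+ 2.
    by rewrite mulr_suml; apply: eq_bigr => i _; rewrite expr_div_n.
  rewrite /vb /v sumrB sumr_const card_ord E -[1 *+ d]/(d%:R).
  have dn : d%:R != 0 :> R by rewrite pnatr_eq0 -lt0n.
  rewrite mulrBr mulVf// addrC subrK [in RHS]invfM mulrCA.
  by [].
have conv (tr : T -> R) (G0 : R) : measurable_fun setT tr -> (forall t, `|tr t| <= 1) ->
    (forall k, rint mu (fun t => tensor_avg k [::] [::] (sc t) * tr t) = vb ^+ k * G0) ->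
    (forall k, rintegrable mu (fun t => tensor_avg k [::] [::] (sc t) * tr t)) ->
    rintegrable mu (fun t => tensor_series [::] (sc t) * tr t) /\
    (fun N => (\sum_(k < N) gbinom s k * vb ^+ k) * G0) @ \oo -->
      rint mu (fun t => tensor_series [::] (sc t) * tr t).
  move=> mt t1 E I.
  pose F N t := (\sum_(k < N) gbinom s k * tensor_avg k [::] [::] (sc t)) * tr t.
  have mF N : measurable_fun setT (F N).
    apply: measurable_funM => //; apply: measurable_sum => k; apply: measurable_funM => //.
  have FI N : rintegrable mu (F N) /\ rint mu (F N) = (\sum_(k < N) gbinom s k * vb ^+ k) * G0.
    elim: N => [|N [I1 I2]].
      have -> : F 0%N = (fun t => 0 * H t) by apply/funext => t; rewrite /F big_ord0 !mul0r.
      by rewrite rintZ// big_ord0 !mul0r; split => //; exact: rintegrableZ.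
    have -> : F N.+1 = (fun t => 1 * F N t + gbinom s N * (tensor_avg N [::] [::] (sc t) * tr
      t)).
      by apply/funext => t; rewrite /F big_ord_recr /=; ring.
    rewrite rint_comb// I2 E big_ord_recr /=; split; last by ring.
    by apply: rintegrableD; exact: rintegrableZ.
  have cF t : F ^~ t @ \oo --> tensor_series [::] (sc t) * tr t.
    by apply: cvgMr_tmp; exact: (rsum_cvg (term_bounded t)).
  have bF N t : `|F N t| <= 2 * H t.
    rewrite /F normrM -[leRHS]mulr1; apply: ler_pM => //.
    by apply: le_trans (ler_norm_sum _ _ _) _; exact: term_bounded.
  have [J1 J2] := rdominated mF cF bF (rintegrableZ 2 HI).
  split; first exact: J1.
  by move: J2; under eq_fun do rewrite (FI _).2.
have mphase : measurable_fun setT (phase a : T -> R) by exact: measurable_phase.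
have mc : measurable_fun setT (fun t : T => cos (phase a t)).
  exact: (measurableT_comp (continuous_measurable (@continuous_cos R))).
have ms : measurable_fun setT (fun t : T => sin (phase a t)).
  exact: (measurableT_comp (continuous_measurable (@continuous_sin R))).
have [_ Cc] := conv _ _ mc (fun t => norm_cos_le1 _) (fun k => (avg_hat k [::]).1)
  (fun k => (rintegrable_phase a (avgI k [::])).1).
have [_ Cs] := conv _ _ ms (fun t => norm_sin_le1 _) (fun k => (avg_hat k [::]).2)
  (fun k => (rintegrable_phase a (avgI k [::])).2).
have I1 : rintegrable mu (fun t => tensor_series [::] (sc t)).
  have mS : measurable_fun setT (fun t => tensor_series [::] (sc t)).
    apply: (@measurable_fun_lim _ _ _ (fun N t => \sum_(k < N) gbinom s k * tensor_avg k [::]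
      [::] (sc t))).
      by move=> N; apply: measurable_sum => k; apply: measurable_funM.
    by move=> t; exact: (rsum_cvg (term_bounded t)).
  apply: (le_rintegrable mS (g := fun t => 2 * H t)); last exact: rintegrableZ.
  by move=> t; exact: rsum_norm_le (term_bounded t).
(* Where the transform of the tensor product is nonzero, every v i, hence also vb, is at most dl in
   absolute value, inside the disc of the binomial series. Where it is zero both sides vanish, which
   [zc] covers. *)
have key (G0 : R) : (rint mu (fun t => ten [::] t * cos (phase a t)) +i*
    rint mu (fun t => ten [::] t * sin (phase a t)))%C != 0 ->
    (fun N => (\sum_(k < N) gbinom s k * vb ^+ k) * G0) @ \oo --> (1 + vb) `^ s * G0.
  rewrite ten_hat => /prodf_neq0 Z.
  have vd : `|vb| <= dl by apply: avg_le => i; apply: v_small; exact: Z.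
  apply: cvgMr_tmp; rewrite -binomial_series//.
    apply: (@rsum_cvg _ _ (1 / (1 - (1 + s) * dl))); apply: abs_bounded_geo => //.
      by rewrite q0 (le_lt_trans qle)// invf_lt1// ltr1n.
    move=> k; rewrite normrM normrX exprMn mul1r; apply: ler_pM => //; first exact: gbinom_norm.
    by rewrite lerXn2r// ?nnegrE// ltW.
  have s8 : 0 < 8 * (1 + s) by rewrite mulr_gt0// ltr_wpDr// ltW.
  apply: (le_lt_trans vd); rewrite -div1r ltr_pdivlMr// mulrC.
  by have := sdl; rewrite (_ : 16 * (1 + s) * dl = 2 * (8 * (1 + s) * dl)); [lra|ring].
have zc (G0 : R) : G0 = 0 -> (fun N => (\sum_(k < N) gbinom s k * vb ^+ k) * G0) @ \oo --> (0
  : R).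
  by move=> ->; under eq_fun do rewrite mulr0; exact: cvg_cst.
split => //; first exact: (avgI 0 [::]).
- rewrite -vbE.
  have [z|nz] := eqVneq (rint mu (fun t => ten [::] t * cos (phase a t)) +i*
    rint mu (fun t => ten [::] t * sin (phase a t)))%C 0;
      last exact: (cvg_unique _ Cc (key _ nz)).
  case: z => z1 z2; rewrite [X in _ = _ * X]z1 mulr0.
  exact: (cvg_unique _ Cc (zc _ z1)).
- rewrite -vbE.
  have [z|nz] := eqVneq (rint mu (fun t => ten [::] t * cos (phase a t)) +i*
    rint mu (fun t => ten [::] t * sin (phase a t)))%C 0;
      last exact: (cvg_unique _ Cs (key _ nz)).
  case: z => z1 z2; rewrite [X in _ = _ * X]z2 mulr0.
  exact: (cvg_unique _ Cs (zc _ z2)).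
Qed.

End tensor.

(** * Euclidean norm and subadditivity of powers *)

Section euclidean.
Variables (R : realType) (d : nat).
Implicit Types x y : 'rV[R]_d.

Lemma dotp_ge0 x : 0 <= dotp x x.
Proof. by apply: sumr_ge0 => i _; rewrite -expr2 sqr_ge0. Qed.

Lemma eucl_ge0 x : 0 <= eucl x.
Proof. exact: sqrtr_ge0. Qed.

Lemma sqr_eucl x : eucl x ^+ 2 = \sum_(i < d) x ord0 i ^+ 2.
Proof. by rewrite /eucl sqr_sqrtr ?dotp_ge0//; apply: eq_bigr => i _; rewrite expr2. Qed.

Lemma dotpDl x y z : dotp (x + y) z = dotp x z + dotp y z.
Proof. by rewrite /dotp -big_split; apply: eq_bigr => i _; rewrite !mxE mulrDl. Qed.

Lemma dotpC x y : dotp x y = dotp y x.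
Proof. by apply: eq_bigr => i _; rewrite mulrC. Qed.

Lemma dotpZl (r : R) x y : dotp (r *: x) y = r * dotp x y.
Proof. by rewrite /dotp mulr_sumr; apply: eq_bigr => i _; rewrite mxE mulrA. Qed.

Lemma cauchy_schwarz x y : dotp x y <= eucl x * eucl y.
Proof.
have [y0|y0] := eqVneq (dotp y y) 0.
  have yi i : y ord0 i = 0.
    have /psumr_eq0P H : \sum_(i < d) y ord0 i * y ord0 i = 0 by exact: y0.
    have /eqP : y ord0 i * y ord0 i = 0 by apply: H => // j _; rewrite -expr2 sqr_ge0.
    by rewrite mulf_eq0 orbb => /eqP.
  rewrite /dotp big1 ?mulr_ge0 ?eucl_ge0// => i _.
  by rewrite yi mulr0.
have yp : 0 < dotp y y by rewrite lt_neqAle eq_sym y0 dotp_ge0.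
have := dotp_ge0 (dotp y y *: x + (- dotp x y) *: y).
rewrite !(dotpDl, dotpZl) !(dotpC _ (_ + _)) !(dotpDl, dotpZl) (dotpC y x).
set a := dotp y y in yp *; set b := dotp x y; set c := dotp x x.
have -> : a * (a * c + - b * b) + - b * (a * b + - b * a) = a * (a * c - b ^+ 2) by ring.
rewrite pmulr_rge0// subr_ge0 => h.
have -> : eucl x * eucl y = Num.sqrt (c * a) by rewrite sqrtrM// dotp_ge0.
apply: le_trans (ler_norm _) _; rewrite -sqrtr_sqr ler_wsqrtr//.
by rewrite mulrC.
Qed.

Lemma eucl_triangle x y : eucl (x + y) <= eucl x + eucl y.
Proof.
rewrite -(@ler_pXn2r _ 2) ?nnegrE ?addr_ge0 ?eucl_ge0//.
have E (z : 'rV[R]_d) : eucl z ^+ 2 = dotp z z by rewrite /eucl sqr_sqrtr ?dotp_ge0.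
rewrite E sqrrD !E dotpDl !(dotpC _ (x + y)) !dotpDl (dotpC y x).
by have := cauchy_schwarz x y; lra.
Qed.

Lemma euclZ (r : R) x : eucl (r *: x) = `|r| * eucl x.
Proof.
rewrite /eucl dotpZl dotpC dotpZl mulrA -expr2 sqrtrM ?sqr_ge0//.
by rewrite sqrtr_sqr.
Qed.

Lemma euclN x : eucl (- x) = eucl x.
Proof. by rewrite -scaleN1r euclZ normrN1 mul1r. Qed.

Lemma eucl_coord x i : `|x ord0 i| <= eucl x.
Proof.
rewrite -sqrtr_sqr ler_wsqrtr// /dotp (bigD1 i)//= expr2 lerDl.
by apply: sumr_ge0 => j _; rewrite -expr2 sqr_ge0.
Qed.

Lemma eucl_le_sum x : eucl x <= \sum_(i < d) `|x ord0 i|.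
Proof.
have s0 (s : seq 'I_d) : 0 <= \sum_(i <- s) `|x ord0 i| by exact: sumr_ge0.
rewrite -(@ler_pXn2r _ 2) ?nnegrE ?eucl_ge0// sqr_eucl.
elim: (index_enum _) => [|i s IH]; first by rewrite !big_nil expr0n.
rewrite !big_cons sqrrD real_normK ?num_real// -addrA lerD2l.
by apply: le_trans IH _; rewrite lerDr mulrn_wge0// mulr_ge0.
Qed.

End euclidean.

Section powR_subadditive.
Variable R : realType.

(** For z = u or z = v the ratio z/(u + v) lies in [0, 1], so it is at most its power of exponent
    eta <= 1; the two ratios add up to 1. *)
Lemma powR_subadd (eta u v : R) : 0 < eta -> eta <= 1 -> 0 <= u -> 0 <= v ->
  (u + v) `^ eta <= u `^ eta + v `^ eta.
Proof.
move=> e0 e1 u0 v0; have [uv|uv] := eqVneq (u + v) 0.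
  by rewrite uv powR0 ?gt_eqF// addr_ge0 ?powR_ge0.
have uvp : 0 < u + v by rewrite lt_neqAle eq_sym uv addr_ge0.
have H z : 0 <= z -> z <= u + v -> z / (u + v) * (u + v) `^ eta <= z `^ eta.
  move=> z0 zuv; have z1 : 0 <= z / (u + v) <= 1.
    by rewrite divr_ge0 ?(ltW uvp)//= ler_pdivrMr// mul1r.
  have {2}-> : z = z / (u + v) * (u + v) by rewrite divfK.
  case/andP: z1 => z1 z2; rewrite powRM ?(ltW uvp)// ler_wpM2r ?powR_ge0//.
  have [->|zn] := eqVneq (z / (u + v)) 0; first exact: powR_ge0.
  by apply: ger1_powR => //; rewrite z2 andbT lt_neqAle eq_sym zn z1.
apply: le_trans (lerD (H u u0 _) (H v v0 _)); rewrite ?lerDl ?lerDr//.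
by rewrite -!mulrDl divff// mul1r.
Qed.

Lemma powR_le_sum d (eta : R) (f : 'I_d -> R) : 0 < eta -> eta <= 1 -> (forall i, 0 <= f i) ->
  (\sum_i f i) `^ eta <= \sum_i f i `^ eta.
Proof.
move=> e0 e1 f0.
suff [] : (\sum_i f i) `^ eta <= \sum_i f i `^ eta /\ 0 <= \sum_i f i by [].
elim/big_rec2: _ => [|i x y _ [IH y0]]; first by rewrite powR0// gt_eqF.
split; last exact: addr_ge0.
by apply: le_trans (powR_subadd e0 e1 _ _) _ => //; rewrite lerD2l.
Qed.

(** Turns a product of one-variable decays exp(-c|x_i|^eta) into decay in the Euclidean norm. *)
Lemma eucl_powR_le_sum d (eta : R) (x : 'rV[R]_d) : 0 < eta -> eta <= 1 ->
  eucl x `^ eta <= \sum_(i < d) `|x ord0 i| `^ eta.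
Proof.
move=> e0 e1; apply: le_trans (powR_le_sum e0 e1 (fun i => normr_ge0 (x ord0 i))).
by rewrite ge0_ler_powR ?nnegrE ?(ltW e0) ?eucl_ge0 ?eucl_le_sum// sumr_ge0.
Qed.

Lemma eucl_powR_diff d (eta : R) (x y : 'rV[R]_d) : 0 < eta -> eta <= 1 ->
  eucl x `^ eta <= eucl y `^ eta + eucl (x - y) `^ eta.
Proof.
move=> e0 e1; apply: le_trans (powR_subadd e0 e1 (eucl_ge0 _) (eucl_ge0 _)).
rewrite ge0_ler_powR ?nnegrE ?(ltW e0) ?addr_ge0 ?eucl_ge0//.
by rewrite -[x in leLHS](subrK y) addrC; exact: eucl_triangle.
Qed.

End powR_subadditive.

Section template.
Variables (R : realType) (d : nat).
Local Notation mu := (@lebesgue_tuple R d).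

Lemma djetZ (c : R) (F : seq 'I_d -> 'rV[R]_d -> R) : djet F -> djet (fun J x => c * F J x).
Proof. by move=> jF J i x; exact: (is_deriveZ c (jF J i x)). Qed.

Definition lap_symbol (g s r : R) (a : 'I_d -> R) : R := (g * (\sum_(i < d) a i ^+ 2) / r ^+
  2) `^ s.

(* phi has its spectrum in a shell, and up to a constant factor G is the
   fractional Laplacian of phi at every scale and location *)
Lemma template_exists (eta s : R) : (0 < d)%N -> 0 < eta -> eta < 1 -> 0 < s ->
  exists phi G : seq 'I_d -> 'rV[R]_d -> R, exists A C c g : R,
  [/\ [/\ 1 <= A, 1 <= C, 0 < c & 0 < g],
      djet phi /\ djet G,
      forall J x, `|phi J x| <= C * A ^+ size J * expR (- (c * eucl x `^ eta)) /\
                  `|G J x| <= C * A ^+ size J * expR (- (c * eucl x `^ eta)),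
      phi [::] 0 = 1 /\ 2^-1 <= G [::] 0 &
      forall r p, 0 < r ->
        let: f := fun t => phi [::] (r *: (row_of t - p)) in
        let: h := fun t => G [::] (r *: (row_of t - p)) in
        [/\ measurable_fun setT f, measurable_fun setT h &
        forall a, rint mu (fun t => h t * cos (phase a t)) =
                  lap_symbol g s r a * rint mu (fun t => f t * cos (phase a t)) /\
                  rint mu (fun t => h t * sin (phase a t)) =
                  lap_symbol g s r a * rint mu (fun t => f t * sin (phase a t))]].
Proof.
move=> d0 e0 e1 s0.
have s1 : 0 < 1 + s by rewrite addr_gt0.
(* The factors in one variable are bounded by 2, so the tensor products are bounded by 2^d. Dividing
   by 2^d makes the terms of G(0) after the first sum to at most 1/8; the rest of the constant keeps
   dl inside the disc of the binomial series. *)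
pose dl : R := (16 * 2 ^+ d * (1 + s))^-1.
have D0 : 0 < 16 * 2 ^+ d * (1 + s) by rewrite !mulr_gt0// exprn_gt0.
have two1 : 1 <= 2 ^+ d :> R by rewrite exprn_ege1// ler1n.
have dl0 : 0 < dl by rewrite invr_gt0.
have qE : (1 + s) * dl * 2 ^+ d = 16^-1.
  by rewrite /dl; field; rewrite !gt_eqF// exprn_gt0.
have q0 : 0 <= (1 + s) * dl by rewrite mulr_ge0// ltW.
have q16 : (1 + s) * dl <= 16^-1 by rewrite -qE ler_peMr.
have sdl : 16 * (1 + s) * dl <= 1 by move: q16; lra.
have dl1 : dl <= 1.
  by apply: le_trans sdl; rewrite ler_peMl ?(ltW dl0)//; have := s0; lra.
have [th [w [A [C [c [[w0 A1 C1 c0] [jth th00 th_rel thb2 thbC]]]]]]] := exists_modulated e0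
  e1 dl0 dl1.
have [C' C'0 HC'] := subexp_le_invsq c0 e0.
have C0 : 0 < C by apply: lt_le_trans C1.
have A0 : 0 <= A by apply: le_trans A1.
have th_int k t : jet_bound (th k) A (C * C' * invsq t * dl ^+ k) t.
  apply: (jet_boundW A0 (lexx A) _ (thbC k t)).
  rewrite ler_wpM2r ?exprn_ge0 ?(ltW dl0)// -mulrA ler_wpM2l ?(ltW C0)//.
pose KC (t : R) := C * expR (- (c * `|t| `^ eta)).
have prodK (x : 'rV[R]_d) : \prod_(i < d) KC (x ord0 i) <= C ^+ d * expR (- (c * eucl x `^
  eta)).
  rewrite /KC big_split /= prodr_const card_ord -expR_sum sumrN -mulr_sumr.
  rewrite ler_wpM2l ?exprn_ge0 ?(ltW C0)// ler_expR lerN2 ler_wpM2l ?(ltW c0)//.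
  by apply: eucl_powR_le_sum => //; exact: ltW.
have prodK0 (x : 'rV[R]_d) : 0 <= \prod_(i < d) KC (x ord0 i).
  by apply: prodr_ge0 => i _; rewrite mulr_ge0 ?expR_ge0// ltW.
have term (K : R -> R) k J x : (forall t, 0 <= K t) ->
   (forall k t, jet_bound (th k) A (K t * dl ^+ k) t) ->
   `|gbinom s k * tensor_avg th k [::] J x| <=
   \prod_(i < d) K (x ord0 i) * A ^+ size J * ((1 + s) * dl) ^+ k.
  move=> K0 HK; rewrite normrM exprMn.
  have -> : \prod_(i < d) K (x ord0 i) * A ^+ size J * ((1 + s) ^+ k * dl ^+ k) =
    (1 + s) ^+ k * (\prod_(i < d) K (x ord0 i) * (dl ^+ k * A ^+ size J)) by ring.
  apply: ler_pM => //; first exact: gbinom_norm.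
  by have := tensor_avg_bound d0 k [::] J x HK; rewrite addn0.
have geo (a : nat -> R) D : 0 <= D -> (forall k, `|a k| <= D * ((1 + s) * dl) ^+ k) ->
  abs_bounded a (2 * D).
  move=> DD H; have q1 : (1 + s) * dl < 1 by move: q16; lra.
  have B : abs_bounded a (D / (1 - (1 + s) * dl)) by apply: abs_bounded_geo => //; rewrite q0.
  move=> N; apply: le_trans (B N) _; rewrite mulrC ler_wpM2r//.
  by rewrite -[leRHS]invrK lef_pV2 ?posrE ?invr_gt0//; move: q16; lra.
exists (tensor th [::]), (tensor_series th s), A, (2 * C ^+ d), c, (d%:R * w ^+ 2)^-1.
have Cd : 1 <= C ^+ d by rewrite exprn_ege1.
split.
- split => //; first by rewrite mulr_ege1 ?ler1n.
  by rewrite invr_gt0 mulr_gt0 ?exprn_gt0// ltr0n.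
- split; first exact: tensorP.
  apply: (@djet_rsum _ _ (fun k J x => gbinom s k * tensor_avg th k [::] J x)
    (fun J k => 2 ^+ d * A ^+ size J * ((1 + s) * dl) ^+ k) (fun J => 2 * (2 ^+ d * A ^+ size
      J))).
  + by move=> k; apply: djetZ; apply: tensor_avgP.
  + move=> k J x; apply: le_trans (term (fun=> 2) k J x (fun=> ler0n R 2) thb2) _.
    by rewrite prodr_const card_ord.
  + move=> J; apply: geo; first by rewrite mulr_ge0 ?exprn_ge0.
    move=> k; rewrite ger0_norm// !mulr_ge0 ?exprn_ge0//.
- move=> J x; split.
    have := tensor_bound [::] J x thbC; move/le_trans; apply.
    rewrite expr0 mul1r -/(KC _) mulrAC ler_wpM2r ?exprn_ge0//.
    apply: le_trans (prodK x) _; rewrite -mulrA ler_peMl ?ler1n//.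
    by rewrite mulr_ge0 ?expR_ge0// exprn_ge0// ltW.
  have KC0 t : 0 <= KC t by rewrite mulr_ge0 ?expR_ge0// ltW.
  have := rsum_norm_le (geo _ _ _ (fun k => term KC k J x KC0 thbC)).
  move=> /(_ (mulr_ge0 (prodK0 x) (exprn_ge0 _ A0))) /le_trans; apply.
  by rewrite -!mulrA ler_wpM2l// [A ^+ _ * _]mulrC mulrA ler_wpM2r ?exprn_ge0.
- have T0 : tensor th [::] [::] (0 : 'rV[R]_d) = 1.
    by rewrite /tensor big1// => i _; rewrite mxE.
  split => //.
  have b := fun k => term (fun=> 2) k [::] (0 : 'rV[R]_d) (fun=> ler0n R 2) thb2.
  have ba := geo _ _ _ b; rewrite prodr_const card_ord mulr1 in ba b.
  have {}ba := ba (exprn_ge0 _ (ler0n R 2)).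
  rewrite /tensor_series (rsum_recl ba) /= mul1r T0.
  set tl := rsum _.
  suff : `|tl| <= 8^-1 by rewrite ler_norml => /andP[]; lra.
  have -> : 8^-1 = 2 * (2 ^+ d * ((1 + s) * dl)) :> R by rewrite [2 ^+ d * _]mulrC qE; lra.
  apply: rsum_norm_le; apply: geo; first by rewrite mulr_ge0// exprn_ge0.
  by move=> k; apply: le_trans (b k.+1) _; rewrite exprS mulrA.
- move=> r p r0.
  have F a := @tensor_series_fourier R d d0 th A dl jth A1 dl0 r w p a r0 w0 th_rel (C * C')
    th_int s s0 sdl.
  have [I1 I2 _ _] := F (fun=> 0).
  split; [exact: rintegrable_measurable I1|exact: rintegrable_measurable I2|].
  move=> a; have [_ _ -> ->] := F a.
  have -> : lap_symbol (d%:R * w ^+ 2)^-1 s r a = (\sum_(i < d) a i ^+ 2 / (d%:R * (r * w) ^+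
    2)) `^ s.
    rewrite /lap_symbol; congr (_ `^ _); rewrite -mulr_suml exprMn.
    by field; rewrite !gt_eqF// ltr0n.
  by rewrite mulr_suml.
Qed.

End template.

(** * Separated sets *)

Section pairing.
Local Open Scope nat_scope.

(** (a + b)^2 + a lies below (a + b + 1)^2, so a + b and then a can be recovered. Polynomial growth
    matters: codes of points have to stay below a multiple of exp(L|x|^rho). *)
Definition square_pair (a b : nat) : nat := ((a + b) ^ 2 + a)%N.

Lemma square_pair_inj a b a' b' : square_pair a b = square_pair a' b' -> a = a' /\ b = b'.
Proof.
have lt u v u' v' : u + v < u' + v' -> square_pair u v < square_pair u' v'.
  move=> uv; apply: (@leq_trans ((u' + v') ^ 2)); last exact: leq_addr.
  apply: (@leq_trans ((u + v).+1 ^ 2)); last by rewrite leq_exp2r.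
  by rewrite /square_pair !expnS !expn0; lia.
move=> h; have [/lt|/lt|s] := ltngtP (a + b) (a' + b'); rewrite ?h ?ltnn//.
by move: h; rewrite /square_pair s; split; lia.
Qed.

Definition seq_code (s : seq nat) : nat := foldr square_pair 0%N s.

(** The sizes have to agree because [square_pair 0 0] is 0, so that [[::]] and [[:: 0]] have the
    same code. *)
Lemma seq_code_inj s t : size s = size t -> seq_code s = seq_code t -> s = t.
Proof.
elim: s t => [|a s IH] [|b t]//= [st] /square_pair_inj[-> h].
by rewrite (IH t).
Qed.

(** Prepending an entry squares the bound: an exponent e of 2b becomes 2 + 2e. *)
Fixpoint code_degree (n : nat) : nat := if n is n'.+1 then (2 + 2 * code_degree n')%N else 0%N.

Lemma seq_code_le (b : nat) (s : seq nat) : all (fun k => k < b)%N s ->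
  ((seq_code s).+1 <= (2 * b) ^ code_degree (size s))%N.
Proof.
elim: s => [//|a s IH] /= /andP[ab /IH].
rewrite /square_pair; set c := seq_code s; set e := code_degree _.
have -> : ((2 * b) ^ (2 + 2 * e) = ((2 * b) * (2 * b) ^ e) ^ 2)%N.
  by rewrite -expnS -expnM; congr (_ ^ _)%N; lia.
move: ((2 * b) ^ e)%N => D cD; apply: (@leq_trans ((a + c).+1 ^ 2));
  first by rewrite !expnS !expn0; lia.
rewrite leq_exp2r//; apply: (@leq_trans (b + D)); first lia.
by rewrite -mulnA mul2n -addnn leq_add ?leq_pmulr ?leq_pmull//; lia.
Qed.

End pairing.

Section separated.
Variables (R : realType) (d : nat) (rho : R).
Hypotheses (d0 : (0 < d)%N) (rho0 : 0 < rho) (rho1 : rho <= 1).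
Implicit Types (G : set 'rV[R]_d) (x y : 'rV[R]_d).

Lemma separated_dist G : rho_separated rho G ->
  exists A B : R, [/\ 0 < A, 0 < B &
    forall x y, G x -> G y -> x != y -> A * expR (- (B * eucl x `^ rho)) <= eucl (x - y)].
Proof.
case=> _ [A [B [A0 B0 H]]]; exists A, B; split=> // x y Gx Gy xy.
have := H x Gx; rewrite mulNr => /le_trans; move=> /(_ (eucl (x - y))%:E).
rewrite lee_fin; apply; apply: ereal_inf_lbound; exists y => //; split=> //.
by move=> /= yx; move: xy; rewrite yx eqxx.
Qed.

(* A point is coded by n = floor |x| and the cell of a grid of mesh
   exp(-B (n+1)^rho) that contains it. *)
Lemma separated_index G : rho_separated rho G ->
  exists (iota : 'rV[R]_d -> nat) (C L : R), [/\ 0 < C, 0 < L,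
    forall x y, G x -> G y -> iota x = iota y -> x = y &
    forall x, (iota x).+1%:R <= C * expR (L * eucl x `^ rho)].
Proof.
move=> /separated_dist[A [B [A0 B0 H]]].
have [D D0 DE] : exists2 D : R, 0 < D & D = d%:R / A.
  by exists (d%:R / A) => //; rewrite divr_gt0// ltr0n.
have [n n_lt n_le] : exists2 n : 'rV[R]_d -> nat,
    forall x, eucl x < (n x).+1%:R & forall x, (n x)%:R <= eucl x.
  exists (fun x => Num.truncn (eucl x)) => x; first exact: truncnS_gt.
  by rewrite truncn_le eucl_ge0.
(* m k cells per unit length: two points in one cell are at distance at most d / m k, which is less
   than the separation A exp(-B(k+1)^rho) guaranteed up to norm k+1. *)
have [m m_gt m_le] : exists2 m : nat -> nat,
    forall k, D * expR (B * (k.+1)%:R `^ rho) < (m k)%:R &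
    forall k, (m k)%:R <= D * expR (B * (k.+1)%:R `^ rho) + 1.
  exists (fun k => (Num.truncn (D * expR (B * (k.+1)%:R `^ rho))).+1) => k.
    exact: truncnS_gt.
  by rewrite -[leLHS]natr1 lerD2r truncn_le mulr_ge0 ?expR_ge0 ?ltW.
have m0 k : 0 < (m k)%:R :> R.
  by apply: le_lt_trans (m_gt k); rewrite mulr_ge0 ?expR_ge0 ?ltW.
have coord_ge0 x i : 0 <= x ord0 i + (n x).+1%:R.
  have := eucl_coord x i; rewrite ler_norml => /andP[h _].
  by have := n_lt x; lra.
have [cell cellP] : exists cell : 'rV[R]_d -> 'I_d -> nat, forall x i,
    (cell x i)%:R <= (x ord0 i + (n x).+1%:R) * (m (n x))%:R < (cell x i)%:R + 1.
  exists (fun x i => Num.truncn ((x ord0 i + (n x).+1%:R) * (m (n x))%:R)) => x i.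
  by rewrite natr1 truncn_itv// mulr_ge0.
pose io x := seq_code (n x :: [seq cell x i | i <- enum 'I_d]).
have szE x : size (n x :: [seq cell x i | i <- enum 'I_d]) = d.+1.
  exact: (f_equal S (etrans (size_map _ _) (size_enum_ord d))).
have injio x y : G x -> G y -> io x = io y -> x = y.
  move=> Gx Gy xy_io.
  have e := seq_code_inj (etrans (szE x) (esym (szE y))) xy_io.
  have nn : n x = n y := f_equal (head 0%N) e.
  have /eq_in_map cc := f_equal behead e.
  apply/eqP/negPn/negP => xy; have := H x y Gx Gy xy; apply/negP; rewrite -ltNge.
  have near i : `|(x - y) ord0 i| <= (m (n x))%:R^-1.
    have := cellP x i; have := cellP y i; rewrite -(cc i (mem_enum _ i)) -nn.
    move=> /andP[y1 y2] /andP[x1 x2]; rewrite !mxE -[leRHS]mul1r ler_pdivlMr//.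
    rewrite -{1}(gtr0_norm (m0 (n x))) -normrM mulrBl ler_norml.
    by move: y1 y2 x1 x2; rewrite !mulrDl; lra.
  have := eucl_le_sum (x - y); move/le_lt_trans; apply.
  apply: (@le_lt_trans _ _ (d%:R * (m (n x))%:R^-1)).
    apply: le_trans (ler_sum _ (fun i _ => near i)) _.
    by rewrite sumr_const card_ord -[leLHS]mulr_natl.
  rewrite ltr_pdivrMr// -ltr_pdivrMl ?mulr_gt0 ?expR_gt0//.
  rewrite invfM -expRN opprK mulrAC [A^-1 * _]mulrC -DE.
  apply: le_lt_trans (m_gt (n x)); rewrite ler_wpM2l ?(ltW D0)// ler_expR ler_wpM2l ?(ltW B0)//.
  by rewrite ge0_ler_powR ?nnegrE ?(ltW rho0) ?eucl_ge0// ltW.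
(* A strict bound for all entries of the coded list: the cell numbers are at most 2(n+1)m because
   coordinates are bounded by n+1. *)
pose b x := (2 * (n x).+1 * (m (n x)) + (n x).+1)%N.
have bio x : ((io x).+1 <= (2 * b x) ^ code_degree d.+1)%N.
  rewrite -(szE x).
  apply: seq_code_le; rewrite /= /b; apply/andP; split; first lia.
  apply/allP => k /mapP[i _ ->]; apply: (@leq_ltn_trans (2 * (n x).+1 * m (n x))); last lia.
  rewrite -(ler_nat R); have /andP[+ _] := cellP x i.
  move=> /le_trans; apply; rewrite !natrM ler_wpM2r//.
  have := eucl_coord x i; rewrite ler_norml => /andP[_ h].
  by have := n_lt x; lra.
have [C1 C10 HC1] : exists2 C1, 0 < C1 & forall x, (2 * b x)%:R <= C1 * expR ((B + 1) * eucl x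
  `^ rho).
  have [C0 C00 HC0] := powR_le_expR ltr01 ltr01 rho0.
  exists ((C0 + 1) * (4 * (D * expR B) + 6)).
    by rewrite mulr_gt0 ?addr_gt0 ?mulr_gt0 ?expR_gt0.
  move=> x; have u0 := eucl_ge0 x.
  have := HC0 _ u0; rewrite powRr1// mul1r => H0.
  rewrite [(B + 1) * _]mulrDl mul1r [B * _ + _]addrC expRD mulrACA.
  set e1 := expR (eucl x `^ rho) in H0 *; set e2 := expR (B * _).
  have p0 := powR_ge0 (eucl x) rho.
  have e11 : 1 <= e1 by rewrite -[leLHS]expR0 ler_expR.
  have e21 : 1 <= e2 by rewrite -[leLHS]expR0 ler_expR mulr_ge0 ?(ltW B0).
  have np : (n x).+1%:R `^ rho <= eucl x `^ rho + 1.
    have := powR_subadd rho0 rho1 u0 ler01; rewrite powR1; apply: le_trans.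
    rewrite ge0_ler_powR ?nnegrE ?(ltW rho0) ?addr_ge0//.
    by rewrite -[leLHS]natr1 lerD2r.
  have mp : (m (n x))%:R <= D * expR B * e2 + 1.
    apply: le_trans (m_le _) _; rewrite lerD2r -mulrA ler_wpM2l ?(ltW D0)//.
    by rewrite -expRD ler_expR; have := ler_wpM2l (ltW B0) np; rewrite mulrDr mulr1 addrC.
  have -> : (2 * b x)%:R = (n x).+1%:R * (4 * (m (n x))%:R + 2) :> R.
    rewrite /b !(natrM, natrD); ring.
  apply: ler_pM; rewrite ?addr_ge0 ?mulr_ge0//.
    by rewrite -[leLHS]natr1; have := n_le x; lra.
  by rewrite mulrDl; move: mp e21; lra.
exists io, (C1 ^+ code_degree d.+1), ((code_degree d.+1)%:R * (B + 1)); split => //.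
- by rewrite exprn_gt0.
- by rewrite mulr_gt0 ?ltr0n// addr_gt0.
- move=> x; apply: (@le_trans _ _ ((2 * b x)%:R ^+ code_degree d.+1)).
    by rewrite -natrX ler_nat.
  rewrite -mulrA expRM_natl -exprMn lerXn2r ?nnegrE ?mulr_ge0 ?expR_ge0//.
  exact: ltW.
Qed.

(** Telescoping: 1/(N+1)^2 <= 1/N - 1/(N+1). *)
Lemma abs_bounded_invsq : abs_bounded (fun n => (n.+1%:R ^- 2 : R)) 2.
Proof.
move=> N; case: N => [|N]; first by rewrite big_ord0.
suff : \sum_(n < N.+1) `|n.+1%:R ^- 2 : R| <= 2 - N.+1%:R^-1.
  by move=> /le_trans; apply; rewrite gerBl invr_ge0.
elim: N => [|N IH].
  by rewrite big_ord_recr big_ord0 /= expr1n invr1 normr1; lra.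
rewrite big_ord_recr /= ger0_norm ?invr_ge0 ?exprn_ge0//.
apply: le_trans (lerD IH (lexx _)) _.
have n0 : 0 < N.+1%:R :> R by rewrite ltr0n.
rewrite -[N.+2%:R]natr1; move: (N.+1%:R) n0 => t n0.
rewrite -addrA lerD2l -subr_ge0.
have -> : - (t + 1)^-1 - (- t^-1 + (t + 1) ^- 2) = (t * (t + 1) ^+ 2)^-1.
  by field; rewrite !gt_eqF// addr_gt0.
by rewrite invr_ge0 mulr_ge0 ?exprn_ge0 ?addr_ge0// ltW.
Qed.

(** A point sits at the position given by its code, so there are gaps, marked by [act]; finite and
    empty sets are covered as well. As the position is at most C exp(L|x|^rho), a negative
    exponential weight becomes summable over the points. *)
Lemma separated_enum G : rho_separated rho G ->
  exists (act : nat -> bool) (pt : nat -> 'rV[R]_d) (C L : R), [/\ 0 < C /\ 0 < L,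
    forall n, act n -> G (pt n),
    forall x, G x -> exists2 n, act n & pt n = x,
    forall m n, act m -> act n -> pt m = pt n -> m = n &
    forall n, act n -> expR (- (L * eucl (pt n) `^ rho)) <= C * n.+1%:R ^- 2].
Proof.
move=> /separated_index[io [C [L [C0 L0 inj H]]]].
pose P n x := G x /\ io x = n.
exists (fun n => `[< exists x, P n x >]), (fun n => xget 0 (P n)), (C ^+ 2), (2 * L).
have act n : `[< exists x, P n x >] -> P n (xget 0 (P n)).
  by move=> /asboolP h; exact: xgetPex.
split.
- by rewrite exprn_gt0// mulr_gt0.
- by move=> n /act[].
- move=> x Gx; have an : `[< exists y, P (io x) y >] by apply/asboolP; exists x.
  by exists (io x) => //; have [G1 E] := act _ an; exact: inj.
- by move=> m n /act[_ {2}<-] /act[_ {2}<-] ->.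
- move=> n /act[_ ion]; have := H (xget 0 (P n)); rewrite ion; set x := xget 0 _.
  set w := eucl x `^ rho => h.
  rewrite -mulrA [2 * _]mulrC expRN expRM_natr ler_pdivlMr ?exprn_gt0 ?ltr0n//.
  rewrite mulrC ler_pdivrMr ?exprn_gt0 ?expR_gt0// -exprMn.
  by rewrite lerXn2r ?nnegrE ?mulr_ge0 ?expR_ge0 ?(ltW C0).
Qed.

End separated.

Lemma succ_sqr_half (n : nat) : (n.+1 ^ 2 <= 4 * n./2.+1 ^ 2)%N.
Proof.
have -> : (4 * n./2.+1 ^ 2 = (2 * n./2.+1) ^ 2)%N by rewrite expnMn.
by rewrite leq_exp2r//; have := odd_double_half n; case: (odd n) => /=; lia.
Qed.

Section nodes.
Variables (R : realType) (d : nat) (rho : R).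
Hypotheses (d0 : (0 < d)%N) (rho0 : 0 < rho) (rho1 : rho <= 1).

(* the two sets are merged into one sequence: even indices carry the points of
   the first set, odd indices those of the second one *)
Lemma separated_nodes (G1 G2 : set 'rV[R]_d) :
  rho_separated rho G1 -> rho_separated rho G2 ->
  exists (act : nat -> bool) (pt : nat -> 'rV[R]_d) (A B L Z : R),
  [/\ [/\ 0 < A, 0 < B, 0 < L & 0 < Z],
      forall n, act n -> if odd n then G2 (pt n) else G1 (pt n),
      (forall x, G1 x -> exists n, [/\ act n, ~~ odd n & pt n = x]) /\
      (forall x, G2 x -> exists n, [/\ act n, odd n & pt n = x]),
      forall m n, act m -> act n -> odd m = odd n -> m != n ->
        A * expR (- (B * eucl (pt n) `^ rho)) <= eucl (pt m - pt n) &
      abs_bounded (fun n => (act n)%:R * expR (- (L * eucl (pt n) `^ rho))) Z].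
Proof.
move=> s1 s2; have [A1 [B1 [A10 B10 H1]]] := separated_dist s1.
have [A2 [B2 [A20 B20 H2]]] := separated_dist s2.
have [a1 [p1 [C1 [L1 [[C10 L10] g1 f1 i1 e1]]]]] := separated_enum d0 rho0 rho1 s1.
have [a2 [p2 [C2 [L2 [[C20 L20] g2 f2 i2 e2]]]]] := separated_enum d0 rho0 rho1 s2.
pose act n := if odd n then a2 n./2 else a1 n./2.
pose pt n := if odd n then p2 n./2 else p1 n./2.
pose A := Num.min A1 A2; pose B := B1 + B2; pose L := L1 + L2.
have A0 : 0 < A by rewrite lt_min A10.
(* Halving the index costs a factor 4, by [succ_sqr_half], and the inverse squares sum to at most
   2. *)
exists act, pt, A, B, L, (4 * (C1 + C2) * 2).
have dist (A' B' e : R) x y : A <= A' -> B' <= B -> 0 <= e ->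
    A' * expR (- (B' * e)) <= eucl (x - y :> 'rV[R]_d) ->
    A * expR (- (B * e)) <= eucl (x - y).
  move=> AA BB e0; apply: le_trans; apply: ler_pM => //; first exact: ltW.
  by rewrite ler_expR lerN2 ler_wpM2r.
split.
- by split; rewrite // ?mulr_gt0 ?addr_gt0.
- by move=> n; rewrite /act /pt; case: odd => [/g2|/g1].
- split=> x.
    by move=> /f1[n an <-]; exists n.*2; rewrite /act /pt odd_double doubleK.
  by move=> /f2[n an <-]; exists n.*2.+1; rewrite /act /pt /= odd_double /= uphalf_double.
- move=> m n am an mn neq; have ne : m./2 != n./2.
    apply: contra neq => /eqP h.
    by rewrite -(odd_double_half m) -(odd_double_half n) mn h.
  move: am an; rewrite /act /pt -mn -(euclN (_ - _)) opprB; case: (odd m) => am an.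
    apply: (dist A2 B2); rewrite ?powR_ge0 ?lerDr ?ge_min ?lexx ?orbT ?(ltW B10)//.
    by apply: H2; [exact: g2|exact: g2|apply: contra ne => /eqP/i2 ->].
  apply: (dist A1 B1); rewrite ?powR_ge0 ?lerDl ?ge_min ?lexx ?orbT ?(ltW B20)//.
  by apply: H1; [exact: g1|exact: g1|apply: contra ne => /eqP/i1 ->].
- have C0 : 0 < 4 * (C1 + C2) by rewrite mulr_gt0 ?addr_gt0.
  have := abs_boundedZ (4 * (C1 + C2)) (@abs_bounded_invsq R).
  rewrite gtr0_norm// => /abs_bounded_le; apply => n.
  rewrite ger0_norm ?mulr_ge0 ?expR_ge0//.
  have h2 : n./2.+1%:R ^- 2 <= 4 * n.+1%:R ^- 2 :> R.
    have p (k : nat) : 0 < k.+1%:R ^+ 2 :> R by rewrite exprn_gt0.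
    rewrite ler_pdivlMr// mulrC ler_pdivrMr// -natrX -natrX -natrM ler_nat.
    exact: succ_sqr_half.
  have gen (a : bool) C' C'' L' e : 0 <= C' -> C' <= C'' -> L' <= L -> 0 <= e ->
      (a -> expR (- (L' * e)) <= C' * n./2.+1%:R ^- 2) ->
      a%:R * expR (- (L * e)) <= 4 * C'' * n.+1%:R ^- 2.
    move=> C'0 CC LL e0; case: a => /= [/(_ isT) h|_]; last first.
      by rewrite mul0r !mulr_ge0 ?invr_ge0 ?exprn_ge0// (le_trans C'0).
    rewrite mul1r; apply: le_trans (le_trans _ h) _.
      by rewrite ler_expR lerN2 ler_wpM2r.
    by rewrite -mulrA mulrCA; apply: ler_pM.
  rewrite /act /pt; case: (odd n).
    by apply: (gen _ C2 _ L2); rewrite ?powR_ge0 ?lerDr ?(ltW C10) ?(ltW C20) ?(ltW L10)//;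
      exact: e2.
  by apply: (gen _ C1 _ L1); rewrite ?powR_ge0 ?lerDl ?(ltW C10) ?(ltW C20) ?(ltW L20)//;
    exact: e1.
Qed.

End nodes.

(** * The interpolation system *)

Lemma le_halving_eq0 (R : realType) (c x : R) : (forall k, `|x| <= c / 2 ^+ k) -> x = 0.
Proof.
move=> H; apply/eqP; rewrite -normr_le0.
have q1 : `|2^-1 : R| < 1 by rewrite ger0_norm ?invr_ge0// invf_lt1// ltr1n.
have cv : (fun k => c * 2^-1 ^+ k) @ \oo --> (c * 0 : R).
  by apply: cvgMl_tmp; exact: cvg_expr.
rewrite -(mulr0 c); apply: (cvgr_to_ge cv); apply: nearW => k.
by rewrite exprVn.
Qed.

Section neumann.
Variables (R : realType) (E : nat -> nat -> R).
Hypothesis EB : forall m, abs_bounded (E m) 2^-1.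

(** Rows of absolute sum at most 1/2 make this an operator of norm at most 1/2 on bounded
    sequences. *)
Definition mxact (w : nat -> R) (m : nat) : R := rsum (fun n => E m n * w n).

Lemma abs_bounded_mxact w K m : (forall n, `|w n| <= K) ->
  abs_bounded (fun n => E m n * w n) (K / 2).
Proof.
move=> wK; have K0 : 0 <= K by exact: le_trans (wK 0%N).
have := abs_boundedZ K (EB m); rewrite ger0_norm// => /abs_boundedW; apply => n.
by rewrite mulrC !normrM (ger0_norm K0) ler_wpM2r.
Qed.

Lemma mxact_norm w K m : (forall n, `|w n| <= K) -> `|mxact w m| <= K / 2.
Proof.
by move=> wK; exact: rsum_norm_le (abs_bounded_mxact m wK).
Qed.

Lemma mxactB w w' K K' m : (forall n, `|w n| <= K) -> (forall n, `|w' n| <= K') ->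
  mxact w m - mxact w' m = mxact (fun n => w n - w' n) m.
Proof.
move=> wK wK'; rewrite /mxact -(rsumB (abs_bounded_mxact m wK) (abs_bounded_mxact m wK')).
by congr rsum; apply/funext => n; rewrite mulrBr.
Qed.

Lemma neumann_unique v K : (forall n, `|v n| <= K) -> (forall m, v m + mxact v m = 0) ->
  forall m, v m = 0.
Proof.
move=> vK Hv; have K0 : 0 <= K by exact: le_trans (vK 0%N).
have H k m : `|v m| <= K / 2 ^+ k.
  elim: k m => [|k IH] m; first by rewrite expr0 divr1.
  have -> : v m = - mxact v m by apply/eqP; rewrite -addr_eq0 Hv.
  by rewrite normrN exprSr invfM mulrA; exact: mxact_norm.
by move=> m; apply: (@le_halving_eq0 _ K).
Qed.

(** The iterates of v -> u - E v from 0 stay bounded by 2K, and after step k they move by at most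
    2K/2^k, uniformly in the index. *)
Lemma neumann_exists u K : (forall n, `|u n| <= K) ->
  exists2 v, forall n, `|v n| <= 2 * K & forall m, v m + mxact v m = u m.
Proof.
move=> uK; have K0 : 0 <= K by exact: le_trans (uK 0%N).
pose s := fix s k m := if k is k'.+1 then u m - mxact (s k') m else 0.
have sB j m : `|s j m| <= 2 * K.
  elim: j m => [|j IH] m /=; first by rewrite normr0 mulr_ge0.
  apply: le_trans (ler_normB _ _) _; have := mxact_norm m IH; have := uK m; lra.
have sC k j m : `|s (k + j)%N m - s k m| <= 2 * K / 2 ^+ k.
  elim: k m => [|k IH] m; first by rewrite subr0 expr0 divr1.
  have -> : s (k.+1 + j)%N m - s k.+1 m = - (mxact (s (k + j)%N) m - mxact (s k) m).
    by rewrite addSn /=; ring.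
  by rewrite (mxactB m (sB _) (sB _)) normrN exprSr invfM mulrA; exact: mxact_norm.
have tel m : abs_bounded (telescope (fun k => s k m)) (2 * K / (1 - 2^-1)).
  apply: abs_bounded_geo; first by rewrite invr_ge0 ler0n invf_lt1// ltr1n.
    by rewrite mulr_ge0.
  by move=> k; rewrite exprVn /telescope /=; have := sC k 1%N m; rewrite addn1.
have vl m : (fun k => s k m) @ \oo --> rsum (telescope (fun k => s k m)).
  have E1 : series (telescope (fun k => s k m)) = (fun k => s k m).
    by rewrite telescopeK; apply/funext => k; rewrite /= subr0.
  by rewrite /rsum; have := abs_bounded_cvg (tel m); rewrite E1.
pose v m := rsum (telescope (fun k => s k m)).
have vs k m : `|s k m - v m| <= 2 * K / 2 ^+ k.
  have cv : (fun j => `|s k m - s j m|) @ \oo --> `|s k m - v m|.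
    by apply: cvg_norm; apply: cvgB; [exact: cvg_cst|exact: vl].
  apply: (cvgr_to_le cv); exists k => // j /= kj.
  by rewrite distrC -(subnKC kj).
have vB m : `|v m| <= 2 * K.
  by have := vs 0%N m; rewrite sub0r normrN expr0 divr1.
(* Inserting iterate k bounds the residual of the limit by 2K/2^k, which avoids exchanging the limit
   with the sum over a row. *)
exists v => // m; apply/eqP; rewrite -subr_eq0; apply/eqP.
apply: (@le_halving_eq0 _ (2 * K)) => k.
have -> : v m + mxact v m - u m = - (s k.+1 m - v m) - mxact (fun n => s k n - v n) m.
  by rewrite -(mxactB m (sB k) vB) /=; ring.
apply: le_trans (ler_normB _ _) _; rewrite normrN.
apply: le_trans (lerD (vs k.+1 m) (mxact_norm m (vs k))) _.
by rewrite exprSr invfM mulrA -mulrDr -[leRHS]mulr1 ler_wpM2l ?mulr_ge0 ?invr_ge0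
  ?exprn_ge0//; lra.
Qed.

End neumann.

(** A solution is chosen for each right-hand side; uniqueness among bounded sequences makes the
    choice linear. *)
Lemma neumann_solver (R : realType) (E : nat -> nat -> R) : (forall m, abs_bounded (E m) 2^-1)
  ->
  exists2 sol : (nat -> R) -> nat -> R,
    forall u K, (forall n, `|u n| <= K) ->
      (forall n, `|sol u n| <= 2 * K) /\ (forall m, sol u m + mxact E (sol u) m = u m) &
    forall a u w K K', (forall n, `|u n| <= K) -> (forall n, `|w n| <= K') ->
      forall n, sol (fun n => a * u n + w n) n = a * sol u n + sol w n.
Proof.
move=> EB; pose P u v := exists2 K, (forall n, `|v n| <= K) & forall m, v m + mxact E v m = u m.
pose sol u : nat -> R := xget (fun=> 0) [set v | P u v].
have P_unique u v v' : P u v -> P u v' -> forall n, v n = v' n.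
  move=> [K vK Hv] [K' vK' Hv'] n; apply/eqP; rewrite -subr_eq0; apply/eqP.
  apply: (neumann_unique EB (v := fun n => v n - v' n) (K := K + K')) => m.
    by apply: le_trans (ler_normB _ _) _; exact: lerD.
  rewrite -(mxactB EB m vK vK'); have := Hv m; have := Hv' m; lra.
have P_ex u K : (forall n, `|u n| <= K) -> P u (sol u).
  move=> uK; have [v vK Hv] := neumann_exists EB uK.
  by apply: (@xgetPex _ (fun=> 0) [set v | P u v]); exists v; exists (2 * K).
exists sol => [u K uK|a u w K K' uK wK' n].
  have [v vK Hv] := neumann_exists EB uK; have Pu := P_ex u K uK.
  have E1 : forall n, sol u n = v n by apply: (P_unique u) => //; exists (2 * K).
  by split=> [n|]; [rewrite E1|case: Pu].
have [A uA HA] := P_ex u K uK; have [B wB HB] := P_ex w K' wK'.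
have cK m : `|a * u m + w m| <= `|a| * K + K'.
  by apply: le_trans (ler_normD _ _) _; rewrite normrM lerD ?ler_wpM2l.
apply: (P_unique _ _ (fun n => a * sol u n + sol w n) (P_ex _ _ cK)).
exists (`|a| * A + B) => m.
  by apply: le_trans (ler_normD _ _) _; rewrite normrM lerD ?ler_wpM2l.
have -> : mxact E (fun n => a * sol u n + sol w n) m = a * mxact E (sol u) m + mxact E (sol w)
  m.
  rewrite /mxact -(rsumZ a (abs_bounded_mxact EB m uA)).
  rewrite -(rsumD (abs_boundedZ a (abs_bounded_mxact EB m uA)) (abs_bounded_mxact EB m wB)).
  by congr rsum; apply/funext => k; ring.
by have := HA m; have := HB m => <- <-; ring.
Qed.

Lemma rint_sum (dsp : measure_display) (T : measurableType dsp) (R : realType)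
  (mu : {measure set T -> \bar R}) (c : nat -> R) (f : nat -> T -> R) N :
  (forall n, rintegrable mu (f n)) ->
  rintegrable mu (fun x => \sum_(n < N) c n * f n x) /\
  rint mu (fun x => \sum_(n < N) c n * f n x) = \sum_(n < N) c n * rint mu (f n).
Proof.
move=> If; elim: N => [|N [I1 I2]].
  have I0 := rintegrableZ 0 (If 0%N).
  have -> : (fun x => \sum_(n < 0) c n * f n x) = (fun x => 0 * f 0%N x).
    by apply/funext => x; rewrite big_ord0 mul0r.
  by rewrite (rintZ _ (If 0%N)) mul0r big_ord0.
have -> : (fun x => \sum_(n < N.+1) c n * f n x) =
          (fun x => 1 * (\sum_(n < N) c n * f n x) + c N * f N x).
  by apply/funext => x; rewrite big_ord_recr mul1r.
rewrite (rint_comb 1 (c N) I1 (If N)) big_ord_recr /= -I2 mul1r; split=> //.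
by apply: rintegrableD; exact: rintegrableZ.
Qed.

Section superposition.
Variables (R : realType) (d : nat).
Local Notation mu := (@lebesgue_tuple R d).
Local Notation RT := (measurableTypeR R).

(** |x|^eta is at least the mean of the |x_i|^eta, so a product of one-variable weights with
    constant c/d is a majorant. *)
Lemma subexp_rintegrable (c eta : R) : (0 < d)%N -> 0 < c -> 0 < eta ->
  exists2 h : d.-tuple RT -> R, rintegrable mu h &
    forall t, expR (- (c * eucl (row_of t) `^ eta)) <= h t.
Proof.
move=> d0 c0 e0; have cd : 0 < c / d%:R by rewrite divr_gt0// ltr0n.
have [C C0 HC] := subexp_le_invsq cd e0.
exists (fun t => \prod_i (C * invsq (tnth t i))).
  by have [] := @tuple_prod R d (fun=> fun t => C * invsq t) (fun i => rintegrableZ C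
    (invsq_integrable R)).
move=> t; apply: (@le_trans _ _ (\prod_(i < d) expR (- (c / d%:R * `|tnth t i| `^ eta)))).
  rewrite -expR_sum sumrN ler_expR lerN2 -mulr_sumr.
  rewrite -mulrA ler_wpM2l ?(ltW c0)// ler_pdivrMl ?ltr0n//.
  apply: (@le_trans _ _ (\sum_(i < d) eucl (row_of t) `^ eta)).
    apply: ler_sum => i _; rewrite ge0_ler_powR ?nnegrE ?(ltW e0) ?eucl_ge0//.
    by have := eucl_coord (row_of t) i; rewrite mxE.
  by rewrite sumr_const card_ord -[leLHS]mulr_natl.
by apply: ler_prod => i _; rewrite expR_ge0 HC.
Qed.

Variables (c eta : R) (a : nat -> seq 'I_d -> 'rV[R]_d -> R) (D : seq 'I_d -> R)
  (w : nat -> R) (W : R).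
Hypotheses (d0 : (0 < d)%N) (c0 : 0 < c) (e0 : 0 < eta) (D0 : forall J, 0 <= D J) (w0 : forall
  n, 0 <= w n)
  (wW : abs_bounded w W) (ja : forall n, djet (a n))
  (aB : forall n J x, `|a n J x| <= D J * w n * expR (- (c * eucl x `^ eta))).

Definition superpose (v : nat -> R) (J : seq 'I_d) (x : 'rV[R]_d) : R := rsum (fun n => v n *
  a n J x).

Lemma superpose_abs_bounded v K J x : (forall n, `|v n| <= K) ->
  abs_bounded (fun n => v n * a n J x) (K * D J * W * expR (- (c * eucl x `^ eta))).
Proof.
move=> vK; have K0 : 0 <= K by exact: le_trans (vK 0%N).
set e := expR _; have k0 : 0 <= K * D J * e by rewrite !mulr_ge0 ?expR_ge0.
have -> : K * D J * W * e = K * D J * e * W by ring.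
have := abs_boundedZ (K * D J * e) wW; rewrite ger0_norm// => /abs_bounded_le.
apply => n; rewrite normrM; apply: le_trans (ler_pM _ _ (vK n) (aB n J x)) _ => //.
by rewrite -/e le_eqVlt; apply/orP; left; apply/eqP; ring.
Qed.

Lemma superpose_norm v K J x : (forall n, `|v n| <= K) ->
  `|superpose v J x| <= K * D J * W * expR (- (c * eucl x `^ eta)).
Proof. by move=> vK; apply: rsum_norm_le; exact: superpose_abs_bounded. Qed.

Lemma superpose_djet v K : (forall n, `|v n| <= K) -> djet (superpose v).
Proof.
move=> vK; have K0 : 0 <= K by exact: le_trans (vK 0%N).
apply: (@djet_rsum _ _ (fun n J x => v n * a n J x) (fun J n => K * D J * w n) (fun J => K * D
  J * W)).
- by move=> n; exact: djetZ.
- move=> n J x; rewrite normrM -mulrA; apply: ler_pM => //.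
  apply: le_trans (aB n J x) _; rewrite ler_piMr ?mulr_ge0//.
  by rewrite -[leRHS]expR0 ler_expR oppr_le0 mulr_ge0 ?powR_ge0 ?(ltW c0).
- move=> J; have := abs_boundedZ (K * D J) wW; rewrite ger0_norm//.
  by rewrite mulr_ge0.
Qed.

Lemma superpose_lin b u v K K' J x : (forall n, `|u n| <= K) -> (forall n, `|v n| <= K') ->
  superpose (fun n => b * u n + v n) J x = b * superpose u J x + superpose v J x.
Proof.
move=> uK vK; have B1 := superpose_abs_bounded J x uK; have B2 := superpose_abs_bounded J x vK.
rewrite /superpose -(rsumZ b B1) -(rsumD (abs_boundedZ b B1) B2).
by congr rsum; apply/funext => n; ring.
Qed.

(** Dominated convergence against a bounded k, which will be the cosine or sine of a phase, or 1 for
    integrability. *)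
Lemma superpose_rint v K (k : d.-tuple RT -> R) : (forall n, `|v n| <= K) ->
  (forall n, measurable_fun setT (fun t => a n [::] (row_of t))) ->
  measurable_fun setT k -> (forall t, `|k t| <= 1) ->
  rintegrable mu (fun t => superpose v [::] (row_of t)) /\
  (fun N => \sum_(n < N) v n * rint mu (fun t => a n [::] (row_of t) * k t)) @ \oo -->
    rint mu (fun t => superpose v [::] (row_of t) * k t).
Proof.
move=> vK ma mk k1; have K0 : 0 <= K by exact: le_trans (vK 0%N).
have W0 := abs_bounded_ge0 wW.
have [h Ih Hh] := subexp_rintegrable d0 c0 e0.
have Ia n : rintegrable mu (fun t => a n [::] (row_of t)).
  apply: (le_rintegrable (ma n) _ (rintegrableZ (D [::] * w n) Ih)) => t.
  by apply: le_trans (aB _ _ _) _; rewrite ler_wpM2l// mulr_ge0.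
have dom (l : d.-tuple RT -> R) : measurable_fun setT l -> (forall t, `|l t| <= 1) ->
    rintegrable mu (fun t => superpose v [::] (row_of t) * l t) /\
    (fun N => rint mu (fun t => \sum_(n < N) v n * (a n [::] (row_of t) * l t))) @ \oo -->
    rint mu (fun t => superpose v [::] (row_of t) * l t).
  move=> ml l1; have Il n : rintegrable mu (fun t => a n [::] (row_of t) * l t).
    exact: (rintegrableM (Ia n) ml l1).
  apply: (rdominated (g := fun t => K * D [::] * W * h t)).
  - by move=> N; have [/rintegrable_measurable] := rint_sum v N Il.
  - move=> t; under eq_fun do (under eq_bigr do rewrite mulrA; rewrite -mulr_suml).
    by apply: cvgMr_tmp; exact: rsum_cvg (superpose_abs_bounded [::] (row_of t) vK).
  - move=> N t; under eq_bigr do rewrite mulrA.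
    rewrite -mulr_suml normrM -[leRHS]mulr1; apply: ler_pM => //.
    apply: le_trans (ler_norm_sum _ _ _) _.
    apply: le_trans (superpose_abs_bounded [::] (row_of t) vK N) _.
    by rewrite ler_wpM2l// !mulr_ge0.
  - exact: rintegrableZ.
have [_ cv] := dom k mk k1; split.
  have n1 : `|1 : R| <= 1 by rewrite normr1.
  have [+ _] := dom (fun=> 1) (measurable_cst _) (fun=> n1).
  by under eq_fun do rewrite mulr1.
have E N : rint mu (fun t => \sum_(n < N) v n * (a n [::] (row_of t) * k t)) =
    \sum_(n < N) v n * rint mu (fun t => a n [::] (row_of t) * k t).
  by have [_ ->] := rint_sum v N (fun n => rintegrableM (Ia n) mk k1).
by move: cv; under eq_fun do rewrite E.
Qed.

End superposition.

(** * Decay of the atoms and choice of their coefficients *)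

Section atoms.
Variables (R : realType) (d : nat) (rho eta : R).
Hypotheses (rho0 : 0 < rho) (rho_eta : rho < eta) (eta1 : eta <= 1).
Implicit Types p x : 'rV[R]_d.

Lemma eta_gt0 : 0 < eta. Proof. exact: lt_trans rho_eta. Qed.

(** A derivative of order k costs r^k, which is at most K^k exp(kB|p|^rho). Since rho < eta, half of
    tau|p|^eta absorbs this together with exp(L0|p|^rho). The other half joins c|x - p|^eta,
    available because r >= 1, and subadditivity of t^eta turns the sum into decay about the origin,
    uniformly in p. *)
Lemma atom_decay (C A c tau T L0 K B Q : R) : 0 <= C -> 1 <= A -> 0 < c -> 0 < tau ->
  1 <= K -> 0 <= B -> 0 <= Q ->
  exists2 D : seq 'I_d -> R, (forall J, 0 <= D J) &
    forall F (r q : R) p,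
      (forall J x, `|F J x| <= C * A ^+ size J * expR (- (c * eucl x `^ eta))) ->
      1 <= r -> r <= K * expR (B * eucl p `^ rho) ->
      `|q| <= Q * expR (T * eucl p `^ rho - tau * eucl p `^ eta) ->
      forall J x, `|q * djet_affine r p F J x| <=
        D J * expR (- (L0 * eucl p `^ rho)) * expR (- (Num.min (tau / 2) c * eucl x `^ eta)).
Proof.
move=> C0 A1 c0 t0 K1 B0 Q0; have e0 := eta_gt0.
have A0 : 0 <= A by exact: le_trans A1.
have K0 : 0 <= K by exact: le_trans K1.
(* The coefficient of |p|^rho to be absorbed at order k; the final 1 keeps it positive, as it serves
   as a divisor. *)
pose b (k : nat) : R := k%:R * B + `|T| + `|L0| + 1.
have b0 k : 0 < b k by rewrite ltr_wpDl// !addr_ge0// mulr_ge0.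
have /choice[E HE] : forall k, exists E, forall r, 0 <= r ->
    b k * r `^ rho <= E + tau / 2 * r `^ eta.
  move=> k; have tb : 0 < tau / 2 / b k by rewrite !divr_gt0.
  have [E E0 HE] := powR_le_eps rho0 rho_eta tb.
  exists (b k * E) => r r0; have := ler_wpM2l (ltW (b0 k)) (HE r r0).
  by rewrite mulrDr [b k * (_ / b k * _)]mulrA [b k * (_ / b k)]mulrC divfK ?gt_eqF.
exists (fun J => Q * K ^+ size J * (C * A ^+ size J) * expR (E (size J))).
  by move=> J; rewrite !mulr_ge0 ?expR_ge0 ?exprn_ge0.
move=> F r q p FB r1 rK qQ J x; set k := size J.
have r0 : 0 <= r by exact: le_trans r1.
set P := eucl p `^ rho in rK qQ *; set Y := eucl p `^ eta in qQ *.
have P0 : 0 <= P by exact: powR_ge0.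
have Y0 : 0 <= Y by exact: powR_ge0.
set X := eucl x `^ eta; set Z := eucl (x - p) `^ eta.
have XYZ : X <= Y + Z by exact: eucl_powR_diff.
have F1 : `|F J (r *: (x - p))| <= C * A ^+ k * expR (- (c * Z)).
  apply: le_trans (FB J _) _; apply: ler_wpM2l; first by rewrite mulr_ge0 ?exprn_ge0.
  rewrite ler_expR lerN2; apply: ler_wpM2l; first exact: ltW.
  apply: ge0_ler_powR; rewrite ?nnegrE ?eucl_ge0 ?(ltW e0)//.
  by rewrite euclZ ger0_norm// ler_peMl ?eucl_ge0.
have Z0 : 0 <= Z by exact: powR_ge0.
have H1 := HE k _ (eucl_ge0 p); rewrite -/P -/Y in H1.
move: P Y X Z P0 Y0 Z0 XYZ rK qQ F1 H1 => P Y X Z P0 Y0 Z0 XYZ rK qQ F1 H1.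
have F2 : r ^+ k <= K ^+ k * expR (k%:R * (B * P)).
  rewrite expRM_natl -exprMn lerXn2r ?nnegrE//.
  by rewrite mulr_ge0 ?expR_ge0.
rewrite /djet_affine -/k !normrM normrX (ger0_norm r0).
apply: le_trans (ler_pM _ _ qQ (ler_pM _ _ F2 F1)) _; rewrite ?mulr_ge0 ?exprn_ge0//.
have -> : Q * expR (T * P - tau * Y) * (K ^+ k * expR (k%:R * (B * P)) * (C * A ^+ k * expR (-
  (c * Z)))) =
  Q * K ^+ k * (C * A ^+ k) * (expR (T * P - tau * Y) * expR (k%:R * (B * P)) * expR (- (c *
    Z))).
  by ring.
rewrite -[leRHS]mulrA -[leRHS]mulrA ler_wpM2l//.
  by rewrite !mulr_ge0 ?exprn_ge0.
rewrite -!expRD ler_expR.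
have H2 : Num.min (tau / 2) c * X <= tau / 2 * Y + c * Z.
  have m0 : 0 <= Num.min (tau / 2) c by rewrite le_min (ltW c0) divr_ge0// ltW.
  apply: le_trans (ler_wpM2l m0 XYZ) _; rewrite mulrDr; apply: lerD.
    by rewrite ler_wpM2r// ge_min lexx.
  by rewrite ler_wpM2r// ge_min lexx orbT.
have H3 : (T + k%:R * B + L0) * P <= b k * P.
  rewrite ler_wpM2r// /b; have := ler_norm T; have := ler_norm L0; lra.
move: H1 H2 H3; rewrite !mulrDl; lra.
Qed.

Lemma large_scale (A sigma T : R) : 0 < A -> 0 < sigma ->
  exists K, [/\ 1 <= K, T <= K `^ eta, T <= (K * A) `^ eta & T <= K `^ sigma].
Proof.
move=> A0 s0; have e0 := eta_gt0; pose U := Num.max 1 T.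
have U1 : 1 <= U by rewrite le_max lexx.
have TU : T <= U by rewrite le_max lexx orbT.
have U0 : 0 <= U by exact: le_trans U1.
have H a K : 0 < a -> U `^ a^-1 <= K -> T <= K `^ a.
  move=> a0 UK; apply: le_trans TU _.
  have {1}-> : U = (U `^ a^-1) `^ a by rewrite -powRrM mulVf ?gt_eqF// powRr1.
  by rewrite ge0_ler_powR ?nnegrE ?(ltW a0) ?powR_ge0// (le_trans _ UK) ?powR_ge0.
have p0 a : 0 <= U `^ a by exact: powR_ge0.
have d1 : 0 <= U `^ eta^-1 / A by rewrite divr_ge0// ltW.
exists (1 + U `^ eta^-1 + U `^ eta^-1 / A + U `^ sigma^-1).
have p1 := p0 eta^-1; have p2 := p0 sigma^-1.
split.
- by rewrite -!addrA lerDl !addr_ge0.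
- by apply: H => //; lra.
- apply: H => //; rewrite -ler_pdivrMr//; lra.
- by apply: H => //; lra.
Qed.

End atoms.

Section coefficients.
Variables (R : realType) (eta : R).
Hypotheses (e0 : 0 < eta).

(** A scale r >= K lets the decay of an atom absorb the variation T|x - p|^eta of the weights at any
    distance. *)
Lemma kernel_near (c K r u T : R) : 0 <= u -> 0 <= c -> 0 <= K -> K <= r -> T <= c * K `^ eta ->
  T * u `^ eta <= c * (r * u) `^ eta.
Proof.
move=> u0 c0 K0 Kr TK; have r0 : 0 <= r by exact: le_trans Kr.
rewrite powRM// mulrA ler_wpM2r ?powR_ge0// (le_trans TK)// ler_wpM2l//.
exact: (ge0_ler_powR (ltW e0)).
Qed.

(** Half of the decay absorbs the weights as in [kernel_near]. For the other half separation gives r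
    u >= K A exp(P), hence a gain of H exp(eta P) >= H (1 + eta P). The spare exp(P) comes from
    taking B + 1 instead of B in the scale. *)
Lemma kernel_far (c K A B P r u T H : R) : 0 <= c -> 0 <= K -> 0 < A -> 0 <= P ->
  A * expR (- (B * P)) <= u -> K * expR ((B + 1) * P) <= r ->
  T <= c / 2 * K `^ eta -> H <= c / 2 * (K * A) `^ eta -> 0 <= B -> 0 <= H ->
  T * u `^ eta + H * (1 + eta * P) <= c * (r * u) `^ eta.
Proof.
move=> c0 K0 A0 P0 Au Kr TK HK B0 H0.
have c2 : 0 <= c / 2 by rewrite divr_ge0.
have u0 : 0 <= u by apply: le_trans Au; rewrite mulr_ge0 ?expR_ge0// ltW.
have Krr : K <= r.
  apply: le_trans Kr; rewrite ler_peMr// -[leLHS]expR0 ler_expR.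
  by rewrite mulr_ge0// addr_ge0.
have r0 : 0 <= r by exact: le_trans Krr.
have -> : c * (r * u) `^ eta = c / 2 * (r * u) `^ eta + c / 2 * (r * u) `^ eta.
  by rewrite -mulrDl -splitr.
apply: lerD; first exact: (@kernel_near (c / 2) K).
have KA : K * A * expR P <= r * u.
  have -> : K * A * expR P = K * expR ((B + 1) * P) * (A * expR (- (B * P))).
    rewrite mulrACA -expRD; congr (_ * expR _); ring.
  by apply: ler_pM => //; rewrite mulr_ge0 ?expR_ge0// ltW.
have KA0 : 0 <= K * A by rewrite mulr_ge0// ltW.
apply: (@le_trans _ _ (c / 2 * ((K * A) `^ eta * expR (eta * P)))).
  rewrite mulrA; apply: ler_pM => //; first by rewrite addr_ge0// mulr_ge0// ltW.
  exact: expR_ge1Dx.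
rewrite ler_wpM2l//.
have -> : (K * A) `^ eta * expR (eta * P) = (K * A * expR P) `^ eta.
  by rewrite [RHS]powRM ?expR_ge0// [eta * P]mulrC expRM.
by apply: (ge0_ler_powR (ltW e0)); rewrite // nnegrE;
  [exact: mulr_ge0 (expR_ge0 _)|exact: mulr_ge0].
Qed.

Lemma powR_le1D (rho u : R) : 0 < rho -> rho < eta -> 0 <= u -> u `^ rho <= 1 + u `^ eta.
Proof.
move=> rho0 rho_eta u0; have [u1|u1] := leP u 1.
  rewrite (@le_trans _ _ 1)// ?lerDl ?powR_ge0//.
  have := ge0_ler_powR (ltW rho0) u0 ler01 u1; rewrite powR1; exact.
by rewrite (@le_trans _ _ (u `^ eta))// ?lerDr// ler_powR// ltW.
Qed.

Lemma mulr_expN_le (M H e : R) : 0 < e -> 0 <= M -> M / e <= H -> M * expR (- H) <= e.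
Proof.
move=> ep M0 MH; rewrite expRN ler_pdivrMr ?expR_gt0// -ler_pdivrMl//.
apply: le_trans (expR_ge1Dx H); rewrite mulrC; apply: le_trans MH _; lra.
Qed.

End coefficients.

(* The Boolean distinguishes the two kinds of points: [false] for prescribed
   values, [true] for prescribed values of the fractional Laplacian.  The scale
   of the first kind is fixed before W, and that of the second kind after W. *)
Lemma node_coefficients (R : realType) (d : nat) (rho eta s tau A B L0 eps C c gam G0 : R) :
  0 < rho -> rho < eta -> eta <= 1 -> 0 < s -> 0 < tau ->
  0 < A -> 0 <= B -> 0 < L0 -> 0 < eps ->
  0 < C -> 0 < c -> 0 < gam -> 2^-1 <= G0 ->
  exists (L W K B' Q T : R) (r qa qb hi : bool -> 'rV[R]_d -> R),
  [/\ [/\ 0 < L, 1 <= W, 1 <= K, 0 <= B' & 0 <= Q],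
      forall k p, 1 <= r k p /\ r k p <= K * expR (B' * eucl p `^ rho),
      forall k p, qb k p = qa k p * (gam * r k p `^ (2 * s)) /\
        let: b := (Q * expR (T * eucl p `^ rho - tau * eucl p `^ eta))%R in
        `|qa k p| <= b /\ `|qb k p| <= b,
      forall p, [/\ hi false p * qa false p = 1, hi true p * (qb true p * G0) = 1,
        hi false p = W * expR (tau * eucl p `^ eta + L * eucl p `^ rho) &
        hi true p = expR (tau * eucl p `^ eta)] &
      forall k l p x t, (k = l -> A * expR (- (B * eucl p `^ rho)) <= eucl (x - p)) ->
        `|t| <= C * expR (- (c * (r l p * eucl (x - p)) `^ eta)) ->
        `|hi k x * ((if k then qb l p else qa l p) * t)| <= eps * expR (- (L0 * eucl p `^
          rho))].
Proof.
move=> rho0 rho_eta eta1 s0 tau0 A0 B0 L00 ep C0 c0 g0 G1.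
have e0 : 0 < eta by exact: lt_trans rho_eta.
have G00 : 0 < G0 by apply: lt_le_trans G1; rewrite invr_gt0.
have s2 : 0 < 2 * s by rewrite mulr_gt0.
pose B1 := B + 1.
(* The weight exp(-L P) of an atom of the first kind pays for the factor exp(2 s B1 P) in r^(2s) and
   still leaves exp(-L0 P) for summability. *)
have [L LE] : exists L, L = 2 * s * B1 + L0 by exists (2 * s * B1 + L0).
have L_gt0 : 0 < L by rewrite LE ltr_wpDl// mulr_ge0// ?addr_ge0// ltW.
(* H rules the interaction within one set: H eta P covers L0 P, and exp(-H) brings the constants
   below eps. *)
have [H [H0 HL HE]] : exists H, [/\ 0 <= H, L0 <= H * eta & 2 * C * expR L / eps <= H].
  exists (L0 / eta + 2 * C * expR L / eps).
  have h1 : 0 <= L0 / eta by rewrite divr_ge0// ltW.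
  have h2 : 0 <= 2 * C * expR L / eps by rewrite !mulr_ge0 ?expR_ge0 ?invr_ge0// ltW.
  split; [exact: addr_ge0| |by rewrite lerDr].
  by rewrite mulrDl divfK ?gt_eqF// lerDl mulr_ge0// ltW.
have c20 : 0 < c / 2 by rewrite divr_gt0.
have scale T0 : exists K, [/\ 1 <= K, tau + L <= c / 2 * K `^ eta, H <= c / 2 * (K * A) `^ eta &
    T0 <= K `^ (2 * s)].
  have [K [K1 h1 h2 h3]] := large_scale rho0 rho_eta ((tau + L + H) / (c / 2) + `|T0|) A0 s2.
  have n0 := normr_ge0 T0; have tL : 0 <= tau + L by rewrite addr_ge0 ?ltW.
  have q0 : 0 <= (tau + L + H) / (c / 2) by rewrite divr_ge0 ?addr_ge0// ltW.
  exists K; split => //.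
  - rewrite mulrC -ler_pdivrMr//; apply: le_trans h1.
    apply: (@le_trans _ _ ((tau + L + H) / (c / 2))); last by rewrite lerDl.
    by rewrite ler_wpM2r ?invr_ge0 ?(ltW c20)// lerDl.
  - rewrite mulrC -ler_pdivrMr//; apply: le_trans h2.
    apply: (@le_trans _ _ ((tau + L + H) / (c / 2))); last by rewrite lerDl.
    by rewrite ler_wpM2r ?invr_ge0 ?(ltW c20)// lerDr.
  - apply: le_trans h3; apply: le_trans (ler_norm T0) _; by rewrite lerDr.
have [K1 [K1_1 K1a K1b _]] := scale 0.
have K10 : 0 < K1 by apply: lt_le_trans K1_1.
have [k1 k10 k1E] : exists2 k1, 0 < k1 & k1 = K1 `^ (2 * s) by exists (K1 `^ (2 * s)) => //;
  exact: powR_gt0.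
(* Dividing the atoms of the first kind by W makes their effect on the second kind of equations
   smaller than eps. The price is a factor W in the opposite direction, which K2^(2s) compensates
   below. *)
have [W W1 WE] : exists2 W, 1 <= W & gam * k1 * C / eps <= W.
  have h : 0 <= gam * k1 * C / eps by rewrite !mulr_ge0 ?invr_ge0// ltW.
  by exists (1 + gam * k1 * C / eps); rewrite ?lerDl ?lerDr.
have W0 : 0 < W by apply: lt_le_trans W1.
have [K2 [K2_1 K2a K2b K2c]] := scale (W * C * expR L / (eps * gam * G0)).
have K20 : 0 < K2 by apply: lt_le_trans K2_1.
have [k2 k20 k2E] : exists2 k2, 0 < k2 & k2 = K2 `^ (2 * s) by exists (K2 `^ (2 * s)) => //;
  exact: powR_gt0.
rewrite -k2E in K2c.
(* The second scale grows fast enough for r^(-2s) to beat the weight exp(L P) of the first kind of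
   equations and still leave exp(-L0 P). *)
have [B2 B2B B2E] : exists2 B2, B + 1 <= B2 & L + L0 <= 2 * s * B2.
  have h : 0 <= (L + L0) / (2 * s) by rewrite divr_ge0 ?addr_ge0// ltW.
  exists (B + 1 + (L + L0) / (2 * s)); first by rewrite lerDl.
  rewrite mulrDr [_ * (_ / _)]mulrC divfK ?gt_eqF// lerDr mulr_ge0 ?addr_ge0//; exact: ltW.
have B20 : 0 <= B2 by apply: le_trans B2B; rewrite addr_ge0.
pose P (p : 'rV[R]_d) := eucl p `^ rho; pose Y (p : 'rV[R]_d) := eucl p `^ eta.
have P0 p : 0 <= P p by exact: powR_ge0.
have Y0 p : 0 <= Y p by exact: powR_ge0.
pose r (k : bool) p := if k then K2 * expR (B2 * P p) else K1 * expR (B1 * P p).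
(* [qa] goes with phi and [qb] with G; their ratio gam r^(2s) is imposed by the fractional
   Laplacian. For each kind the prescribed quantity fixes the normalisation and [hi] inverts it on
   the diagonal. *)
pose qa (k : bool) p := if k then expR (- (tau * Y p) - 2 * s * B2 * P p) / (k2 * gam * G0)
                        else W^-1 * expR (- (tau * Y p) - L * P p).
pose qb (k : bool) p := if k then expR (- (tau * Y p)) / G0
                        else W^-1 * gam * k1 * expR (- (tau * Y p) - L0 * P p).
pose hi (k : bool) p := if k then expR (tau * Y p) else W * expR (tau * Y p + L * P p).
exists L, W, (K1 + K2), (B1 + B2), ((k2 * gam * G0)^-1 + W^-1 + G0^-1 + W^-1 * gam * k1), 0,
  r, qa, qb, hi.
have rP k p : 1 <= r k p /\ r k p <= (K1 + K2) * expR ((B1 + B2) * P p).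
  have w (K B' : R) : 1 <= K -> 0 <= B' -> K <= K1 + K2 -> B' <= B1 + B2 ->
      1 <= K * expR (B' * P p) /\ K * expR (B' * P p) <= (K1 + K2) * expR ((B1 + B2) * P p).
    move=> K_1 B'0 KK BB; split.
      by apply: mulr_ege1 => //; rewrite -[leLHS]expR0 ler_expR mulr_ge0.
    apply: ler_pM => //; first exact: le_trans K_1.
    by rewrite ler_expR ler_wpM2r.
  have B10 : 0 <= B1 by exact: addr_ge0.
  by rewrite /r; case: k; apply: w; rewrite // ?lerDl ?lerDr ?(ltW K10) ?(ltW K20).
have r2s k p : r k p `^ (2 * s) = if k then k2 * expR (2 * s * B2 * P p) else k1 * expR (2 * s
  * B1 * P p).
  by rewrite /r; case: k; rewrite powRM ?expR_ge0 ?ltW// -?k1E -?k2E -expRM;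
    congr (_ * expR _); ring.
have W_1 : 0 < W^-1 by rewrite invr_gt0.
have kg0 : 0 < k2 * gam * G0 by rewrite !mulr_gt0.
have kg1 : 0 < (k2 * gam * G0)^-1 by rewrite invr_gt0.
have G01 : 0 < G0^-1 by rewrite invr_gt0.
have Wgk : 0 < W^-1 * gam * k1 by rewrite !mulr_gt0.
have bnd M x (z : R) p : 0 <= M -> M <= (k2 * gam * G0)^-1 + W^-1 + G0^-1 + W^-1 * gam * k1 ->
    0 <= x -> z = M * expR (- (tau * Y p) - x * P p) ->
    `|z| <= ((k2 * gam * G0)^-1 + W^-1 + G0^-1 + W^-1 * gam * k1) * expR (0 * P p - tau * Y p).
  move=> M0 MQ x0 ->; rewrite ger0_norm ?mulr_ge0 ?expR_ge0//.
  apply: ler_pM => //; rewrite ?expR_ge0// ler_expR mul0r add0r gerBl.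
  exact: mulr_ge0.
split.
- split => //; first by apply: le_trans K1_1 _; rewrite lerDl ltW.
    by rewrite addr_ge0// /B1 addr_ge0.
  by move: kg1 W_1 G01 Wgk; clear; lra.
- exact: rP.
- move=> k p; split.
    rewrite r2s /qa /qb; case: k.
      rewrite [expR (- (tau * Y p) - _)]expRD [expR (- (2 * s * B2 * P p))]expRN.
      by field; rewrite !gt_eqF ?expR_gt0.
    have -> : expR (- (tau * Y p) - L0 * P p) = expR (- (tau * Y p) - L * P p) * expR (2 * s *
      B1 * P p).
      by rewrite -expRD LE; congr expR; ring.
    ring.
  split; rewrite /qa /qb; case: k.
  + apply: (bnd (k2 * gam * G0)^-1 (2 * s * B2)); rewrite ?(ltW kg1) ?mulr_ge0 ?(ltW s0)//.
      by move: kg1 W_1 G01 Wgk; clear; lra.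
    by rewrite mulrC.
  + by apply: (bnd W^-1 L); rewrite ?(ltW W_1) ?(ltW L_gt0)//; move: kg1 W_1 G01 Wgk; clear;
    lra.
  + apply: (bnd G0^-1 0); rewrite ?(ltW G01)//; first by move: kg1 W_1 G01 Wgk; clear; lra.
    by rewrite mul0r subr0 mulrC.
  + by apply: (bnd (W^-1 * gam * k1) L0); rewrite ?(ltW Wgk) ?(ltW L00)//;
    move: kg1 W_1 G01 Wgk; clear; lra.
- move=> p; split => //; rewrite /hi /qa /qb.
    rewrite mulrACA divff ?gt_eqF// mul1r -expRD -[RHS]expR0; congr expR; ring.
  by rewrite divfK ?gt_eqF// -expRD subrr expR0.
- move=> k l p x t near tB.
  have YY : Y x <= Y p + eucl (x - p) `^ eta by exact: eucl_powR_diff.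
  (* The power rho of the distance is traded for the power eta by u^rho <= 1 + u^eta; the constant 1
     is the origin of the factors exp(L). *)
  have PP : P x <= P p + (1 + eucl (x - p) `^ eta).
    apply: le_trans (eucl_powR_diff _ p rho0 (ltW (lt_le_trans rho_eta eta1))) _.
    by rewrite lerD2l powR_le1D// eucl_ge0.
  set u := eucl (x - p) in near tB YY PP *; set U := u `^ eta in YY PP *.
  have u0 : 0 <= u by exact: eucl_ge0.
  have U0 : 0 <= U by exact: powR_ge0.
  set V := (r l p * u) `^ eta in tB *.
  have V_far : k = l -> (tau + L) * U + H * (1 + eta * P p) <= c * V.
    move=> kl; have := near kl; rewrite -/(P p) => Au.
    rewrite /V /r; case: (l).
      apply: (@kernel_far _ eta e0 c K2 A B) => //; [exact: ltW|exact: ltW|].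
      by rewrite ler_wpM2l ?(ltW K20)// ler_expR ler_wpM2r.
    by apply: (@kernel_far _ eta e0 c K1 A B) => //; exact: ltW.
  have V_near : (tau + L) * U <= c * V.
    have cc : c / 2 <= c by rewrite ler_pdivrMr// ler_peMr ?(ltW c0)// ler1n.
    have [K [K0 Kr Ka]] : exists K, [/\ 0 <= K, K <= r l p & tau + L <= c / 2 * K `^ eta].
      have ex1 (b : R) : 0 <= b -> 1 <= expR (b * P p).
        by move=> b0; rewrite -[leLHS]expR0 ler_expR mulr_ge0.
      rewrite /r; case: (l).
        by exists K2; split; rewrite ?ler_peMr ?ex1// ltW.
      by exists K1; split; rewrite ?ler_peMr ?ex1 ?addr_ge0// ltW.
    by apply: (kernel_near e0 u0 (ltW c0) K0 Kr); apply: le_trans Ka _;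
      rewrite ler_wpM2r ?powR_ge0.
  (* All four interactions are a constant times an exponential times the decay of the template;
     exponent and constant are then estimated separately. *)
  have fin (M N E1 E2 : R) : 0 <= N -> 0 <= M -> N = M * expR E1 -> E1 - c * V <= E2 - L0 * P
    p ->
      M * C * expR E2 <= eps -> `|N * t| <= eps * expR (- (L0 * P p)).
    move=> N0 M0 NE EE ME; rewrite normrM (ger0_norm N0).
    apply: le_trans (ler_wpM2l N0 tB) _; rewrite NE.
    have -> : M * expR E1 * (C * expR (- (c * V))) = M * C * expR (E1 - c * V).
      by rewrite expRD; ring.
    apply: (@le_trans _ _ (M * C * expR E2 * expR (- (L0 * P p)))).
      rewrite -[leRHS]mulrA -expRD ler_wpM2l ?mulr_ge0 ?(ltW C0)//.
      by rewrite ler_expR.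
    by rewrite ler_wpM2r ?expR_ge0.
  have HP : L0 * P p <= H * eta * P p by rewrite ler_wpM2r.
  have {}V_near : tau * U + L * U <= c * V by rewrite -mulrDl.
  have {}V_far : k = l -> tau * U + L * U + (H + H * eta * P p) <= c * V.
    by move=> /V_far; rewrite mulrDl mulrDr mulr1 mulrA.
  have t1 : tau * Y x <= tau * Y p + tau * U by rewrite -mulrDr ler_wpM2l ?(ltW tau0).
  have t2 : L * P x <= L * P p + (L + L * U).
    by rewrite -{3}[L]mulr1 -!mulrDr; apply: ler_wpM2l => //; exact: ltW.
  have tU : 0 <= L * U by rewrite mulr_ge0 ?(ltW L_gt0).
  have B2P : L * P p + L0 * P p <= 2 * s * B2 * P p.
    by rewrite -mulrDl; exact: ler_wpM2r (P0 p) _ _ B2E.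
  have N0 : 0 <= hi k x by rewrite /hi; case: (k); rewrite ?mulr_ge0 ?expR_ge0 ?(ltW W0).
  have eL : 1 <= expR L by rewrite -[leLHS]expR0 ler_expR ltW.
  move: V tB V_far V_near fin => V tB V_far V_near fin.
  rewrite mulrA; clear r2s rP bnd scale near tB; case: k l V_far N0 => [] [] V_far N0.
  (* The cases, as equation and atom: second and second, small by separation; second and first,
     small by W; first and second, small by K2; first and first, small by separation. *)
  + apply: (fin G0^-1 _ (tau * Y x - tau * Y p) (- H)).
    * by rewrite mulr_ge0 // /qb mulr_ge0 ?expR_ge0 ?(ltW G01).
    * exact: ltW.
    * by rewrite /hi /qb expRD; ring.
    * by move: (V_far erefl) t1 HP tU; clear; lra.
    * apply: mulr_expN_le => //; first by rewrite mulr_ge0 ?(ltW G01) ?(ltW C0).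
      apply: le_trans HE; rewrite ler_wpM2r ?invr_ge0 ?(ltW ep)//.
      apply: (@le_trans _ _ (2 * C)); last by rewrite ler_peMr ?mulr_ge0 ?(ltW C0).
      by rewrite ler_wpM2r ?(ltW C0)// -[leRHS]invrK lef_pV2 ?posrE ?invr_gt0.
  + apply: (fin (W^-1 * gam * k1) _ (tau * Y x - tau * Y p - L0 * P p) 0).
    * by rewrite mulr_ge0 // /qb mulr_ge0 ?expR_ge0 ?(ltW Wgk).
    * exact: ltW.
    * by rewrite /hi /qb !expRD; ring.
    * by move: V_near t1 tU; clear; lra.
    * rewrite expR0 mulr1; have := WE; rewrite ler_pdivrMr// => h.
      by rewrite -!mulrA ler_pdivrMl// mulrA.
  + apply: (fin (W / (k2 * gam * G0)) _ (tau * Y x + L * P x - tau * Y p - 2 * s * B2 * P p) L).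
    * by rewrite mulr_ge0 // /qa mulr_ge0 ?expR_ge0 ?(ltW kg1).
    * by rewrite mulr_ge0 ?(ltW W0) ?(ltW kg1).
    * by rewrite /hi /qa !expRD; ring.
    * by move: V_near t1 t2 B2P; clear; lra.
    * move: K2c; rewrite ler_pdivrMr ?mulr_gt0// => h.
      have -> : W / (k2 * gam * G0) * C * expR L = W * C * expR L / (k2 * gam * G0) by ring.
      by rewrite ler_pdivrMr//; apply: le_trans h _; rewrite le_eqVlt; apply/orP; left;
        apply/eqP; ring.
  + apply: (fin 1 _ (tau * Y x + L * P x - tau * Y p - L * P p) (L - H)).
    * by rewrite mulr_ge0 // /qa mulr_ge0 ?expR_ge0 ?(ltW W_1).
    * exact: ler01.
    * rewrite /hi /qa !expRD; field; rewrite gt_eqF//.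
    * by move: (V_far erefl) t1 t2 HP; clear; lra.
    * rewrite mul1r expRD mulrA; apply: mulr_expN_le => //.
        by rewrite mulr_ge0 ?expR_ge0// ltW.
      apply: le_trans HE; rewrite ler_wpM2r ?invr_ge0 ?(ltW ep)//.
      by rewrite -mulrA ler_peMl ?ler1n// mulr_ge0 ?expR_ge0 ?(ltW C0).
Qed.

(** * Interpolation of real data *)

Section real_interpolation.
Variables (R : realType) (d : nat).
Local Notation mu := (@lebesgue_tuple R d).
Implicit Types (x p xi : 'rV[R]_d) (J : seq 'I_d).

Definition frequency xi (i : 'I_d) : R := 2 * pi * xi ord0 i.

(** The constant (4 pi^2 g)^(-s) removes g and the passage to angular frequencies, and r^(2s) undoes
    the scaling of the template. *)
Lemma lap_symbol_frequency (g s r : R) xi : 0 < g -> 0 < s -> 0 < r ->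
  ((4 * pi ^+ 2 * g) `^ s)^-1 * r `^ (2 * s) * lap_symbol g s r (frequency xi) = eucl xi `^ (2
    * s).
Proof.
move=> g0 s0 r0; have p0 : 0 < 4 * pi ^+ 2 * g :> R by rewrite !mulr_gt0 ?exprn_gt0 ?pi_gt0.
have sq (z : R) : 0 <= z -> z `^ (2 * s) = (z ^+ 2) `^ s by move=> z0;
  rewrite powRrM powR_mulrn.
rewrite !sq ?(ltW r0) ?eucl_ge0//.
have -> : lap_symbol g s r (frequency xi) = (4 * pi ^+ 2 * g * eucl xi ^+ 2 / r ^+ 2) `^ s.
  rewrite /lap_symbol sqr_eucl; congr (_ `^ s); congr (_ / _).
  rewrite [4 * _ * g]mulrC -mulrA; congr (_ * _); rewrite mulr_sumr.
  by apply: eq_bigr => i _; rewrite /frequency; ring.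
have r2 : 0 < r ^+ 2 by rewrite exprn_gt0.
have e2 : 0 <= eucl xi ^+ 2 by rewrite exprn_ge0 ?eucl_ge0.
have q0 : 0 <= 4 * pi ^+ 2 * g * eucl xi ^+ 2 / r ^+ 2.
  by apply: divr_ge0 (ltW r2); exact: mulr_ge0 (ltW p0) e2.
rewrite -mulrA -(powRM _ (ltW r2) q0).
rewrite [r ^+ 2 * _]mulrC divfK ?gt_eqF// (powRM _ (ltW p0) e2).
by rewrite mulKf// gt_eqF// powR_gt0.
Qed.

Lemma scaled_rintegrable (F : 'rV[R]_d -> R) (C c eta r : R) p : (0 < d)%N ->
  0 <= C -> 0 < c -> 0 < eta -> eta <= 1 -> 1 <= r ->
  (forall x, `|F x| <= C * expR (- (c * eucl x `^ eta))) ->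
  measurable_fun setT (fun t => F (r *: (row_of t - p))) ->
  rintegrable mu (fun t => F (r *: (row_of t - p))).
Proof.
move=> d0 C0 c0 e0 e1 r1 FC mF; have [h Ih Hh] := subexp_rintegrable d0 c0 e0.
apply: (le_rintegrable mF _ (rintegrableZ (C * expR (c * eucl p `^ eta)) Ih)) => t.
apply: le_trans (FC _) _; rewrite -mulrA ler_wpM2l//.
apply: (@le_trans _ _ (expR (c * eucl p `^ eta) * expR (- (c * eucl (row_of t) `^ eta)))).
  rewrite -expRD ler_expR -mulrBr -mulrN ler_wpM2l ?(ltW c0)//.
  have h1 := eucl_powR_diff (row_of t) p e0 e1.
  have h2 : eucl (row_of t - p) `^ eta <= eucl (r *: (row_of t - p)) `^ eta.
    apply: (ge0_ler_powR (ltW e0)); rewrite ?nnegrE ?eucl_ge0//.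
    by rewrite euclZ ger0_norm ?(le_trans ler01 r1)// ler_peMl ?eucl_ge0.
  rewrite lerNl opprB lerBlDl; apply: (le_trans h1); rewrite lerD2l; exact: h2.
by rewrite ler_wpM2l ?expR_ge0.
Qed.

Variables (rho eta s tau : R) (Lam M : set 'rV[R]_d).

(** Data are functions on the whole space constrained only on the two sets, and an explicit K
    replaces the norm, so linear combinations need no suprema. *)
Definition bounded_data (L K : R) (al be : 'rV[R]_d -> R) :=
  [/\ 0 <= K,
      forall x, Lam x -> expR (tau * eucl x `^ eta + L * eucl x `^ rho) * `|al x| <= K &
      forall x, M x -> expR (tau * eucl x `^ eta) * `|be x| <= K].

(** [f false] is the interpolant and [f true] its fractional Laplacian. Both sums use the same
    solution of the linear system, with atoms built from phi and from G, so the Fourier relation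
    holds atom by atom and survives summation. *)
Lemma real_interpolation : (0 < d)%N -> 0 < rho -> rho < eta -> eta < 1 -> 0 < s -> 0 < tau ->
  rho_separated rho Lam -> rho_separated rho M ->
  exists (L c : R) (D : seq 'I_d -> R)
    (f : bool -> ('rV[R]_d -> R) -> ('rV[R]_d -> R) -> seq 'I_d -> 'rV[R]_d -> R),
  [/\ 0 < L /\ 0 < c,
      forall K al be k, bounded_data L K al be ->
        [/\ djet (f k al be),
            forall J x, `|f k al be J x| <= D J * K * expR (- (c * eucl x `^ eta)) &
            rintegrable mu (fun t => f k al be [::] (row_of t))],
      forall K al be, bounded_data L K al be ->
        (forall x, Lam x -> f false al be [::] x = al x) /\
        (forall x, M x -> f true al be [::] x = be x),
      forall K al be xi, bounded_data L K al be -> forall tr, tr = cos \/ tr = sin ->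
        rint mu (fun t => f true al be [::] (row_of t) * tr (phase (frequency xi) t)) =
        eucl xi `^ (2 * s) * rint mu (fun t => f false al be [::] (row_of t) * tr (phase
          (frequency xi) t)) &
      forall a K al be K' al' be' k, bounded_data L K al be -> bounded_data L K' al' be' ->
        forall J x, f k (fun x => a * al x + al' x) (fun x => a * be x + be' x) J x =
          a * f k al be J x + f k al' be' J x].
Proof.
move=> d0 rho0 rho_eta eta1 s0 tau0 sL sM; have e0 : 0 < eta by exact: lt_trans rho_eta.
have [phi [G [A [C [c [g [[A1 C1 c0 g0] [jphi jG] tB [phi0 G0] tF]]]]]]] := template_exists d0
  e0 eta1 s0.
have [act [pt [A' [B [L0 [Z [[A'0 B0 L00 Z0] mem surj sep wZ]]]]]]] :=
  separated_nodes d0 rho0 (ltW (lt_trans rho_eta eta1)) sL sM.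
have C0 : 0 < C by apply: lt_le_trans C1.
pose gam : R := ((4 * pi ^+ 2 * g) `^ s)^-1.
have gam0 : 0 < gam by rewrite invr_gt0 powR_gt0// !mulr_gt0 ?exprn_gt0 ?pi_gt0.
(* Z bounds the sum of the weights, so the rows of the system have absolute sum at most eps Z =
   1/2. *)
pose eps := (2 * Z)^-1; have eps0 : 0 < eps by rewrite invr_gt0 mulr_gt0.
have [L [W [K0 [B' [Q [T [r [qa [qb [hi [[L_gt0 W1 K1 B'0 Q0] rP qP hiP off]]]]]]]]]]] :=
  @node_coefficients R d rho eta s tau A' B L0 eps C c gam (G [::] 0)
   rho0 rho_eta (ltW eta1) s0 tau0 A'0 (ltW B0) L00 eps0 C0 c0 gam0 G0.
have [D D0 HD] := atom_decay d rho0 rho_eta (ltW eta1) T L0 (ltW C0) A1 c0 tau0 K1 B'0 Q0.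
have [c' c'0 c'E] : exists2 c', 0 < c' & Num.min (tau / 2) c = c'.
  by exists (Num.min (tau / 2) c) => //; rewrite lt_min c0 divr_gt0.
rewrite c'E in HD.
pose F (k : bool) := if k then G else phi.
pose q (k : bool) n := (if k then qb else qa) (odd n) (pt n).
pose rn n := r (odd n) (pt n).
pose atom k n J x := (act n)%:R * (q k n * djet_affine (rn n) (pt n) (F k) J x).
pose w n := (act n)%:R * expR (- (L0 * eucl (pt n) `^ rho)).
have w0 n : 0 <= w n by rewrite mulr_ge0 ?expR_ge0.
have rn1 n : 1 <= rn n by have [] := rP (odd n) (pt n).
have jF k : djet (F k) by case: k.
have FB k J x : `|F k J x| <= C * A ^+ size J * expR (- (c * eucl x `^ eta)).
  by have [h1 h2] := tB J x; case: k.
have atom_djet k n : djet (atom k n).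
  by apply: djetZ; apply: djetZ; exact: djet_affineP.
have atomB k n J x : `|atom k n J x| <= D J * w n * expR (- (c' * eucl x `^ eta)).
  have [r1 r2] := rP (odd n) (pt n); have [_ [q1 q2]] := qP (odd n) (pt n).
  have qQ : `|q k n| <= Q * expR (T * eucl (pt n) `^ rho - tau * eucl (pt n) `^ eta).
    by rewrite /q; case: k.
  have := HD (F k) (rn n) (q k n) (pt n) (FB k) r1 r2 qQ J x.
  move=> h; rewrite /atom normrM (ger0_norm (ler0n R (act n))) /w.
  apply: le_trans (ler_wpM2l (ler0n R (act n)) h) _.
  by rewrite !mulrA [(act n)%:R * D J]mulrC.
(* The diagonal is 1 by the choice of [hi], so only the rest is kept. The parity of m tells whether
   row m tests f or its fractional Laplacian; inactive indices give zero rows and columns. *)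
pose E m n := if [&& act m, act n & m != n]
  then hi (odd m) (pt m) * atom (odd m) n [::] (pt m) else 0.
have E_half m : abs_bounded (E m) 2^-1.
  have -> : 2^-1 = `|eps| * Z :> R by rewrite gtr0_norm// /eps invfM mulfVK// gt_eqF.
  apply: (abs_bounded_le (abs_boundedZ eps wZ)) => n; rewrite -/(w n) /E.
  case: ifP => [/and3P[am an mn]|_]; last by rewrite normr0 mulr_ge0// ltW.
  rewrite /w /atom an !mul1r /q /djet_affine expr0 mul1r.
  have := off (odd m) (odd n) (pt n) (pt m) (F (odd m) [::] (rn n *: (pt m - pt n))).
  rewrite (fun_if (fun h => h (odd n) (pt n))); apply.
    by move=> /sep; apply.
  apply: le_trans (FB _ _ _) _; rewrite expr0 mulr1 euclZ ger0_norm//.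
  exact: le_trans (rn1 n).
have [sol solP sol_lin] := neumann_solver E_half.
pose u (al be : 'rV[R]_d -> R) m := (act m)%:R * (hi (odd m) (pt m) * (if odd m then be (pt m)
  else al (pt m))).
have uB K al be m : bounded_data L K al be -> `|u al be m| <= W * K.
  case=> K0' HL HM; have WK : K <= W * K by rewrite ler_peMl.
  rewrite /u; case am: (act m); last by rewrite mul0r normr0 (le_trans K0').
  rewrite mul1r normrM; have := mem m am; have [_ _] := hiP (pt m).
  case: (odd m) => /= [_ ->|-> _] G_pt.
    by rewrite gtr0_norm ?expR_gt0//; apply: le_trans WK; exact: HM.
  rewrite ger0_norm; last by rewrite mulr_ge0 ?expR_ge0// (le_trans ler01).
  by rewrite -mulrA ler_wpM2l ?(le_trans ler01 W1)//; exact: HL.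
have W0 : 0 <= W by exact: le_trans W1.
have vB K al be n : bounded_data L K al be -> `|sol (u al be) n| <= 2 * (W * K).
  by move=> h; have [] := solP _ _ (fun m => uB K al be m h).
have diag m : act m -> hi (odd m) (pt m) * atom (odd m) m [::] (pt m) = 1.
  move=> am; rewrite /atom am /djet_affine /q subrr scaler0 expr0 !mul1r.
  have [h1 h2 _ _] := hiP (pt m); case: (odd m) => //=.
  by rewrite phi0 mulr1.
have interp K al be m : bounded_data L K al be -> act m ->
    superpose (atom (odd m)) (sol (u al be)) [::] (pt m) = if odd m then be (pt m) else al (pt
      m).
  move=> dB am; have vK n := vB K al be n dB.
  have B1 := superpose_abs_bounded D0 wZ (atomB (odd m)) [::] (pt m) vK.
  have [_ /(_ m)] := solP _ _ (fun n => uB K al be n dB).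
  have -> : mxact E (sol (u al be)) m = hi (odd m) (pt m) *
      rsum (fun n => if n == m then 0 else sol (u al be) n * atom (odd m) n [::] (pt m)).
    have B2 : abs_bounded (fun n => if n == m then 0 else sol (u al be) n * atom (odd m) n
      [::] (pt m))
        (2 * (W * K) * D [::] * Z * expR (- (c' * eucl (pt m) `^ eta))).
      by apply: (abs_boundedW B1) => n; case: ifP => // _; rewrite normr0.
    rewrite /mxact -(rsumZ _ B2); congr rsum; apply/funext => n.
    rewrite /E am eq_sym; case: (eqVneq n m) => [_|nm] /=; first by rewrite andbF mul0r mulr0.
    rewrite andbT; case an: (act n); first by ring.
    by rewrite /atom an !mul0r !mulr0.
  (* Once the diagonal term is split off, equation m of the system is the interpolation condition
     multiplied by [hi], which is nonzero by [hd]. *)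
  rewrite /superpose (rsumD1 m B1); set S := rsum _; rewrite {2}/u am mul1r => h.
  have hd := diag m am; have hi0 : hi (odd m) (pt m) != 0.
    by apply/eqP => h0; move: hd; rewrite h0 mul0r => /eqP; rewrite eq_sym oner_eq0.
  apply: (mulfI hi0); rewrite -h mulrDr mulrCA hd mulr1 //.
have Fm k n : measurable_fun setT (fun t => F k [::] (rn n *: (row_of t - pt n))).
  by have [h1 h2 _] := tF (rn n) (pt n) (lt_le_trans ltr01 (rn1 n)); case: k.
have atomE k n t : atom k n [::] (row_of t) = (act n)%:R * q k n * F k [::] (rn n *: (row_of t
  - pt n)).
  by rewrite /atom /djet_affine expr0 mul1r mulrA.
have atom_m k n : measurable_fun setT (fun t => atom k n [::] (row_of t)).
  under eq_fun do rewrite atomE.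
  by apply: measurable_funM => //; exact: measurable_cst.
have FI k n : rintegrable mu (fun t => F k [::] (rn n *: (row_of t - pt n))).
  apply: (@scaled_rintegrable (F k [::]) C c eta (rn n) (pt n)) => //; [exact: ltW|exact: ltW|].
  by move=> x; have := FB k [::] x; rewrite expr0 mulr1.
have n1 : `|1 : R| <= 1 by rewrite normr1.
exists L, c', (fun J => 2 * W * D J * Z), (fun k al be => superpose (atom k) (sol (u al be))).
split => //.
- move=> K al be k dB; have vK n := vB K al be n dB; split.
  + exact: (superpose_djet c'0 D0 w0 wZ (atom_djet k) (atomB k) vK).
  + move=> J x; have := superpose_norm D0 wZ (atomB k) J x vK.
    by move/le_trans; apply; rewrite le_eqVlt; apply/orP; left; apply/eqP; ring.
  + by have [] := @superpose_rint R d c' eta (atom k) D w Z d0 c'0 e0 D0 w0 wZ (atomB k) _ _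
    (fun=> 1) vK (atom_m k) (measurable_cst _) (fun=> n1).
- move=> K al be dB; split=> x xG.
    have [m [am /negbTE om mx]] := (surj.1 x xG).
    by have := interp K al be m dB am; rewrite om mx.
  have [m [am om mx]] := (surj.2 x xG).
  by have := interp K al be m dB am; rewrite om mx.
- move=> K al be xi dB tr trP; have vK n := vB K al be n dB.
  have tr1 (t : d.-tuple (measurableTypeR R)) : `|tr (phase (frequency xi) t)| <= 1.
    by case: trP => ->; [exact: norm_cos_le1|exact: norm_sin_le1].
  have trm : measurable_fun setT (fun t : d.-tuple (measurableTypeR R) => tr (phase (frequency
    xi) t)).
    have mph := measurable_phase (frequency xi).
    case: trP => ->.
      exact: (measurableT_comp (continuous_measurable (@continuous_cos R)) mph).
    exact: (measurableT_comp (continuous_measurable (@continuous_sin R)) mph).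
  (* The factor gam r^(2s) between the two coefficients cancels the dependence of the symbol on the
     scale, so all atoms share the multiplier |xi|^(2s). *)
  have rel n : rint mu (fun t => atom true n [::] (row_of t) * tr (phase (frequency xi) t)) =
      eucl xi `^ (2 * s) * rint mu (fun t => atom false n [::] (row_of t) * tr (phase
        (frequency xi) t)).
    have aE k : rint mu (fun t => atom k n [::] (row_of t) * tr (phase (frequency xi) t)) =
        (act n)%:R * q k n * rint mu (fun t => F k [::] (rn n *: (row_of t - pt n)) * tr
          (phase (frequency xi) t)).
      rewrite -rintZ; last exact: (rintegrableM (FI k n) trm tr1).
      by congr rint; apply/funext => t; rewrite atomE mulrA.
    have rn0 : 0 < rn n by exact: lt_le_trans (rn1 n).
    have [_ _ /(_ (frequency xi))[rc rs]] := tF (rn n) (pt n) rn0.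
    have Frel : rint mu (fun t => F true [::] (rn n *: (row_of t - pt n)) * tr (phase
      (frequency xi) t)) =
        lap_symbol g s (rn n) (frequency xi) *
        rint mu (fun t => F false [::] (rn n *: (row_of t - pt n)) * tr (phase (frequency xi)
          t)).
      by case: trP => ->.
    rewrite !aE Frel -(lap_symbol_frequency xi g0 s0 rn0) -/gam /q.
    have [-> _] := qP (odd n) (pt n); rewrite -/(rn n); ring.
  have [_ ca] := superpose_rint d0 c'0 e0 D0 w0 wZ (atomB false) vK (atom_m false) trm tr1.
  have [_ cb] := superpose_rint d0 c'0 e0 D0 w0 wZ (atomB true) vK (atom_m true) trm tr1.
  apply: (cvg_unique _ cb); first exact: norm_hausdorff.
  have -> : (fun N => \sum_(n < N) sol (u al be) n *
      rint mu (fun t => atom true n [::] (row_of t) * tr (phase (frequency xi) t))) =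
    (fun N => eucl xi `^ (2 * s) * \sum_(n < N) sol (u al be) n *
      rint mu (fun t => atom false n [::] (row_of t) * tr (phase (frequency xi) t))).
    by apply/funext => N; rewrite mulr_sumr; apply: eq_bigr => n _; rewrite rel mulrCA.
  exact: cvgMl_tmp ca.
- move=> a K al be K' al' be' k dB dB' J x.
  have vK n := vB K al be n dB; have vK' n := vB K' al' be' n dB'.
  rewrite -(superpose_lin D0 wZ (atomB k) a J x vK vK'); congr rsum.
  apply/funext => n; congr (_ * _).
  rewrite -(sol_lin a _ _ _ _ (fun m => uB K al be m dB) (fun m => uB K' al' be' m dB')).
  congr (sol _ n); apply/funext => m; rewrite /u.
  by case: (odd m); ring.
Qed.

End real_interpolation.

(** * Complex-valued functions and the Schwartz space *)

Section complex_jets.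
Variables (R : realType) (d : nat).
Local Notation mu := (@lebesgue_tuple R d).
Implicit Types (x xi : 'rV[R]_d) (J : seq 'I_d) (f g : seq 'I_d -> 'rV[R]_d -> R).

Definition cjet f g J x : R[i] := f J x +i* g J x.

Lemma partials_cjet f g J : djet f -> djet g -> partials J (cjet f g [::]) = cjet f g J.
Proof.
move=> jf jg; elim: J => [//|i J IH].
rewrite /partials /= -/(partials J _) IH; apply/funext => x; rewrite /partial.
have -> : re_fun (cjet f g J) = f J by [].
have -> : im_fun (cjet f g J) = g J by [].
by rewrite (@derive_val _ _ _ _ _ _ _ (jf J i x)) (@derive_val _ _ _ _ _ _ _ (jg J i x)).
Qed.

Lemma smooth_cjet f g (D : seq 'I_d -> R) : djet f -> djet g ->
  (forall J x, `|f J x| <= D J) -> (forall J x, `|g J x| <= D J) -> smooth (cjet f g [::]).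
Proof.
move=> jf jg fD gD J; rewrite partials_cjet//.
have ct h : djet h -> (forall J x, `|h J x| <= D J) -> continuous (h J).
  move=> jh hD; apply: (djet_continuous (D := \sum_i `|D (i :: J)|)) => // i x.
  apply: le_trans (hD _ _) _; rewrite (bigD1 i)//= (le_trans (ler_norm _))// lerDl.
  exact: sumr_ge0.
split; [exact: ct|exact: ct|] => i x.
by split; [exact: (@ex_derive _ _ _ _ _ _ _ (jf J i x))|exact: (@ex_derive _ _ _ _ _ _ _ (jg J
  i x))].
Qed.

Lemma cmod_le (a b c : R) : `|a| <= c -> `|b| <= c -> cmod (a +i* b)%C <= 2 * c.
Proof.
move=> ac bc; have c0 : 0 <= c by exact: le_trans ac.
rewrite /cmod /= -(ger0_norm (mulr_ge0 (ler0n R 2) c0)) -sqrtr_sqr ler_wsqrtr//.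
have h (z : R) : `|z| <= c -> z ^+ 2 <= c ^+ 2 by move=> zc;
  rewrite -[z ^+ 2]real_normK ?num_real// lerXn2r.
have := h _ ac; have := h _ bc; have := sqr_ge0 c; rewrite exprMn; lra.
Qed.

(** c is divided by k + 1, and each of the k factors 1 + |x| is absorbed by one such portion. *)
Lemma poly_subexp_le (c eta : R) (k : nat) : 0 < c -> 0 < eta ->
  exists2 C, 0 <= C & forall x : 'rV[R]_d, (1 + eucl x) ^+ k * expR (- (c * eucl x `^ eta)) <=
    C.
Proof.
move=> c0 e0; have ck : 0 < c / k.+1%:R by rewrite divr_gt0.
have [C C0 HC] := powR_le_expR ltr01 ck e0.
exists ((1 + C) ^+ k); first by rewrite exprn_ge0// addr_ge0 ?ltW.
move=> x; have u0 := eucl_ge0 x; have := HC _ u0; rewrite powRr1//.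
set w := c / k.+1%:R * eucl x `^ eta => h.
have w0 : 0 <= w by rewrite mulr_ge0 ?powR_ge0 ?(ltW ck).
have e1 : 1 <= expR w by rewrite -[leLHS]expR0 ler_expR.
have h1 : 1 + eucl x <= (1 + C) * expR w by rewrite mulrDl mul1r lerD.
apply: (@le_trans _ _ (((1 + C) * expR w) ^+ k * expR (- (c * eucl x `^ eta)))).
  by rewrite ler_wpM2r ?expR_ge0// lerXn2r// nnegrE ?addr_ge0// mulr_ge0 ?expR_ge0 ?addr_ge0
    ?ltW.
rewrite exprMn -mulrA ler_piMr ?exprn_ge0 ?addr_ge0 ?(ltW C0)//.
rewrite -expRM_natl -expRD -[leRHS]expR0 ler_expR subr_le0 /w mulrA.
rewrite ler_wpM2r ?powR_ge0// mulrA ler_pdivrMr// mulrC ler_wpM2l ?(ltW c0)// ler_nat.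
exact: leqnSn.
Qed.

Lemma subexp_le1 (c eta : R) x : 0 < c -> expR (- (c * eucl x `^ eta)) <= 1.
Proof. by move=> c0; rewrite -[leRHS]expR0 ler_expR oppr_le0 mulr_ge0 ?powR_ge0 ?ltW. Qed.

Lemma schwartz_cjet (c eta : R) (D : seq 'I_d -> R) f g : 0 < c -> 0 < eta -> djet f -> djet g
  ->
  (forall J x, `|f J x| <= D J * expR (- (c * eucl x `^ eta))) ->
  (forall J x, `|g J x| <= D J * expR (- (c * eucl x `^ eta))) ->
  is_schwartz (cjet f g [::]).
Proof.
move=> c0 e0 jf jg fD gD.
have D0 J : 0 <= D J.
  by have := le_trans (normr_ge0 _) (fD J 0); rewrite pmulr_lge0 ?expR_gt0.
have bd (h : seq 'I_d -> 'rV[R]_d -> R) : (forall J x, `|h J x| <= D J * expR (- (c * eucl x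
  `^ eta))) -> forall J x, `|h J x| <= D J.
  by move=> hD J x; apply: le_trans (hD J x) _; rewrite ler_piMr ?subexp_le1.
split; first by apply: (smooth_cjet (D := D)) => //; exact: bd.
move=> k nu; have [C C0 HC] := poly_subexp_le k c0 e0.
rewrite /schwartz_term /dmulti; set J := flatten _; exists (2 * D J * C) => _ [x _ <-].
rewrite partials_cjet//; have w0 : 0 <= (1 + eucl x) ^+ k by rewrite exprn_ge0// addr_ge0
  ?eucl_ge0.
apply: le_trans (ler_wpM2l w0 (cmod_le (fD J x) (gD J x))) _.
have -> : (1 + eucl x) ^+ k * (2 * (D J * expR (- (c * eucl x `^ eta)))) =
  2 * D J * ((1 + eucl x) ^+ k * expR (- (c * eucl x `^ eta))) by ring.
by rewrite ler_wpM2l// mulr_ge0.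
Qed.

Lemma phase_frequency xi (t : d.-tuple (measurableTypeR R)) :
  phase (frequency xi) t = 2 * pi * dotp xi (row_of t).
Proof.
rewrite /phase /dotp mulr_sumr; apply: eq_bigr => i _.
by rewrite /frequency mxE mulrA.
Qed.

Lemma fourierE (F : 'rV[R]_d -> R[i]) xi : cintegrable F ->
  let: f := fun t : d.-tuple (measurableTypeR R) => re_fun F (row_of t) in
  let: g := fun t : d.-tuple (measurableTypeR R) => im_fun F (row_of t) in
  let: ph := phase (frequency xi) in
  fourier F xi =
   ((rint mu (fun t => f t * cos (ph t)) + rint mu (fun t => g t * sin (ph t))) +i*
    (rint mu (fun t => g t * cos (ph t)) - rint mu (fun t => f t * sin (ph t))))%C.
Proof.
case=> If Ig; have [fc fs] := rintegrable_phase (frequency xi) (If : rintegrable mu _).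
have [gc gs] := rintegrable_phase (frequency xi) (Ig : rintegrable mu _).
rewrite /fourier /cintegral; congr (_ +i* _)%C.
  have := rint_comb 1 1 fc gs; rewrite !mul1r => <-; congr Rintegral; apply/funext => t.
  rewrite /re_fun /im_fun /cis -phase_frequency /phase cosN sinN.
  by case: (F (row_of t)) => a b /=; ring.
have := rint_comb 1 (-1) gc fs; rewrite !mul1r mulN1r => <-; congr Rintegral; apply/funext => t.
rewrite /re_fun /im_fun /cis -phase_frequency /phase cosN sinN.
by case: (F (row_of t)) => a b /=; ring.
Qed.

(** Two candidates have equal transforms. Combining the identities at xi and -xi separates the
    cosine and sine integrals of the real and imaginary parts, so uniqueness for real functions
    applies to each part. *)
Lemma frac_lapE (s : R) (F G : 'rV[R]_d -> R[i]) : is_frac_lap s F G -> frac_lap s F = G.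
Proof.
move=> FG; have := @xgetPex _ 0 [set g | is_frac_lap s F g] (ex_intro _ G FG).
rewrite -/(frac_lap s F); case: FG => sG IG GF /= [sH IH HF].
set H := frac_lap s F in sH IH HF *.
have E xi : fourier G xi = fourier H xi by rewrite GF HF.
have [IG1 IG2] := IG; have [IH1 IH2] := IH.
have frq (a : 'I_d -> R) : exists xi, frequency xi = a.
  exists (\row_i (a i / (2 * pi))); apply/funext => i; rewrite /frequency mxE mulrC divfK//.
  by rewrite gt_eqF// mulr_gt0// pi_gt0.
have frqN xi t : phase (frequency (- xi)) t = - phase (frequency xi) t :> R.
  by rewrite !phase_frequency /dotp -mulrN -sumrN; congr (_ * _); apply: eq_bigr => i _;
    rewrite mxE mulNr.
have parts xi (f := fun t : d.-tuple (measurableTypeR R) => re_fun G (row_of t))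
  (g := fun t : d.-tuple (measurableTypeR R) => im_fun G (row_of t))
  (f' := fun t : d.-tuple (measurableTypeR R) => re_fun H (row_of t))
  (g' := fun t : d.-tuple (measurableTypeR R) => im_fun H (row_of t)) (ph := phase (frequency
    xi)) :
  [/\ rint mu (fun t => f t * cos (ph t)) = rint mu (fun t => f' t * cos (ph t)),
      rint mu (fun t => f t * sin (ph t)) = rint mu (fun t => f' t * sin (ph t)),
      rint mu (fun t => g t * cos (ph t)) = rint mu (fun t => g' t * cos (ph t)) &
      rint mu (fun t => g t * sin (ph t)) = rint mu (fun t => g' t * sin (ph t))].
  have N (p : d.-tuple (measurableTypeR R) -> R) : rintegrable mu p ->
      rint mu (fun t => p t * cos (phase (frequency (- xi)) t)) = rint mu (fun t => p t * cos
        (ph t)) /\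
      rint mu (fun t => p t * sin (phase (frequency (- xi)) t)) = - rint mu (fun t => p t *
        sin (ph t)).
    move=> Ip; have [_ ps] := rintegrable_phase (frequency xi) Ip.
    rewrite -mulN1r -(rintZ _ ps); split; congr rint; apply/funext => t.
      by rewrite frqN cosN.
    by rewrite frqN sinN mulN1r mulrN.
  have := E xi; have := E (- xi); rewrite !fourierE//.
  have [-> ->] := N f IG1; have [-> ->] := N g IG2.
  have [-> ->] := N f' IH1; have [-> ->] := N g' IH2.
  move=> /eqP; rewrite eq_complex /= => /andP[/eqP e1 /eqP e2].
  move=> /eqP; rewrite eq_complex /= => /andP[/eqP e3 /eqP e4].
  move: e1 e2 e3 e4; rewrite -/f -/g -/f' -/g'.
  move: (rint mu _) (rint mu _) (rint mu _) (rint mu _) (rint mu _) (rint mu _) (rint mu _)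
    (rint mu _).
  by clear => *; split; lra.
have zero (p q : 'rV[R]_d -> R) : continuous p -> continuous q ->
    rintegrable mu (fun t => p (row_of t)) -> rintegrable mu (fun t => q (row_of t)) ->
    (forall xi, rint mu (fun t => p (row_of t) * cos (phase (frequency xi) t)) =
                rint mu (fun t => q (row_of t) * cos (phase (frequency xi) t)) /\
                rint mu (fun t => p (row_of t) * sin (phase (frequency xi) t)) =
                rint mu (fun t => q (row_of t) * sin (phase (frequency xi) t))) ->
    forall y, p y = q y.
  move=> cp cq Ip Iq pq y; apply/eqP; rewrite -subr_eq0; apply/eqP.
  apply: (@fourier_uniqueness R d (fun y => p y - q y)).
  - by move=> z; exact: (cvgB (cp z) (cq z)).
  - have := rintegrableD Ip (rintegrableZ (-1) Iq).
    by congr rintegrable; apply/funext => t; rewrite mulN1r.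
  - move=> a; have [xi <-] := frq a; have [e1 e2] := pq xi.
    have [pc ps] := rintegrable_phase (frequency xi) Ip.
    have [qc qs] := rintegrable_phase (frequency xi) Iq.
    have c1 := rint_comb 1 (-1) pc qc; have c2 := rint_comb 1 (-1) ps qs.
    rewrite mul1r mulN1r e1 subrr in c1; rewrite mul1r mulN1r e2 subrr in c2.
    split; [rewrite -[RHS]c1|rewrite -[RHS]c2]; congr rint; apply/funext => t;
      rewrite /phase; ring.
have [G1 G2 _] := sG [::]; have [H1 H2 _] := sH [::].
apply/funext => y.
have re_eq : re_fun G y = re_fun H y.
  by apply: zero => // xi; have [] := parts xi.
have im_eq : im_fun G y = im_fun H y.
  by apply: zero => // xi; have [] := parts xi.
by move: re_eq im_eq; rewrite /re_fun /im_fun; case: (G y) (H y) => [a b] [a' b'] /= -> ->.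
Qed.

End complex_jets.

Section schwartz_topology.
Variables (R : realType) (d : nat).
Implicit Types f g : schwartz R d.

Lemma partialsD (F G : 'rV[R]_d -> R[i]) (J : seq 'I_d) : smooth F -> smooth G ->
  partials J (F + G) = partials J F + partials J G.
Proof.
move=> sF sG; elim: J => [//|i J IH].
rewrite /partials /= -!/(partials J _) IH; apply/funext => x.
have [_ _ /(_ i x)[F1 F2]] := sF J; have [_ _ /(_ i x)[G1 G2]] := sG J.
rewrite /partial [RHS](_ : _ = partial i (partials J F) x + partial i (partials J G) x)//
  /partial.
have -> : re_fun (partials J F + partials J G) = re_fun (partials J F) + re_fun (partials J G).
  by apply/funext => y; rewrite /re_fun !fctE; case: (partials J F y) (partials J G y) => [a
    b] [a' b'].
have -> : im_fun (partials J F + partials J G) = im_fun (partials J F) + im_fun (partials J G).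
  by apply/funext => y; rewrite /im_fun !fctE; case: (partials J F y) (partials J G y) => [a
    b] [a' b'].
by rewrite !deriveD.
Qed.

Lemma schwartzP f : is_schwartz f.
Proof. by have /asboolP := schwartz_funP f. Qed.

Lemma schwartz_seminormD k nu f g :
  schwartz_seminorm k nu (f + g) <= schwartz_seminorm k nu f + schwartz_seminorm k nu g.
Proof.
have [sf bf] := schwartzP f; have [sg bg] := schwartzP g.
have w0 (x : 'rV[R]_d) : 0 <= (1 + eucl x) ^+ k by rewrite exprn_ge0// addr_ge0 ?eucl_ge0.
have t0 (h : 'rV[R]_d -> R[i]) x : 0 <= schwartz_term k nu h x by rewrite mulr_ge0 ?cmod_ge0.
apply: range_sup_le => [|x]; first by rewrite addr_ge0// range_sup_ge0.
apply: le_trans (lerD (range_supP x (bf k nu)) (range_supP x (bg k nu))).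
rewrite /schwartz_term /dmulti.
have -> : schwartz_fun (f + g) = (f : 'rV[R]_d -> R[i]) + g by [].
by rewrite partialsD// -mulrDr ler_wpM2l//; exact: cmodD.
Qed.

(** Subbasic balls may be centred anywhere; the triangle inequality for the seminorms finds in each
    a ball around Q x, and only finitely many are intersected. *)
Lemma schwartz_continuous (T : topologicalType) (Q : T -> schwartz R d) :
  (forall x k nu e, 0 < e -> \forall y \near x, schwartz_seminorm k nu (Q y - Q x) < e) ->
  continuous Q.
Proof.
move=> H x A; rewrite nbhsE => -[B [oB Bx] BA].
have [D' D'sub BE] := oB.
move: Bx; rewrite -BE => -[S D'S Sx].
have [E Esub SE] := D'sub _ D'S.
have : \forall y \near x, S (Q y).
  rewrite -SE; apply: filter_bigI => B' B'E.
  have /Esub := B'E; rewrite inE => -[f [k [nu [e [e0 B'eq]]]]].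
  have : B' (Q x) by move: Sx; rewrite -SE; apply.
  rewrite B'eq /= => fx.
  have d0 : 0 < e - schwartz_seminorm k nu (Q x - f) by rewrite subr_gt0.
  have := H x k nu _ d0; apply: filterS => y.
  rewrite ltrBrDr; apply: le_lt_trans.
  by have := schwartz_seminormD k nu (Q y - Q x) (Q x - f); rewrite addrA subrK.
apply: filterS => y Sy; apply: BA; rewrite -BE; exists S => //.
Qed.

End schwartz_topology.

Section complex_data.
Variable R : realType.

Definition component (b : bool) (z : R[i]) : R := if b then complex.Im z else complex.Re z.

Lemma component_le b z : `|component b z| <= cmod z.
Proof.
case: z => x y; rewrite /cmod /=; case: b => /=; rewrite -sqrtr_sqr ler_wsqrtr//.
  by rewrite lerDr sqr_ge0.
by rewrite lerDl sqr_ge0.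
Qed.

(** Multiplication by a complex scalar mixes the two components; in this shape complex linearity
    follows from two uses of real linearity. *)
Lemma component_lin b (a z w : R[i]) : component b (a * z + w) =
  complex.Re a * component b z + ((if b then complex.Im a else - complex.Im a) * component (~~
    b) z + component b w).
Proof. by case: a z w b => [a a'] [z z'] [w w'] [] /=; ring. Qed.

Variables (d : nat) (A : set 'rV[R]_d).

(** Extension by 0 off A turns the data into functions on the whole space, as [bounded_data]
    expects. *)
Definition extend (h : A -> R[i]) (x : 'rV[R]_d) : R[i] := oapp h 0 (insub x).

Lemma extend_val h (l : A) : extend h (val l) = h l.
Proof. by rewrite /extend valK. Qed.

Lemma extend_lin (a : R[i]) (h k : A -> R[i]) x : extend (a *: h + k) x = a * extend h x +
  extend k x.
Proof. by rewrite /extend; case: insubP => [l _ _|_] //=; rewrite mulr0 addr0. Qed.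

End complex_data.

(** * The interpolation operator for complex data *)

Theorem theorem4p7 (R : realType) (d : nat) (hd : (1 <= d)%N)
    (rho eta s : R) (hrho : 0 < rho) (hrhoeta : rho < eta) (heta : eta < 1)
    (hs : 0 < s) (Lam M : set 'rV[R]_d)
    (hLam : rho_separated rho Lam) (hM : rho_separated rho M)
    (tau : R) (htau : 0 < tau) :
  exists2 L : R, 0 < L &
  exists Q : {linear weighted_space rho eta tau L Lam M -> schwartz R d},
    [/\ continuous Q,
        forall u : weighted_space rho eta tau L Lam M,
          [/\ is_schwartz (frac_lap s (Q u)),
              forall l : Lam, Q u (val l) = (weighted_pair u).1 l &
              forall m : M, frac_lap s (Q u) (val m) = (weighted_pair u).2 m] &
        forall nu : {ffun 'I_d -> nat},
          exists C c : R, [/\ 0 < C, 0 < c &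
            forall (u : weighted_space rho eta tau L Lam M) (x : 'rV[R]_d),
              `|dmulti nu (Q u) x| + `|dmulti nu (frac_lap s (Q u)) x|
              <= C%:C * `|u| * (expR (- c * eucl x `^ eta))%:C]].
Proof.
have [L [c [D [f [[L0 c0] fP fint fF flin]]]]] :=
  real_interpolation hd hrho hrhoeta heta hs htau hLam hM.
have e0 : 0 < eta by exact: lt_trans hrhoeta.
exists L => //; pose V := weighted_space rho eta tau L Lam M.
pose al b (u : V) x := component b (extend (weighted_pair u).1 x).
pose be b (u : V) x := component b (extend (weighted_pair u).2 x).
pose nrm (u : V) := weighted_norm rho eta tau L (weighted_pair u).
have uP (u : V) : has_ubound (range (lam_term rho eta tau L (weighted_pair u))) /\
    has_ubound (range (mu_term eta tau (weighted_pair u))).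
  by have /asboolP := weighted_pairP u.
have dB b (u : V) : bounded_data rho eta tau Lam M L (nrm u) (al b u) (be b u).
  have [u1 u2] := uP u.
  have s1 := range_sup_ge0 u1 (fun t => mulr_ge0 (expR_ge0 _) (cmod_ge0 _)).
  have s2 := range_sup_ge0 u2 (fun t => mulr_ge0 (expR_ge0 _) (cmod_ge0 _)).
  split; rewrite /nrm /weighted_norm; first exact: addr_ge0.
    move=> x Lx; pose l : Lam := SigSub (mem_set Lx).
    apply: le_trans (_ : lam_term rho eta tau L (weighted_pair u) l <= _).
      rewrite /lam_term ler_wpM2l ?expR_ge0//.
      by rewrite -(extend_val (weighted_pair u).1 l); exact: component_le.
    by apply: le_trans (range_supP l u1) _; rewrite lerDl.
  move=> x Mx; pose m : M := SigSub (mem_set Mx).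
  apply: le_trans (_ : mu_term eta tau (weighted_pair u) m <= _).
    rewrite /mu_term ler_wpM2l ?expR_ge0//.
    by rewrite -(extend_val (weighted_pair u).2 m); exact: component_le.
  by apply: le_trans (range_supP m u2) _; rewrite lerDr.
(* b selects the real or imaginary part of the data, and k the interpolant or its fractional
   Laplacian; the two parts are solved for separately. *)
pose ff k b u := f k (al b u) (be b u).
pose F k u := cjet (ff k false u) (ff k true u).
have ffB k b u J x : `|ff k b u J x| <= `|D J| * nrm u * expR (- (c * eucl x `^ eta)).
  have [_ /(_ J x) /le_trans H _] := fP _ _ _ k (dB b u); apply: H.
  have [n0 _ _] := dB b u.
  by rewrite ler_wpM2r ?expR_ge0// ler_wpM2r// ler_norm.
have jff k b u : djet (ff k b u) by have [] := fP _ _ _ k (dB b u).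
have Iff k b u : rintegrable (@lebesgue_tuple R d) (fun t => ff k b u [::] (row_of t)).
  by have [] := fP _ _ _ k (dB b u).
have FS k u : is_schwartz (F k u [::]).
  exact: (schwartz_cjet c0 e0 (jff k false u) (jff k true u) (ffB k false u) (ffB k true u)).
have FI k u : cintegrable (F k u [::]).
  by split; [exact: Iff k false u|exact: Iff k true u].
have lapF u : is_frac_lap s (F false u [::]) (F true u [::]).
  split; [by have [] := FS true u|exact: FI|] => xi.
  have rc b := fF _ _ _ xi (dB b u) cos (or_introl erefl).
  have rs b := fF _ _ _ xi (dB b u) sin (or_intror erefl).
  rewrite (fourierE xi (FI true u)) (fourierE xi (FI false u)).
  have scale (r a b : R) : r%:C * (a +i* b)%C = ((r * a) +i* (r * b))%C.
    by apply/eqP; rewrite eq_complex /= !mul0r subr0 addr0 !eqxx.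
  rewrite scale mulrDr mulrBr -(rc false) -(rc true) -(rs false) -(rs true) //.
have FP k u : F k u [::] \in schwartz_pred (R := R) (d := d) by apply/asboolP.
pose Qf u : schwartz R d := Schwartz (FP false u).
have fracQ u : frac_lap s (Qf u) = F true u [::] by exact: frac_lapE (lapF u).
(* Real linearity is used twice: for the other component of u scaled by a2 plus the component of v,
   and then for the component of u scaled by Re a plus that combination, whose bound is [dB2]. *)
have ff_lin k b (a : R[i]) (u v : V) J x : ff k b (a *: u + v) J x =
    complex.Re a * ff k b u J x +
    ((if b then complex.Im a else - complex.Im a) * ff k (~~ b) u J x + ff k b v J x).
  pose a2 := if b then complex.Im a else - complex.Im a.
  have dB2 : bounded_data rho eta tau Lam M L (`|a2| * nrm u + nrm v)
      (fun x => a2 * al (~~ b) u x + al b v x) (fun x => a2 * be (~~ b) u x + be b v x).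
    have [n1 h1 h1'] := dB (~~ b) u; have [n2 h2 h2'] := dB b v.
    have tri (w p q : R) : 0 <= w -> w * `|p| <= nrm u -> w * `|q| <= nrm v ->
        w * `|a2 * p + q| <= `|a2| * nrm u + nrm v.
      move=> w0 wp wq; apply: le_trans (ler_wpM2l w0 (ler_normD _ _)) _.
      by rewrite mulrDr normrM mulrCA lerD// ler_wpM2l.
    split; first by rewrite addr_ge0// mulr_ge0.
      by move=> y Ly; apply: tri; [exact: expR_ge0|exact: h1|exact: h2].
    by move=> y My; apply: tri; [exact: expR_ge0|exact: h1'|exact: h2'].
  rewrite /ff -(flin _ _ _ _ _ _ _ k (dB (~~ b) u) (dB b v)) -/a2.
  rewrite -(flin _ _ _ _ _ _ _ k (dB b u) dB2); congr (f k _ _ J x); apply/funext => y.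
    rewrite /al -component_lin; congr component; exact: (extend_lin a (weighted_pair u).1).
  rewrite /be -component_lin; congr component; exact: (extend_lin a (weighted_pair u).2).
have Qlin : linear Qf.
  move=> a u v; apply: val_inj; apply/funext => x.
  apply: (etrans (_ : _ = (ff false false (a *: u + v) [::] x +i* ff false true (a *: u + v)
    [::] x)%C)) => //.
  rewrite !ff_lin /= [RHS](_ : _ = a * F false u [::] x + F false v [::] x)//.
  rewrite /F /cjet; case: a => a1 a2; apply/eqP; rewrite eq_complex /=.
  by apply/andP; split; apply/eqP; ring.
pose Q : {linear V -> schwartz R d} := HB.pack Qf (GRing.isLinear.Build _ _ _ _ _ Qlin).
exists Q; split.
- apply: schwartz_continuous => u k nu e e_gt0.
  have [C C0 HC] := poly_subexp_le d k c0 e0.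
  set J := flatten [seq nseq (nu i) i | i <- enum 'I_d].
  have K0 : 0 <= 2 * `|D J| * C by rewrite !mulr_ge0.
  have sB w : schwartz_seminorm k nu (Q w) <= 2 * `|D J| * C * nrm w.
    have [n0 _ _] := dB false w.
    apply: range_sup_le => [|x]; first exact: mulr_ge0.
    rewrite /schwartz_term /dmulti -/J partials_cjet//.
    have p0 : 0 <= (1 + eucl x) ^+ k by rewrite exprn_ge0// addr_ge0 ?eucl_ge0.
    apply: le_trans (ler_wpM2l p0 (cmod_le (ffB false false w J x) (ffB false true w J x))) _.
    have -> : (1 + eucl x) ^+ k * (2 * (`|D J| * nrm w * expR (- (c * eucl x `^ eta)))) =
      2 * `|D J| * nrm w * ((1 + eucl x) ^+ k * expR (- (c * eucl x `^ eta))) by ring.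
    by rewrite [leRHS]mulrAC ler_wpM2l// !mulr_ge0.
  have K1 : 0 < 2 * `|D J| * C + 1 by rewrite ltr_wpDl.
  have del0 : (0 : R[i]) < (e / (2 * `|D J| * C + 1))%:C by rewrite ltcR divr_gt0.
  have := nbhsx_ballx u _ del0; apply: filterS => y; rewrite -ball_normE /= => uy.
  have uy' : nrm (u - y) < e / (2 * `|D J| * C + 1) by rewrite -ltcR.
  have -> : Qf y - Qf u = Q (y - u) by exact: esym (linearB Q y u).
  apply: le_lt_trans (sB _) _.
  have -> : nrm (y - u) = nrm (u - y).
    have : `|y - u| = `|u - y| := distrC y u.
    by move=> /(@complexI R (nrm (y - u)) (nrm (u - y))).
  have [n0 _ _] := dB false (u - y).
  by move: uy'; rewrite ltr_pdivlMr// => h; apply: le_lt_trans h;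
    rewrite mulrC ler_wpM2l// lerDl.
- move=> u; rewrite [frac_lap s (Q u)]fracQ.
  have val_of k (z : R[i]) x : (forall b, ff k b u [::] x = component b z) -> F k u [::] x = z.
    by move=> h; rewrite /F /cjet !h; case: z {h}.
  split; first exact: FS.
    move=> l; apply: (val_of false) => b; have [h _] := fint _ _ _ (dB b u).
    by rewrite /ff h; [rewrite /al extend_val|exact: set_mem (valP l)].
  move=> m; apply: (val_of true) => b; have [_ h] := fint _ _ _ (dB b u).
  by rewrite /ff h; [rewrite /be extend_val|exact: set_mem (valP m)].
- move=> nu; set J := flatten [seq nseq (nu i) i | i <- enum 'I_d].
  have C_gt0 : 0 < 4 * `|D J| + 1 by rewrite ltr_wpDl// mulr_ge0.
  (* [cmod_le] costs a factor 2 for each of the two moduli; the 1 keeps the constant positive even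
     when D J vanishes. *)
  exists (4 * `|D J| + 1), c; split=> // u x; rewrite [frac_lap s (Q u)]fracQ.
  have -> : `|u| = (nrm u)%:C by [].
  have nm (z : R[i]) : `|z| = (cmod z)%:C by [].
  rewrite !nm -rmorphD -!rmorphM lecR /dmulti -/J.
  have bd k : cmod (partials J (F k u [::]) x) <= 2 * (`|D J| * nrm u * expR (- (c * eucl x `^
    eta))).
    by rewrite partials_cjet//; exact: cmod_le.
  apply: le_trans (lerD (bd false) (bd true)) _; rewrite mulNr.
  have [n0 _ _] := dB false u.
  rewrite -mulrDl mulrA ler_wpM2r ?expR_ge0// mulrA ler_wpM2r//; lra.
Qed.
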